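(* Let $\frac12\le H<1$ and $d=1$. Let $n=3$, $\lambda_1=\lambda_2=\frac16$, $\lambda_3=\frac23$, and $$\alpha=\frac{2H\sqrt3+\sqrt3}{2H+1},\qquad \beta=\frac{\sqrt{-96H^2+66H+57}}{2H+1}.$$ Define paths on $[0,1]$ by $$\omega_{t,1}=\begin{cases}(2\alpha-\beta)t,& t\in[0,\frac13],\\ (\alpha-\beta)+(2\beta-\alpha)t,& t\in[\frac13,\frac23],\\ (\beta-\alpha)+(2\alpha-\beta)t,& t\in[\frac23,1],\end{cases}$$ $\omega_{t,2}=-\omega_{t,1}$ and $\omega_{t,3}=0$ for $t\in[0,1]$. Then the weights $\{\lambda_1,\lambda_2,\lambda_3\}$ and the paths $\{\omega_{\cdot,1},\omega_{\cdot,2},\omega_{\cdot,3}\}$ satisfy the cubature formula $$\mathbb{E}\left[\int_{0<t_1<\dots<t_k<1}d\hat B^{i_1}_{t_1}\cdots d\hat B^{i_k}_{t_k}\right]=\sum_{j=1}^{3}\lambda_j\int_{0<t_1<\dots<t_k<1}d\hat\omega^{i_1}_{t_1,j}\cdots d\hat\omega^{i_k}_{t_k,j}$$ of degree $5$ if $\frac12\le H<\frac23$, and of degree $4$ if $\frac23\le H<1$.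
   Context: $B$ is a one-dimensional fractional Brownian motion with Hurst parameter $H$: the continuous centered Gaussian process with covariance $\mathbb{E}[B_aB_b]=\frac12(a^{2H}+b^{2H}-|a-b|^{2H})$. For letters $i\in\{0,1\}$: $\hat B^0_t=t$, $\hat B^1_t=B_t$, $\hat\omega^0_{t,j}=t$, $\hat\omega^1_{t,j}=\omega_{t,j}$. Iterated integrals of $\hat B$ are Young integrals for $H>\frac12$ and Stratonovich integrals for $H=\frac12$. The cubature formula (at time $1$) is of degree $m$ if the displayed identity holds for every word $(i_1,\dots,i_k)$, $k\in\mathbb{N}$, with $i_l\in\{0,1\}$ and $2Hk+(2-2H)\,\mathrm{card}\{l: i_l=0\}\le m$. *)

(* Defs.v *)
From HB Require Import structures.
From mathcomp Require Import all_boot all_order all_algebra.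
From mathcomp Require Import all_classical all_reals all_analysis.
Import Order.TTheory GRing.Theory Num.Theory.
Import numFieldNormedType.Exports.

Set Implicit Arguments.
Unset Strict Implicit.
Unset Printing Implicit Defensive.

Local Open Scope classical_set_scope.
Local Open Scope ring_scope.

(* The k-th point of the partition 0 = p_0 < p_1 < ... < p_(size s) = t given
   by [itv_partition 0 t s]. *)
Definition part_pt (R : realType) (s : seq R) (k : nat) : R := nth 0 (0 :: s) k.

Definition mesh_lt (R : realType) (s : seq R) (delta : R) : Prop :=
  forall k, (k < size s)%N -> part_pt s k.+1 - part_pt s k < delta.

Definition is_tagging (R : realType) (s : seq R) (xi : nat -> R) : Prop :=
  forall k, (k < size s)%N -> part_pt s k <= xi k <= part_pt s k.+1.

(* I is the Riemann-Stieltjes limit, over tagged partitions of [0, t] with mesh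
   tending to 0, of the sums sum_k f(xi_k) (g(p_(k+1)) - g(p_k)).  For Hoelder
   continuous f and g with exponents adding up to more than 1 this is the Young
   integral. *)
Definition is_young_int (R : realType) (f g : R -> R) (t I : R) : Prop :=
  forall eps : R, 0 < eps -> exists2 delta : R, 0 < delta &
    forall (s : seq R) (xi : nat -> R),
      itv_partition 0 t s -> mesh_lt s delta -> is_tagging s xi ->
      `| \sum_(k < size s) f (xi k) * (g (part_pt s k.+1) - g (part_pt s k))
         - I | < eps.

Definition young_int (R : realType) (f g : R -> R) (t : R) : R :=
  xget 0 [set I | is_young_int f g t I].

(* Words over {0, 1} are boolean sequences, [false] standing for the letter 0
   and [true] for 1; the first letter is the innermost integration variable. *)
Definition path_hat (R : realType) (x : R -> R) (i : bool) (t : R) : R :=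
  if i then x t else t.

Definition young_iter (R : realType) (x : R -> R) (w : seq bool) : R -> R :=
  foldl (fun (I : R -> R) (i : bool) (t : R) => young_int I (path_hat x i) t)
        (fun=> 1) w.

Section probability.
Context (d : measure_display) (T : measurableType d) (R : realType)
  (P : probability T R).

(* [normal_prob m 0] is not the Dirac mass at m, whence the case sigma = 0. *)
Definition is_gaussian (X : T -> R) : Prop :=
  exists m sigma : R, forall A : set R, measurable A ->
    P (X @^-1` A) = if sigma == 0 then \d_m A else normal_prob m sigma A.

Definition is_fBm (H : R) (B : R -> {RV P >-> R}) : Prop :=
  [/\ forall omega : T, {within `[0, 1], continuous (fun t => B t omega)},
      forall (n : nat) (c t : 'I_n -> R), (forall k, 0 <= t k <= 1) ->
        is_gaussian (fun omega => \sum_(k < n) c k * B (t k) omega),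
      forall a : R, 0 <= a <= 1 -> ('E_P[B a] = 0)%E
    & forall a b : R, 0 <= a <= 1 -> 0 <= b <= 1 ->
        'E_P[(fun omega => B a omega * B b omega)%R]%E =
        (2^-1 * (a `^ (2 * H) + b `^ (2 * H) - `|a - b| `^ (2 * H)))%:E ].

(* Y is the limit in probability, as the mesh of the (deterministic) partition
   of [0, t] tends to 0, of the sums
   sum_k (X_(p_k) + X_(p_(k+1))) / 2 * (Z_(p_(k+1)) - Z_(p_k)). *)
Definition is_stratonovich_int (X Z : R -> {RV P >-> R}) (t : R)
    (Y : {RV P >-> R}) : Prop :=
  forall eps eta : R, 0 < eps -> 0 < eta -> exists2 delta : R, 0 < delta &
    forall s : seq R, itv_partition 0 t s -> mesh_lt s delta ->
      (P [set omega | (eps < `| \sum_(k < size s)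
            (X (part_pt s k) omega + X (part_pt s k.+1) omega) / 2
            * (Z (part_pt s k.+1) omega - Z (part_pt s k) omega)
          - Y omega |)%R] <= eta%:E)%E.

(* For each t, a random variable determined up to almost sure equality. *)
Definition stratonovich_int (X Z : R -> {RV P >-> R}) (t : R) : {RV P >-> R} :=
  xget (cst 0 : {mfun T >-> R}) [set Y | is_stratonovich_int X Z t Y].

Definition process_hat (B : R -> {RV P >-> R}) (i : bool) (t : R) :
    {RV P >-> R} :=
  if i then B t else (cst t : {mfun T >-> R}).

Definition stratonovich_iter (B : R -> {RV P >-> R}) (w : seq bool) :
    R -> {RV P >-> R} :=
  foldl (fun (I : R -> {RV P >-> R}) (i : bool) (t : R) =>
           stratonovich_int I (process_hat B i) t)
        (fun=> (cst 1 : {mfun T >-> R})) w.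

(* The iterated integral over 0 < t_1 < ... < t_k < 1 of the process
   (t, B_t) along w: Stratonovich for H = 1/2, pathwise Young otherwise. *)
Definition fBm_iter (H : R) (B : R -> {RV P >-> R}) (w : seq bool) : T -> R :=
  if H == 2^-1 then (stratonovich_iter B w 1 : T -> R)
  else fun omega => young_iter (fun t => B t omega) w 1.

Definition word_degree (H : R) (w : seq bool) : R :=
  2 * H * (size w)%:R + (2 - 2 * H) * (count_mem false w)%:R.

Definition cubature_formula (H : R) (B : R -> {RV P >-> R}) (n : nat)
    (lambda : 'I_n -> R) (omega : 'I_n -> R -> R) (m : nat) : Prop :=
  forall w : seq bool, word_degree H w <= m%:R ->
    'E_P[fBm_iter H B w]%E =
    (\sum_(j < n) lambda j * young_iter (omega j) w 1)%:E.

End probability.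

Section weights_and_paths.
Context (R : realType) (H : R).

Definition alpha : R :=
  (2 * H * Num.sqrt 3 + Num.sqrt 3) / (2 * H + 1).

Definition beta : R :=
  Num.sqrt (- 96 * H ^+ 2 + 66 * H + 57) / (2 * H + 1).

Definition omega1 (t : R) : R :=
  if t <= 1 / 3 then (2 * alpha - beta) * t
  else if t <= 2 / 3 then (alpha - beta) + (2 * beta - alpha) * t
  else (beta - alpha) + (2 * alpha - beta) * t.

(* Indices 0, 1, 2 of 'I_3 stand for 1, 2, 3. *)
Definition weights (j : 'I_3) : R := nth 0 [:: 1 / 6; 1 / 6; 2 / 3] j.

Definition paths (j : 'I_3) : R -> R :=
  nth (fun=> 0) [:: omega1; fun t => - omega1 t; fun=> 0] j.

End weights_and_paths.

(* Main.v *)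
(* Every word of degree at most 5 has size plus number of zeros at most 5, whatever H,
   and for such words the identity holds for all H in [1/2, 1).  Integrating by parts
   whenever the integrator is the path x, the iterated integral along the word becomes
   a polynomial in x_1 and the moments int_0^1 u^a x_u^n du, for Young integrals (paths
   with increments o(h^(1/2))) and for trapezoidal sums (increments o(h^(1/3))) alike;
   the sample paths have this regularity by Kolmogorov's chaining argument.  Words with
   an odd number of letters 1 contribute 0 on both sides by symmetry.  The others
   involve only E B_1^2 = 1, E B_1^4 = 3, E int_0^1 B_s B_1 ds = 1/2 and
   E int_0^1 B_s^2 ds = 1 / (2 H + 1), matched on the path side by x_1^2 = alpha^2 = 3,
   int_0^1 x_s ds = alpha / 2 and int_0^1 x_s^2 ds = 3 / (2 H + 1). *)

Require Import Defs.
From HB Require Import structures.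
From mathcomp Require Import all_boot all_order all_algebra.
From mathcomp Require Import all_classical all_reals all_analysis.
From mathcomp Require Import ring lra measurable_realfun.
Import Order.TTheory GRing.Theory Num.Theory.
Import numFieldNormedType.Exports.
Set Implicit Arguments.
Unset Strict Implicit.
Unset Printing Implicit Defensive.
Local Open Scope classical_set_scope.
Local Open Scope ring_scope.

(** * Primitives of continuous functions *)

Section primitive.
Context (R : realType).
Implicit Types (f g : R -> R) (s t : R).

(** Errors are controlled interval by interval: one summand minus the increment of the candidate
    integral is o(t - s), so a whole sum errs by o(1). For an arbitrary tag the error is quadratic
    in the path increments, which suits H > 1/2. At H = 1/2 squared increments are of order t - s;
    the trapezoidal rule cancels the quadratic term and leaves cubes. All estimates are uniform over
    a family of paths, because a limit in probability asks for one mesh serving an event of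
    probability close to 1. The constants: the two opposite paths carry total weight 1/3, so E B_1^2
    = 1 and E B_1^4 = 3 ask for x_1^2 = 3 and x_1^4 = 9, both met by x_1 = sqrt 3. The path is
    symmetric about the point (1/2, alpha / 2), so int x = alpha / 2 whatever beta is. Since int x^2
    = (8 alpha^2 + beta^2) / 27, the remaining parameter beta is fixed by the value 3 / (2 H +
    1). *)

Definition cont01 f := {within `[0, 1], continuous f}.

Definition prim f t : R := \int[lebesgue_measure]_(u in `[0, t]) f u.

Lemma cont01P f : (forall eps : R, 0 < eps -> exists2 delta : R, 0 < delta &
    forall s t, 0 <= s -> s <= t -> t <= 1 -> t - s < delta ->
      `|f t - f s| <= eps) -> cont01 f.
Proof.
move=> H; apply/subspace_continuousP => x /=; rewrite in_itv/= => /andP[x0 x1].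
apply/cvgrPdist_le => /= eps /H[d d0 Hd].
rewrite near_withinE; near=> y; rewrite /= in_itv/= => /andP[y0 y1].
have xyd : `|x - y| < d by near: y; apply: nbhsx_ballx.
have [xy|yx] := leP x y.
  by rewrite distrC; apply: Hd => //; rewrite distrC ger0_norm ?subr_ge0// in xyd.
by apply: Hd => //; [exact: ltW|rewrite ger0_norm ?subr_ge0 ?ltW// in xyd].
Unshelve. all: by end_near. Qed.

Lemma cont01_cst c : cont01 (fun=> c).
Proof. by apply: continuous_subspaceT => x; exact: cvg_cst. Qed.

Lemma cont01_id : cont01 id.
Proof. by apply: continuous_subspaceT => x; exact: cvg_id. Qed.

Lemma cont01D f g : cont01 f -> cont01 g -> cont01 (fun t => f t + g t).
Proof. by move=> cf cg; exact: within_continuousD. Qed.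

Lemma cont01M f g : cont01 f -> cont01 g -> cont01 (fun t => f t * g t).
Proof. by move=> cf cg x; apply: cvgM; [exact: cf|exact: cg]. Qed.

Lemma cont01X f n : cont01 f -> cont01 (fun t => f t ^+ n).
Proof.
move=> cf; elim: n => [|n ih]; first exact: cont01_cst.
by under eq_fun do rewrite exprS; exact: cont01M.
Qed.

Lemma cont01_integrable f t : 0 <= t <= 1 -> cont01 f ->
  lebesgue_measure.-integrable `[0, t] (EFin \o f).
Proof.
move=> /andP[t0 t1] cf; apply: continuous_compact_integrable.
  exact: segment_compact.
apply: continuous_subspaceW cf => x /=; rewrite !in_itv/= => /andP[-> xt].
exact: le_trans t1.
Qed.

Lemma cont01_prim f : cont01 f -> cont01 (prim f).
Proof.
move=> cf; apply: parameterized_integral_continuous => //.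
by apply: cont01_integrable => //; rewrite ler01 lexx.
Qed.

Lemma prim0 f : prim f 0 = 0.
Proof. by rewrite /prim set_itv1 Rintegral_set1. Qed.

Lemma primD f g t : 0 <= t <= 1 -> cont01 f -> cont01 g ->
  prim (fun u => f u + g u) t = prim f t + prim g t.
Proof. by move=> t01 cf cg; rewrite /prim RintegralD//; exact: cont01_integrable. Qed.

Lemma primZ c f t : 0 <= t <= 1 -> cont01 f ->
  prim (fun u => c * f u) t = c * prim f t.
Proof. by move=> t01 cf; rewrite /prim RintegralZl//; exact: cont01_integrable. Qed.

Lemma eq_prim f g t : t <= 1 -> (forall u, 0 <= u <= 1 -> f u = g u) ->
  prim f t = prim g t.
Proof.
move=> t1 fg; apply: eq_Rintegral => u; rewrite inE/= in_itv/= => /andP[u0 ut].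
by apply: fg; rewrite u0 (le_trans ut).
Qed.

Lemma prim_cst c t : 0 <= t -> prim (fun=> c) t = c * t.
Proof.
move=> t0; rewrite /prim Rintegral_cst//= lebesgue_measure_itv/= lte_fin.
case: ltgtP t0 => //= [t0 _|<- _]; first by rewrite subr0.
by [].
Qed.

(** The quantity bounded is the integral over []s, t]] of [f u - f s]. *)
Lemma prim_increment f s t (e : R) : cont01 f -> 0 <= s -> s <= t -> t <= 1 ->
  (forall u, s <= u <= t -> `|f u - f s| <= e) ->
  `|prim f t - prim f s - f s * (t - s)| <= e * (t - s).
Proof.
move=> cf s0 st t1 fe.
have t01 : 0 <= t <= 1 by rewrite (le_trans s0 st) t1.
have intf := cont01_integrable t01 cf.
have ints : lebesgue_measure.-integrable `]s, t] (EFin \o f).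
  apply: integrableS intf => // x /=; rewrite !in_itv/= => /andP[sx ->].
  by rewrite (le_trans s0 (ltW sx)).
have intc (c : R) : lebesgue_measure.-integrable `]s, t] (EFin \o (fun=> c)).
  apply: integrableS (cont01_integrable t01 (@cont01_cst c)) => // x /=.
  rewrite !in_itv/= => /andP[sx ->].
  by rewrite (le_trans s0 (ltW sx)).
have cstE (c : R) : \int[lebesgue_measure]_(x in `]s, t]) c = c * (t - s).
  rewrite Rintegral_cst//= lebesgue_measure_itv/= lte_fin.
  by case: ltgtP st => //= <- _; rewrite subrr.
rewrite /prim Rintegral_itvB//.
rewrite -(cstE (f s)) -RintegralB//.
have intB : lebesgue_measure.-integrable `]s, t] (EFin \o (fun x => f x - f s)).
  rewrite [X in integrable _ _ X](_ : _ = (fun x => (EFin \o f) x - (EFin \o (fun=> f s)) x)%E)//.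
  by apply: integrableB => //; exact: intc.
apply: le_trans (le_normr_Rintegral _ _) _ => //.
rewrite -(cstE e); apply: le_Rintegral => //.
- exact: integrable_norm intB.
- by move=> x /=; rewrite in_itv/= => /andP[sx xt]; apply: fe; rewrite ltW.
Qed.

End primitive.

(** * Errors uniform over a family of paths, and their sums over partitions *)

Section increments.
Context (R : realType) (G : set (R -> R)).
(* A quantity attached to a path x in G and times 0 <= s <= u <= t <= 1, where u is
   the tag in [s, t]. *)
Notation incr := ((R -> R) -> R -> R -> R -> R).
Implicit Types (D b : incr) (F : (R -> R) -> R -> R).

Definition admissible (x : R -> R) (s u t : R) :=
  [/\ G x, 0 <= s, s <= u, u <= t & t <= 1].

Definition bnd b := exists2 M : R, 0 <= M & forall x s u t, admissible x s u t -> `|b x s u t| <= M.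

(* o(1), respectively o(t - s), uniformly over the paths of G. *)
Definition tiny D := forall eps : R, 0 < eps -> exists2 delta : R, 0 < delta &
  forall x s u t, admissible x s u t -> t - s < delta -> `|D x s u t| <= eps.

Definition negl D := forall eps : R, 0 < eps -> exists2 delta : R, 0 < delta &
  forall x s u t, admissible x s u t -> t - s < delta -> `|D x s u t| <= eps * (t - s).

Lemma eq_negl D D' : (forall x s u t, admissible x s u t -> D x s u t = D' x s u t) ->
  negl D' -> negl D.
Proof.
move=> DD' nD eps /nD[d d0 H]; exists d => // x s u t a ts.
by rewrite DD'//; exact: H.
Qed.

Lemma eq_tiny D D' : (forall x s u t, admissible x s u t -> D x s u t = D' x s u t) ->
  tiny D' -> tiny D.
Proof.
move=> DD' nD eps /nD[d d0 H]; exists d => // x s u t a ts.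
by rewrite DD'//; exact: H.
Qed.

Lemma le_negl D D' : (forall x s u t, admissible x s u t -> `|D x s u t| <= D' x s u t) ->
  negl D' -> negl D.
Proof.
move=> DD' nD eps /nD[d d0 H]; exists d => // x s u t a ts.
by apply: (le_trans (DD' _ _ _ _ a)); apply: le_trans (H _ _ _ _ a ts); exact: ler_norm.
Qed.

Lemma neglD D D' : negl D -> negl D' ->
  negl (fun x s u t => D x s u t + D' x s u t).
Proof.
move=> nD nD' eps e0; have e2 : 0 < eps / 2 by rewrite divr_gt0.
have [d d0 H] := nD _ e2; have [d' d0' H'] := nD' _ e2.
exists (Num.min d d') => [|x s u t a]; first by rewrite lt_min d0.
rewrite lt_min => /andP[t1 t2]; apply: le_trans (ler_normD _ _) _.
by rewrite [eps]splitr mulrDl lerD ?H ?H'.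
Qed.

Lemma tinyD D D' : tiny D -> tiny D' ->
  tiny (fun x s u t => D x s u t + D' x s u t).
Proof.
move=> nD nD' eps e0; have e2 : 0 < eps / 2 by rewrite divr_gt0.
have [d d0 H] := nD _ e2; have [d' d0' H'] := nD' _ e2.
exists (Num.min d d') => [|x s u t a]; first by rewrite lt_min d0.
rewrite lt_min => /andP[t1 t2]; apply: le_trans (ler_normD _ _) _.
by rewrite [eps]splitr lerD ?H ?H'.
Qed.

Lemma neglMl b D : bnd b -> negl D ->
  negl (fun x s u t => b x s u t * D x s u t).
Proof.
move=> [M M0 bM] nD eps e0; have M1 : 0 < M + 1 by lra.
have [d d0 H] := nD (eps / (M + 1)) (divr_gt0 e0 M1).
exists d => // x s u t a ts; rewrite normrM.
have -> : eps * (t - s) = (M + 1) * (eps / (M + 1) * (t - s)).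
  by field; rewrite gt_eqF.
by apply: ler_pM => //; [apply: le_trans (bM _ _ _ _ a) _; lra|exact: H].
Qed.

Lemma tinyMl b D : bnd b -> tiny D ->
  tiny (fun x s u t => b x s u t * D x s u t).
Proof.
move=> [M M0 bM] nD eps e0; have M1 : 0 < M + 1 by lra.
have [d d0 H] := nD (eps / (M + 1)) (divr_gt0 e0 M1).
exists d => // x s u t a ts; rewrite normrM.
have -> : eps = (M + 1) * (eps / (M + 1)).
  by field; rewrite gt_eqF.
by apply: ler_pM => //; [apply: le_trans (bM _ _ _ _ a) _; lra|exact: H].
Qed.

Lemma tiny_negl D : tiny D ->
  negl (fun x s u t => D x s u t * (t - s)).
Proof.
move=> nD eps e0; have [d d0 H] := nD _ e0; exists d => // x s u t a ts.
have [_ s0 su ut t1] := a.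
rewrite normrM [X in _ * X]ger0_norm ?subr_ge0 ?(le_trans su)//.
by apply: ler_wpM2r; [rewrite subr_ge0 (le_trans su)|exact: H].
Qed.

Lemma negl_tiny D : negl D -> tiny D.
Proof.
move=> nD eps e0; have [d d0 H] := nD _ e0; exists d => // x s u t a ts.
have [_ s0 su ut t1] := a.
apply: le_trans (H _ _ _ _ a ts) _; rewrite ler_piMr ?(ltW e0)//; lra.
Qed.

Lemma bnd_cst c : bnd (fun _ _ _ _ => c).
Proof. by exists `|c|. Qed.

Lemma bndD b b' : bnd b -> bnd b' ->
  bnd (fun x s u t => b x s u t + b' x s u t).
Proof.
move=> [M M0 H] [M' M'0 H']; exists (M + M') => [|x s u t a]; first exact: addr_ge0.
by apply: le_trans (ler_normD _ _) _; rewrite lerD ?H ?H'.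
Qed.

Lemma bndM b b' : bnd b -> bnd b' ->
  bnd (fun x s u t => b x s u t * b' x s u t).
Proof.
move=> [M M0 H] [M' M'0 H']; exists (M * M') => [|x s u t a]; first exact: mulr_ge0.
by rewrite normrM ler_pM ?H ?H'.
Qed.

Lemma bndX b n : bnd b -> bnd (fun x s u t => b x s u t ^+ n).
Proof.
move=> bb; elim: n => [|n ih]; first exact: bnd_cst.
have [M M0 H] := bndM bb ih; exists M => // x s u t a.
by rewrite exprS; exact: H.
Qed.

Lemma bnd_sum n (b : 'I_n -> incr) : (forall i, bnd (b i)) ->
  bnd (fun x s u t => \sum_(i < n) b i x s u t).
Proof.
elim: n b => [|n ih] b bb.
  by have [M M0 H] := bnd_cst 0; exists M => // x s u t a; rewrite big_ord0; exact: H a.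
have [M M0 H] := bndD (bb ord0) (ih (fun i => b (lift ord0 i)) (fun i => bb _)).
by exists M => // x s u t a; rewrite big_ord_recl; exact: H a.
Qed.

Definition ubounded F := exists2 M : R, 0 <= M & forall x t, G x -> 0 <= t <= 1 -> `|F x t| <= M.

Definition equicont F := ubounded F /\
  forall eps : R, 0 < eps -> exists2 delta : R, 0 < delta & forall x s t,
    G x -> 0 <= s -> s <= t -> t <= 1 -> t - s < delta -> `|F x t - F x s| <= eps.

Lemma equicont_tiny F : equicont F ->
  tiny (fun x s u t => F x t - F x s).
Proof.
case=> _ H eps /H[d d0 {}H]; exists d => // x s u t [Gx s0 su ut t1] ts.
by apply: H => //; exact: le_trans su ut.
Qed.

Lemma equicont_tinyl F : equicont F ->
  tiny (fun x s u t => F x u - F x s).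
Proof.
case=> _ H eps /H[d d0 {}H]; exists d => // x s u t [Gx s0 su ut t1] ts.
by apply: H => //; [exact: le_trans t1|lra].
Qed.

Lemma bnd_left F : ubounded F -> bnd (fun x s u t => F x s).
Proof.
move=> [M M0 H]; exists M => // x s u t [Gx s0 su ut t1]; apply: H => //.
by rewrite s0 (le_trans su)// (le_trans ut).
Qed.

Lemma bnd_right F : ubounded F -> bnd (fun x s u t => F x t).
Proof.
move=> [M M0 H]; exists M => // x s u t [Gx s0 su ut t1]; apply: H => //.
by rewrite t1 (le_trans s0)// (le_trans su).
Qed.

Lemma bnd_mid F : ubounded F -> bnd (fun x s u t => F x u).
Proof.
move=> [M M0 H]; exists M => // x s u t [Gx s0 su ut t1]; apply: H => //.
by rewrite (le_trans s0)// (le_trans ut).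
Qed.

Lemma equicontP F : ubounded F -> tiny (fun x s u t => F x t - F x s) -> equicont F.
Proof.
move=> uF tF; split=> // eps /tF[d d0 H]; exists d => // x s t Gx s0 st t1 ts.
by apply: (H x s t t).
Qed.

Lemma equicont_cst c : equicont (fun _ _ => c).
Proof.
apply: equicontP; first by exists `|c|.
by move=> eps e0; exists 1 => // x s u t _ _; rewrite subrr normr0 ltW.
Qed.

Lemma equicontD F F' : equicont F -> equicont F' -> equicont (fun x t => F x t + F' x t).
Proof.
move=> eF eF'; apply: equicontP.
  have [[M M0 H] _] := eF; have [[M' M'0 H'] _] := eF'.
  exists (M + M') => [|x t Gx t01]; first exact: addr_ge0.
  by apply: le_trans (ler_normD _ _) _; rewrite lerD ?H ?H'.
apply: eq_tiny (tinyD (equicont_tiny eF) (equicont_tiny eF')) => x s u t _ /=.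
by ring.
Qed.

Lemma equicontM F F' : equicont F -> equicont F' -> equicont (fun x t => F x t * F' x t).
Proof.
move=> eF eF'; apply: equicontP.
  have [[M M0 H] _] := eF; have [[M' M'0 H'] _] := eF'.
  exists (M * M') => [|x t Gx t01]; first exact: mulr_ge0.
  by rewrite normrM ler_pM ?H ?H'.
apply: eq_tiny (tinyD (tinyMl (bnd_right eF.1) (equicont_tiny eF'))
  (tinyMl (bnd_left eF'.1) (equicont_tiny eF))) => x s u t _ /=.
by ring.
Qed.

Lemma equicontX F n : equicont F -> equicont (fun x t => F x t ^+ n).
Proof.
move=> eF; elim: n => [|n ih]; first exact: equicont_cst.
by under eq_fun do under eq_fun do rewrite exprS; exact: equicontM.
Qed.

Lemma equicont_cont01 F x : equicont F -> G x -> cont01 (F x).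
Proof.
move=> [_ H] Gx; apply: cont01P => eps /H[d d0 {}H]; exists d => // s t.
exact: H.
Qed.

Lemma prim_negl F : equicont F ->
  negl (fun x s u t => prim (F x) t - prim (F x) s - F x s * (t - s)).
Proof.
move=> eF eps e0; have [_ H] := eF; have [d d0 {}H] := H _ e0.
exists d => // x s u t [Gx s0 su ut t1] ts.
apply: prim_increment => //; first exact: equicont_cont01 eF Gx.
  exact: le_trans su ut.
move=> v /andP[sv vt]; apply: H => //; first exact: le_trans vt t1.
by lra.
Qed.

Lemma tiny_dt : tiny (fun x s u t => t - s).
Proof.
move=> eps e0; exists eps => // x s u t [_ s0 su ut t1] ts.
by rewrite ger0_norm ?subr_ge0 ?(le_trans su)// ltW.
Qed.

Lemma equicont_prim F : equicont F -> equicont (fun x => prim (F x)).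
Proof.
move=> eF; apply: equicontP.
  have [[M M0 H] _] := eF; exists (M + (M + M)) => [|x t Gx /andP[t0 t1]]; first by rewrite !addr_ge0.
  (* The crude oscillation bound [M + M] on [0, t] is enough to bound the primitive. *)
  have : `|prim (F x) t - prim (F x) 0 - F x 0 * (t - 0)| <= (M + M) * (t - 0).
    apply: prim_increment => //; first exact: equicont_cont01 eF Gx.
    move=> u /andP[u0 ut]; apply: le_trans (ler_normB _ _) _.
    by rewrite lerD ?H ?lexx ?ler01// u0 (le_trans ut).
  rewrite prim0 !subr0 => K.
  have -> : prim (F x) t = F x 0 * t + (prim (F x) t - F x 0 * t) by ring.
  apply: le_trans (ler_normD _ _) _; apply: lerD.
    rewrite normrM -[M]mulr1; apply: ler_pM => //; first by rewrite H ?lexx ?ler01.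
    by rewrite ger0_norm.
  by apply: le_trans K _; rewrite ler_piMr// addr_ge0.
have t1 := negl_tiny (prim_negl eF).
have t2 := tinyMl (bnd_left eF.1) tiny_dt.
by apply: eq_tiny (tinyD t1 t2) => x s u t _ /=; ring.
Qed.

(** Local errors below eps (t - s) add up to at most eps times the length of [0, t], which is at
    most 1. The mesh is the same for all paths of [G]. *)
Lemma partition_sum (D : incr) : negl D ->
  forall eps : R, 0 < eps -> exists2 delta : R, 0 < delta &
  forall x t (s : seq R) (xi : nat -> R), G x -> t <= 1 ->
    itv_partition 0 t s -> mesh_lt s delta -> is_tagging s xi ->
    `|\sum_(k < size s) D x (part_pt s k) (xi k) (part_pt s k.+1)| <= eps.
Proof.
move=> nD eps e0; have [d d0 H] := nD _ e0; exists d => // x t s xi Gx t1 ps ms ts.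
apply: le_trans (ler_norm_sum _ _ _) _.
have nthle k : (k <= size s)%N -> 0 <= part_pt s k <= 1.
  move=> ks; rewrite /part_pt; apply/andP; split.
    by rewrite (set_nth_default t)//; exact: (itv_partition_nth_ge _ ps).
  apply: le_trans t1; rewrite (set_nth_default t)//.
  exact: (itv_partition_nth_le _ ps).
have step k : (k < size s)%N ->
  `|D x (part_pt s k) (xi k) (part_pt s k.+1)| <= eps * (part_pt s k.+1 - part_pt s k).
  move=> ks; apply: H; last exact: ms.
  have /andP[? ?] := ts k ks; have /andP[? ?] := nthle k (ltnW ks).
  by have /andP[? ?] := nthle k.+1 ks.
apply: (@le_trans _ _ (\sum_(k < size s) eps * (part_pt s k.+1 - part_pt s k))).
  by apply: ler_sum => k _; exact: step.
rewrite -mulr_sumr.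
rewrite -(big_mkord xpredT (fun k => part_pt s k.+1 - part_pt s k)) telescope_sumr//.
have /andP[a b] := nthle (size s) (leqnn _).
have -> : part_pt s 0 = 0 by [].
by rewrite subr0 ler_piMr ?(ltW e0).
Qed.

End increments.

(** * Iterated integrals as path functionals *)

Section power_sums.
Context (R : realType).
Implicit Types y z : R.

(** The divided difference of the n-th power between z and y; being a polynomial, it stays bounded
    along bounded paths. *)
Definition powsum n y z : R := \sum_(i < n) y ^+ (n.-1 - i) * z ^+ i.

Lemma powsumE n y z : y ^+ n - z ^+ n = (y - z) * powsum n y z.
Proof. exact: subrXX. Qed.

(** The error of the trapezoidal rule for the k-th power between z and y, divided by (y - z)^3. *)
Definition trapezoid_rest k y z : R :=
  (2 * k.+1%:R)^-1 * \sum_(i < k.+1) powsum i y z * powsum (k - i) y z.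

(* Both sides are 1 / (2 (k + 1)) times the sum over i <= k of
   (y^i - z^i) (y^(k-i) - z^(k-i)) (y - z). *)
Lemma trapezoid_error k y z :
  (z ^+ k + y ^+ k) / 2 * (y - z) - (y ^+ k.+1 - z ^+ k.+1) / k.+1%:R =
  trapezoid_rest k y z * (y - z) ^+ 3.
Proof.
have k0 : k.+1%:R != 0 :> R by rewrite pnatr_eq0.
pose S := \sum_(i < k.+1) y ^+ (k - i) * z ^+ i.
have S' : \sum_(i < k.+1) y ^+ i * z ^+ (k - i) = S.
  rewrite /S (reindex_inj rev_ord_inj)/=; apply: eq_bigr => i _.
  by rewrite subSS subKn// -ltnS.
have -> : y ^+ k.+1 - z ^+ k.+1 = (y - z) * S by rewrite subrXX.
(* Each product expands into y^k + z^k minus two cross terms; both cross terms sum to [S], one of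
   them after reversing the summation. *)
have H : \sum_(i < k.+1) (y ^+ i - z ^+ i) * (y ^+ (k - i) - z ^+ (k - i)) =
    k.+1%:R * (z ^+ k + y ^+ k) - 2 * S.
  rewrite (eq_bigr (fun i : 'I_k.+1 => (y ^+ k + z ^+ k)
      - y ^+ i * z ^+ (k - i) - y ^+ (k - i) * z ^+ i)); last first.
    move=> i _; have ik : (i <= k)%N by rewrite -ltnS.
    have yk : y ^+ k = y ^+ i * y ^+ (k - i) by rewrite -exprD subnKC.
    have zk : z ^+ k = z ^+ i * z ^+ (k - i) by rewrite -exprD subnKC.
    by rewrite yk zk; ring.
  rewrite !sumrB S' sumr_const card_ord -/S -mulr_natl; ring.
have -> : trapezoid_rest k y z * (y - z) ^+ 3 = (2 * k.+1%:R)^-1 *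
    ((\sum_(i < k.+1) (y ^+ i - z ^+ i) * (y ^+ (k - i) - z ^+ (k - i))) * (y - z)).
  rewrite /trapezoid_rest -!mulrA; congr (_ * _); rewrite !mulr_suml.
  by apply: eq_bigr => i _; rewrite !powsumE; ring.
by rewrite H; field.
Qed.

End power_sums.

Section functionals.
Context (R : realType).

(* Functionals of a path through which every iterated integral can be written, by
   integrating by parts each time the path itself is the integrator. *)
Inductive pexpr := Zero | Cst of R | Pow of nat | Add of pexpr & pexpr
  | Mul of pexpr & pexpr | Prim of pexpr.

Fixpoint ev (e : pexpr) (x : R -> R) (t : R) : R :=
  match e with
  | Zero => 0
  | Cst c => c
  | Pow n => x t ^+ n
  | Add a b => ev a x t + ev b x t
  | Mul a b => ev a x t * ev b x t
  | Prim a => prim (ev a x) t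
  end.

(* (c, e, k) stands for the process (c + int_0^t e) x_t^k *)
Definition cterm := (R * pexpr * nat)%type.

Definition coef (m : cterm) x t : R := m.1.1 + prim (ev m.1.2 x) t.

Definition evm (m : cterm) x t : R := coef m x t * x t ^+ m.2.

Definition evt (l : seq cterm) x t : R := \sum_(m <- l) evm m x t.

(** With a = c + int e, integration by parts gives int a x^k dx = (a x^(k+1) - int e x^(k+1) du) /
    (k + 1): the first entry has coefficient a / (k + 1), the second is the correction integral.
    Integration in time moves the whole integrand into the density. *)
Definition raw_integ_term (i : bool) (m : cterm) : seq cterm :=
  let: (c, e, k) := m in
  let q := k.+1%:R^-1 in
  if i then [:: (q * c, Mul (Cst q) e, k.+1); (0, Mul (Cst (- q)) (Mul e (Pow k.+1)), 0%N)]
  else [:: (0, Mul (Add (Cst c) (Prim e)) (Pow k), 0%N)].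

(** A constant coefficient needs no correction integral. Dropping it syntactically keeps the
    expressions small enough to evaluate every word by computation; this is why [Zero] is a
    constructor of its own, a real number in [Cst] not being open to pattern matching. *)
Definition integ_term (i : bool) (m : cterm) : seq cterm :=
  match m with
  | (c, Zero, k) => if i then [:: (k.+1%:R^-1 * c, Zero, k.+1)]
                    else [:: (0, Mul (Cst c) (Pow k), 0%N)]
  | _ => raw_integ_term i m
  end.

Definition integ (i : bool) (l : seq cterm) : seq cterm := flatten (map (integ_term i) l).

Lemma evt_cons m l x t : evt (m :: l) x t = evm m x t + evt l x t.
Proof. by rewrite /evt big_cons. Qed.

Lemma evt_cat l l' x t : evt (l ++ l') x t = evt l x t + evt l' x t.
Proof. by rewrite /evt big_cat. Qed.

Lemma evt_nil x t : evt [::] x t = 0.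
Proof. by rewrite /evt big_nil. Qed.

Lemma cont01_ev e x : cont01 x -> cont01 (ev e x).
Proof.
move=> cx; elim: e => [|c|n|a iha b ihb|a iha b ihb|a iha] /=.
- exact: cont01_cst.
- exact: cont01_cst.
- exact: cont01X.
- exact: cont01D.
- exact: cont01M.
- exact: cont01_prim.
Qed.

Lemma integ_termE i m x t : cont01 x -> 0 <= t <= 1 ->
  evt (integ_term i m) x t = evt (raw_integ_term i m) x t.
Proof.
case: m => [[c []]] // k cx t01; have /andP[t0 t1] := t01.
case: i => /=; rewrite !evt_cons !evt_nil /evm /coef /=.
  have -> : prim (fun=> 0) t = 0 by rewrite prim_cst// mul0r.
  have -> : prim (fun=> k.+1%:R^-1 * 0) t = 0 by rewrite prim_cst// mulr0 mul0r.
  have -> : prim (fun u => - k.+1%:R^-1 * (0 * x u ^+ k.+1)) t = 0.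
    rewrite (@eq_prim _ _ (fun=> 0))// => [|u _]; first by rewrite prim_cst// mul0r.
    by ring.
  by ring.
rewrite (@eq_prim _ _ (fun u => (c + prim (fun=> 0) u) * x u ^+ k))// => u /andP[u0 _].
by rewrite prim_cst//; ring.
Qed.

(** Every term is a primitive or carries a positive power of x_0 = 0. Telescoped increments thus
    leave no boundary term at 0. *)
Lemma evt_integ0 i l x : cont01 x -> x 0 = 0 -> evt (integ i l) x 0 = 0.
Proof.
move=> cx x0; elim: l => [|m l ih]; first exact: evt_nil.
rewrite /integ/= evt_cat -/(integ i l) ih addr0 integ_termE ?lexx ?ler01//.
case: m => [[c e] k].
case: i {ih} => /=; rewrite !evt_cons evt_nil /evm /coef /= !prim0 ?x0 ?expr0n /=; ring.
Qed.

Section regular_family.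
Context (p : nat) (G : set (R -> R)).

(* Uniformly over G, increments are o((t - s)^(1/p)).  For p = 2 left-point sums
   converge, for p = 3 trapezoidal sums do. *)
Definition regular_paths := [/\ ubounded G (fun x => x), forall x, G x -> x 0 = 0 &
  forall eps : R, 0 < eps -> exists2 delta : R, 0 < delta &
    forall x s t, G x -> 0 <= s -> s <= t -> t <= 1 -> t - s < delta ->
    `|x t - x s| ^+ p <= eps * (t - s)].

Hypothesis Gp : regular_paths.
Hypothesis p0 : (0 < p)%N.

Let incr_neg : negl G (fun x s u t => `|x t - x s| ^+ p).
Proof.
move=> eps e0; have [_ _ H] := Gp; have [d d0 {}H] := H _ e0.
exists d => // x s u t [Gx s0 su ut t1] ts.
by rewrite ger0_norm ?exprn_ge0//; apply: H => //; exact: le_trans ut.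
Qed.

Lemma equicont_path : equicont G (fun x => x).
Proof.
have [ux _ _] := Gp; apply: equicontP => // eps e0.
have [d d0 H] := negl_tiny incr_neg (exprn_gt0 p e0).
exists d => // x s u t a ts; have := H _ _ _ _ a ts.
by rewrite ger0_norm ?exprn_ge0// ler_pXn2r// nnegrE ltW.
Qed.

Lemma equicont_ev e : equicont G (ev e).
Proof.
elim: e => [|c|n|a iha b ihb|a iha b ihb|a iha] /=.
- exact: equicont_cst.
- exact: equicont_cst.
- exact/equicontX/equicont_path.
- exact: equicontD.
- exact: equicontM.
- exact: equicont_prim.
Qed.

Lemma equicont_coef m : equicont G (coef m).
Proof.
by apply: equicontD; [exact: equicont_cst|exact/equicont_prim/equicont_ev].
Qed.

Lemma equicont_evm m : equicont G (evm m).
Proof.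
by apply: equicontM; [exact: equicont_coef|exact/equicontX/equicont_path].
Qed.

Let bl F : equicont G F -> bnd G (fun x s u t => F x s).
Proof. by case=> uF _; exact: bnd_left. Qed.
Let br F : equicont G F -> bnd G (fun x s u t => F x t).
Proof. by case=> uF _; exact: bnd_right. Qed.
Let bm F : equicont G F -> bnd G (fun x s u t => F x u).
Proof. by case=> uF _; exact: bnd_mid. Qed.

Let bnd_powsum n (f g : (R -> R) -> R -> R -> R -> R) : bnd G f -> bnd G g ->
  bnd G (fun x s u t => powsum n (f x s u t) (g x s u t)).
Proof.
by move=> bf bg; apply: bnd_sum => i; apply: bndM; exact: bndX.
Qed.

Lemma evm_time_left m : negl G (fun x s u t =>
  evm m x s * (t - s) - (evt (raw_integ_term false m) x t - evt (raw_integ_term false m) x s)).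
Proof.
case: m => [[c e] k].
have /prim_negl H : equicont G (ev (Mul (Add (Cst c) (Prim e)) (Pow k))).
  exact: equicont_ev.
apply: (eq_negl _ (neglMl (bnd_cst G (-1)) H)) => x s u t _ /=.
by rewrite !evt_cons !evt_nil /evm /coef /= expr0 ; ring.
Qed.

Lemma evm_time_trapezoid m : negl G (fun x s u t =>
  (evm m x s + evm m x t) / 2 * (t - s) - (evt (raw_integ_term false m) x t - evt (raw_integ_term false m) x s)).
Proof.
have H := tiny_negl (tinyMl (bnd_cst G 2^-1) (equicont_tiny (equicont_evm m))).
apply: (eq_negl _ (neglD (evm_time_left m) H)) => x s u t _ /=.
by field.
Qed.

Lemma evm_time_tagged m : negl G (fun x s u t =>
  evm m x u * (t - s) - (evt (raw_integ_term false m) x t - evt (raw_integ_term false m) x s)).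
Proof.
have H := tiny_negl (equicont_tinyl (equicont_evm m)).
apply: (eq_negl _ (neglD (evm_time_left m) H)) => x s u t _ /=.
by ring.
Qed.

(* With a the coefficient and h = x_t - x_s, the error is
   a_s (trapezoid error for x^k) + (a_t - a_s) x_t^k h / 2 minus the increments of
   a x^(k+1) and of the correction integral, which cancel to first order. *)
Lemma evm_path_trapezoid m : (p <= 3)%N -> negl G (fun x s u t =>
  (evm m x s + evm m x t) / 2 * (x t - x s) - (evt (raw_integ_term true m) x t - evt (raw_integ_term true m) x s)).
Proof.
move=> p3; case: m => [[c e] k].
pose q : R := k.+1%:R^-1.
have ecoef := equicont_coef (c, e, k).
have ex := equicont_path.
have exn n : equicont G (fun x t => x t ^+ n) by exact: equicontX.
have ee := equicont_ev e.
have bh : bnd G (fun x s u t => x t - x s).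
  by have := bndD (br ex) (bndM (bnd_cst G (-1)) (bl ex));
     under eq_fun do under eq_fun do under eq_fun do under eq_fun do rewrite mulN1r.
(* The missing factor (x_t - x_s)^(3 - p) is bounded, so control of p-th powers passes to cubes. *)
have h3 : negl G (fun x s u t => (x t - x s) ^+ 3).
  have [M M0 HM] := bndX (3 - p) bh.
  apply: (le_negl _ (neglMl (bnd_cst G M) incr_neg)) => x s u t a /=.
  by rewrite -(subnK p3) exprD normrM [X in _ * X]normrX ler_wpM2r ?exprn_ge0//; exact: HM a.
have th : tiny G (fun x s u t => x t - x s) by exact: equicont_tiny ex.
have n1 : negl G (fun x s u t => coef (c, e, k) x t - coef (c, e, k) x s - ev e x s * (t - s)).
  apply: (eq_negl _ (prim_negl ee)) => x s u t _.
  by rewrite /coef /=; ring.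
have n2 := prim_negl (equicont_ev (Mul (Cst (- q)) (Mul e (Pow k.+1)))).
have n3 := prim_negl (equicont_ev (Mul (Cst q) e)).
(* [E1] is a_s times the trapezoidal error of x^k. [E2] and [E3] make up (a_t - a_s) x_t^k h / 2,
   with a_t - a_s split into e_s (t - s) and a remainder. [E4], [E5] and [E6] make up -(a_t - a_s)
   x_t^(k+1) / (k + 1) minus the increment of the correction integral. *)
have E1 := neglMl (bndM (bl ecoef) (bndM (bnd_cst G (2 * k.+1%:R)^-1)
  (bnd_sum (fun i : 'I_k.+1 => bndM (bnd_powsum i (br ex) (bl ex))
     (bnd_powsum (k - i) (br ex) (bl ex)))))) h3.
have E2 := neglMl (bndM (bnd_cst G 2^-1) (br (exn k))) (neglMl bh n1).
have E3 := neglMl (bndM (bnd_cst G 2^-1) (br (exn k)))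
  (tiny_negl (tinyMl (bl ee) th)).
have E4 := neglMl (bndM (bnd_cst G (- q)) (br (exn k.+1))) n1.
have E5 := tiny_negl (tinyMl (bndM (bnd_cst G (- q)) (bl ee))
  (equicont_tiny (exn k.+1))).
have E6 := neglMl (bnd_cst G (-1)) n2.
apply: (eq_negl _ (neglD (neglD E1 (neglD E2 E3))
  (neglD (neglD E4 E5) E6))) => x s u t a /=.
rewrite !evt_cons !evt_nil /evm /= !expr0 !mulr1.
have [Gx s0 su ut t1] := a.
have Eq r : 0 <= r <= 1 -> coef (q * c, Mul (Cst q) e, k.+1) x r = q * coef (c, e, k) x r.
  move=> r01; rewrite /coef /= primZ//; first by ring.
  exact: equicont_cont01 ee Gx.
have s01 : 0 <= s <= 1 by rewrite s0 (le_trans su)// (le_trans ut).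
have t01 : 0 <= t <= 1 by rewrite t1 (le_trans s0)// (le_trans su).
rewrite -/q !Eq// /coef /= !add0r !addr0.
rewrite -/(trapezoid_rest k (x t) (x s)).
rewrite -[_ * trapezoid_rest _ _ _ * _]mulrA -trapezoid_error -/q.
move: (prim _ t) (prim _ s) (prim _ t) (prim _ s) (ev e x s) => ? ? ? ? ?.
move: (x t ^+ k.+1) (x s ^+ k.+1) (x t ^+ k) (x s ^+ k) => ? ? ? ?.
by field.
Qed.

(** The value at the tag differs from the trapezoidal mean by half of its increments from s and from
    t. Multiplied by x_t - x_s, these are second-order products, negligible as soon as squared
    increments are. *)
Lemma evm_path_tagged m : (p <= 2)%N -> negl G (fun x s u t =>
  evm m x u * (x t - x s) - (evt (raw_integ_term true m) x t - evt (raw_integ_term true m) x s)).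
Proof.
move=> p2; have p3 : (p <= 3)%N by exact: leqW.
have Etrap := evm_path_trapezoid m p3.
have ex := equicont_path.
have ecoef := equicont_coef m.
have ee := equicont_ev m.1.2.
have exn n : equicont G (fun x t => x t ^+ n) by exact: equicontX.
have th : tiny G (fun x s u t => x t - x s) by exact: equicont_tiny ex.
have bh : bnd G (fun x s u t => x t - x s).
  by have := bndD (br ex) (bndM (bnd_cst G (-1)) (bl ex));
     under eq_fun do under eq_fun do under eq_fun do under eq_fun do rewrite mulN1r.
have h2 : negl G (fun x s u t => (x t - x s) ^+ 2).
  have [M M0 HM] := bndX (2 - p) bh.
  apply: (le_negl _ (neglMl (bnd_cst G M) incr_neg)) => x s u t a /=.
  by rewrite -(subnK p2) exprD normrM [X in _ * X]normrX ler_wpM2r ?exprn_ge0//; exact: HM a.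
(* The estimate for (x_t - x_s)^2 is applied on the subinterval from s to u, which is admissible
   with its right end as tag. *)
have h2l : negl G (fun x s u t => (x u - x s) ^+ 2).
  move=> eps e0; have [d d0 H] := h2 _ e0; exists d => // x s u t [Gx s0 su ut t1] ts.
  have au : admissible G x s u u by split => //; exact: le_trans t1.
  apply: le_trans (H _ _ _ _ au _) _; first by lra.
  by rewrite ler_wpM2l ?(ltW e0)//; lra.
have h2r : negl G (fun x s u t => (x t - x u) ^+ 2).
  move=> eps e0; have [d d0 H] := h2 _ e0; exists d => // x s u t [Gx s0 su ut t1] ts.
  have au : admissible G x u u t by split => //; exact: le_trans su.
  apply: le_trans (H _ _ _ _ au _) _; first by lra.
  by rewrite ler_wpM2l ?(ltW e0)//; lra.
have hl : negl G (fun x s u t => (x u - x s) * (x t - x s)).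
  apply: (le_negl _ (neglD h2l h2)) => x s u t _ /=.
  rewrite normrM; set a := x u - x s; set b := x t - x s.
  rewrite -[a ^+ 2]real_normK ?num_real// -[b ^+ 2]real_normK ?num_real//.
  by have := sqr_ge0 (`|a| - `|b|); have := normr_ge0 a; have := normr_ge0 b; nra.
have hr : negl G (fun x s u t => (x t - x u) * (x t - x s)).
  apply: (le_negl _ (neglD h2r h2)) => x s u t _ /=.
  rewrite normrM; set a := x t - x u; set b := x t - x s.
  rewrite -[a ^+ 2]real_normK ?num_real// -[b ^+ 2]real_normK ?num_real//.
  by have := sqr_ge0 (`|a| - `|b|); have := normr_ge0 a; have := normr_ge0 b; nra.
have [M M0 HM] : bnd G (fun x s u t => ev m.1.2 x s) by exact: bl.
(* The coefficient a is Lipschitz, with constant [M + 1] on short intervals, while the factor x_t -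
   x_s tends to 0. *)
have al : negl G (fun x s u t => (coef m x u - coef m x s) * (x t - x s)).
  have lip := prim_negl ee.
  have [d1 d10 H1] := lip _ ltr01.
  have tM := tinyMl (bnd_cst G (M + 1)) th.
  move=> eps e0; have [d d0 H] := tM _ e0.
  exists (Num.min d d1) => [|x s u t a]; first by rewrite lt_min d0.
  rewrite lt_min => /andP[t1 t2]; have [Gx s0 su ut tle] := a.
  have au : admissible G x s u u by split => //; exact: le_trans tle.
  have Ha := H _ _ _ _ a t1; have HMs := HM _ _ _ _ a.
  have {}H1 : `|prim (ev m.1.2 x) u - prim (ev m.1.2 x) s - ev m.1.2 x s * (u - s)| <= 1 * (u - s).
    by apply: (H1 x s u u) => //; lra.
  have K : `|coef m x u - coef m x s| <= (M + 1) * (t - s).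
    rewrite /coef; have -> : m.1.1 + prim (ev m.1.2 x) u - (m.1.1 + prim (ev m.1.2 x) s) =
       (prim (ev m.1.2 x) u - prim (ev m.1.2 x) s - ev m.1.2 x s * (u - s)) + ev m.1.2 x s * (u - s) by ring.
    apply: le_trans (ler_normD _ _) _; rewrite normrM (ger0_norm (_ : 0 <= u - s)); last by lra.
    have : `|ev m.1.2 x s| * (u - s) <= M * (t - s).
      by apply: ler_pM => //; lra.
    by nra.
  rewrite normrM; apply: (le_trans (ler_wpM2r (normr_ge0 _) K)).
  have ts0 : 0 <= t - s by lra.
  move: Ha; rewrite normrM (ger0_norm (_ : 0 <= M + 1)) => [Ha|]; last by lra.
  by rewrite mulrAC; apply: ler_wpM2r.
have ar : negl G (fun x s u t => (coef m x u - coef m x t) * (x t - x s)).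
  have lip := tiny_negl (tinyMl (bl ee) th).
  have E := neglMl bh (prim_negl ee).
  apply: (eq_negl _ (neglD al (neglMl (bnd_cst G (-1)) (neglD lip E)))) => x s u t _ /=.
  by rewrite /coef; ring.
have E1 := neglMl (bndM (bnd_cst G 2^-1) (bm (exn m.2))) al.
have E2 := neglMl (bndM (bnd_cst G 2^-1) (bm (exn m.2))) ar.
have E3 := neglMl (bndM (bndM (bnd_cst G 2^-1) (bl ecoef)) (bnd_powsum m.2 (bm ex) (bl ex))) hl.
have E4 := neglMl (bndM (bndM (bnd_cst G (- 2^-1)) (br ecoef)) (bnd_powsum m.2 (br ex) (bm ex))) hr.
apply: (eq_negl _ (neglD Etrap (neglD (neglD E1 E2) (neglD E3 E4)))) => x s u t _ /=.
have P1 := powsumE m.2 (x u) (x s); have P2 := powsumE m.2 (x t) (x u).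
rewrite /evm.
have -> : 2^-1 * coef m x s * powsum m.2 (x u) (x s) * ((x u - x s) * (x t - x s)) =
  2^-1 * coef m x s * (x u ^+ m.2 - x s ^+ m.2) * (x t - x s) by rewrite P1; ring.
have -> : - 2^-1 * coef m x t * powsum m.2 (x t) (x u) * ((x t - x u) * (x t - x s)) =
  - 2^-1 * coef m x t * (x t ^+ m.2 - x u ^+ m.2) * (x t - x s) by rewrite P2; ring.
by field.
Qed.

Lemma evt_trapezoid i l : (p <= 3)%N -> negl G (fun x s u t =>
  (evt l x s + evt l x t) / 2 * (path_hat x i t - path_hat x i s)
   - (evt (integ i l) x t - evt (integ i l) x s)).
Proof.
move=> p3; elim: l => [|m l ih].
  apply: (eq_negl _ (neglMl (bnd_cst G 0) incr_neg)) => x s u t _.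
  by rewrite !evt_nil; ring.
have Em : negl G (fun x s u t => (evm m x s + evm m x t) / 2 * (path_hat x i t - path_hat x i s)
   - (evt (integ_term i m) x t - evt (integ_term i m) x s)).
  have Eraw : negl G (fun x s u t => (evm m x s + evm m x t) / 2 * (path_hat x i t - path_hat x i s)
     - (evt (raw_integ_term i m) x t - evt (raw_integ_term i m) x s)).
    by case: i {ih} => /=; [exact: evm_path_trapezoid|exact: evm_time_trapezoid].
  apply: (eq_negl _ Eraw) => x s u t [Gx s0 su ut t1].
  have cx : cont01 x by exact: equicont_cont01 equicont_path Gx.
  have s01 : 0 <= s <= 1 by rewrite s0; lra.
  have t01 : 0 <= t <= 1 by rewrite t1 andbT; lra.
  by rewrite !integ_termE.
apply: (eq_negl _ (neglD Em ih)) => x s u t _.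
by rewrite !evt_cons /integ/= !evt_cat; field.
Qed.

Lemma evt_tagged i l : (p <= 2)%N -> negl G (fun x s u t =>
  evt l x u * (path_hat x i t - path_hat x i s)
   - (evt (integ i l) x t - evt (integ i l) x s)).
Proof.
move=> p3; elim: l => [|m l ih].
  apply: (eq_negl _ (neglMl (bnd_cst G 0) incr_neg)) => x s u t _.
  by rewrite !evt_nil; ring.
have Em : negl G (fun x s u t => evm m x u * (path_hat x i t - path_hat x i s)
   - (evt (integ_term i m) x t - evt (integ_term i m) x s)).
  have Eraw : negl G (fun x s u t => evm m x u * (path_hat x i t - path_hat x i s)
     - (evt (raw_integ_term i m) x t - evt (raw_integ_term i m) x s)).
    by case: i {ih} => /=; [exact: evm_path_tagged|exact: evm_time_tagged].
  apply: (eq_negl _ Eraw) => x s u t [Gx s0 su ut t1].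
  have cx : cont01 x by exact: equicont_cont01 equicont_path Gx.
  have s01 : 0 <= s <= 1 by rewrite s0; lra.
  have t01 : 0 <= t <= 1 by rewrite t1 andbT; lra.
  by rewrite !integ_termE.
apply: (eq_negl _ (neglD Em ih)) => x s u t _.
by rewrite !evt_cons /integ/= !evt_cat; ring.
Qed.

End regular_family.
End functionals.

(** * Limits of Riemann sums and iterated integrals *)

Section sums.
Context (R : realType).

(** Limits over partitions of small mesh are not vacuous, whence the uniqueness of Young and
    Stratonovich integrals. The uniform partition serves, or the empty list if t = 0. *)
Lemma exists_partition (t delta : R) : 0 <= t -> 0 < delta ->
  exists2 s, itv_partition 0 t s & mesh_lt s delta.
Proof.
rewrite le_eqVlt => /predU1P[<- _|t0 d0]; first by exists [::] => //; split.
pose N := (Num.bound (t / delta)).+1.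
have N0 : 0 < N%:R :> R by rewrite ltr0n.
have tN : t / N%:R < delta.
  rewrite ltr_pdivrMr// mulrC -ltr_pdivrMr//.
  apply: lt_trans (archi_boundP _) _; first by rewrite divr_ge0 ?ltW.
  by rewrite ltr_nat.
pose s := mkseq (fun i => t * i.+1%:R / N%:R) N.
have ptE k : (k <= N)%N -> part_pt s k = t * k%:R / N%:R.
  case: k => [|k] kN; first by rewrite /part_pt/= mulr0 mul0r.
  by rewrite /part_pt/= nth_mkseq.
have incE k : (k < N)%N -> part_pt s k.+1 - part_pt s k = t / N%:R.
  move=> kN; rewrite (ptE _ kN) (ptE _ (ltnW kN)) -mulrBl -mulrBr.
  by rewrite mulrSr addrAC subrr add0r mulr1.
exists s; last by move=> k; rewrite size_mkseq => kN; rewrite incE.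
split.
  apply/(pathP 0) => k; rewrite size_mkseq => kN.
  rewrite -[X in X < _]/(part_pt s k) -[X in _ < X]/(part_pt s k.+1).
  by rewrite -subr_gt0 incE// divr_gt0.
rewrite (last_nth 0) size_mkseq -[X in X == _]/(part_pt s N) ptE//.
by rewrite mulfK// gt_eqF.
Qed.

Lemma part_pt_ge0 (t : R) s k : itv_partition 0 t s -> (k <= size s)%N -> 0 <= part_pt s k.
Proof.
by move=> ps ks; rewrite /part_pt (set_nth_default t)//; exact: (itv_partition_nth_ge _ ps).
Qed.

Lemma part_pt_le (t : R) s k : itv_partition 0 t s -> (k <= size s)%N -> part_pt s k <= t.
Proof.
by move=> ps ks; rewrite /part_pt (set_nth_default t)//; exact: (itv_partition_nth_le _ ps).
Qed.

Lemma part_pt_last (t : R) s : itv_partition 0 t s -> part_pt s (size s) = t.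
Proof. exact: itv_partition_nth_size. Qed.

Lemma partition_telescope (F : R -> R) t s : itv_partition 0 t s ->
  \sum_(k < size s) (F (part_pt s k.+1) - F (part_pt s k)) = F t - F 0.
Proof.
move=> ps; rewrite -(big_mkord xpredT (fun k => F (part_pt s k.+1) - F (part_pt s k))).
by rewrite telescope_sumr// (part_pt_last ps).
Qed.

Lemma left_tagging (t : R) s : itv_partition 0 t s -> is_tagging s (part_pt s).
Proof.
move=> [ps _] k ks; rewrite lexx/= ltW//.
by have /(pathP 0)/(_ _ ks) := ps.
Qed.

Lemma young_int_unique (f g : R -> R) t I : 0 <= t -> is_young_int f g t I ->
  young_int f g t = I.
Proof.
move=> t0 fgI; apply: xget_unique => // J fgJ.
apply/eqP; rewrite -subr_eq0 -normr_le0; apply/ler_addgt0Pl => e e0; rewrite addr0.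
have e2 : 0 < e / 2 by rewrite divr_gt0.
have [d1 d10 H1] := fgI _ e2; have [d2 d20 H2] := fgJ _ e2.
have [||s ps ms] := @exists_partition t (Num.min d1 d2) => //; first by rewrite lt_min d10.
have ms1 : mesh_lt s d1.
  by move=> k ks; apply: lt_le_trans (ms k ks) _; rewrite ge_min lexx.
have ms2 : mesh_lt s d2.
  by move=> k ks; apply: lt_le_trans (ms k ks) _; rewrite ge_min lexx orbT.
have {}H1 := H1 s (part_pt s) ps ms1 (left_tagging ps).
have {}H2 := H2 s (part_pt s) ps ms2 (left_tagging ps).
set S := \sum_(k < size s) _ in H1 H2.
have -> : J - I = (S - I) - (S - J) by ring.
apply: le_trans (ler_normB _ _) _; rewrite [e]splitr.
by apply: lerD; exact: ltW.
Qed.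

Definition iterated (w : seq bool) : seq (cterm R) :=
  foldl (fun l i => integ i l) [:: (1, Zero R, 0%N)] w.

Lemma evt_iterated_nil x (t : R) : 0 <= t -> evt (iterated [::]) x t = 1.
Proof.
by move=> t0; rewrite /iterated/= evt_cons evt_nil /evm /coef/= prim_cst//; ring.
Qed.

(** The mesh is common to all paths of [G] and all end points t, as needed for convergence in
    probability on an event where the sample paths lie in [G]. *)
Lemma trapezoid_sums p (G : set (R -> R)) i l : (0 < p <= 3)%N -> regular_paths p G ->
  forall eps : R, 0 < eps -> exists2 delta : R, 0 < delta &
  forall x t s, G x -> t <= 1 -> itv_partition 0 t s -> mesh_lt s delta ->
    `|\sum_(k < size s) (evt l x (part_pt s k) + evt l x (part_pt s k.+1)) / 2 *
        (path_hat x i (part_pt s k.+1) - path_hat x i (part_pt s k))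
      - evt (integ i l) x t| <= eps.
Proof.
move=> /andP[p0 p3] Gp eps e0.
have [d d0 H] := partition_sum (evt_trapezoid Gp p0 i l p3) e0.
exists d => // x t s Gx t1 ps ms.
have := H x t s _ Gx t1 ps ms (left_tagging ps).
rewrite sumrB (partition_telescope (evt (integ i l) x) ps) evt_integ0 ?subr0//.
  exact: equicont_cont01 (equicont_path Gp p0) Gx.
by have [_ -> ] := Gp.
Qed.

Lemma young_int_evt (G : set (R -> R)) i l x t : regular_paths 2 G -> G x -> 0 <= t <= 1 ->
  young_int (evt l x) (path_hat x i) t = evt (integ i l) x t.
Proof.
move=> Gp Gx /andP[t0 t1]; apply: young_int_unique => // eps e0.
have e2 : 0 < eps / 2 by rewrite divr_gt0.
have [d d0 H] := partition_sum (evt_tagged Gp isT i l (leqnn 2)) e2.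
exists d => // s xi ps ms ts.
have := H x t s xi Gx t1 ps ms ts.
rewrite sumrB (partition_telescope (evt (integ i l) x) ps) evt_integ0 ?subr0//; first 1 last.
- exact: equicont_cont01 (equicont_path Gp _) Gx.
- by have [_ -> ] := Gp.
by move=> K; apply: le_lt_trans K _; lra.
Qed.

(** The sums sample the integrand at tags in [0, t] only. Iterates are known only on [0, 1], so
    equality there has to suffice. *)
Lemma eq_young_int (f f' g : R -> R) t : 0 <= t <= 1 ->
  (forall u, 0 <= u <= 1 -> f u = f' u) -> young_int f g t = young_int f' g t.
Proof.
move=> /andP[t0 t1] ff'; congr (xget _ _); apply/seteqP; split => I HI eps e0.
  have [d d0 H] := HI _ e0; exists d => // s xi ps ms ts.
  have := H s xi ps ms ts; congr (`|_ - _| < _); apply: eq_bigr => k _.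
  rewrite ff'//; have /andP[a b] := ts k (ltn_ord k).
  rewrite (le_trans (part_pt_ge0 ps (ltnW (ltn_ord k))) a)/=.
  by apply: le_trans b (le_trans (part_pt_le ps (ltn_ord k)) t1).
have [d d0 H] := HI _ e0; exists d => // s xi ps ms ts.
have := H s xi ps ms ts; congr (`|_ - _| < _); apply: eq_bigr => k _.
rewrite ff'//; have /andP[a b] := ts k (ltn_ord k).
rewrite (le_trans (part_pt_ge0 ps (ltnW (ltn_ord k))) a)/=.
by apply: le_trans b (le_trans (part_pt_le ps (ltn_ord k)) t1).
Qed.

Lemma young_iterE (G : set (R -> R)) x w t : regular_paths 2 G -> G x -> 0 <= t <= 1 ->
  young_iter x w t = evt (iterated w) x t.
Proof.
(* The word is consumed from its innermost letter, so the induction needs an arbitrary starting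
   integrand. *)
move=> Gp Gx t01; suff: forall I l, (forall u, 0 <= u <= 1 -> I u = evt l x u) ->
    foldl (fun (I : R -> R) (i : bool) (t : R) => young_int I (path_hat x i) t) I w t =
    evt (foldl (fun l i => integ i l) l w) x t.
  by apply=> u /andP[u0 _]; exact: (esym (evt_iterated_nil x u0)).
elim: w => [|i w ih] I l H /=; first exact: H.
apply: ih => u u01; rewrite (eq_young_int _ u01 H).
exact: young_int_evt Gx u01.
Qed.

End sums.

(** * Fundamental theorem of calculus and integration by parts *)

Section primitive_calculus.
Context (R : realType).
Implicit Types (f g F : R -> R).

Lemma derivable_prim f : cont01 f -> derivable_oo_LRcontinuous (prim f) 0 1.
Proof.
move=> cf; have /(continuous_within_itvP _ ltr01)[_ c0 c1] := cont01_prim cf.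
split => // t; rewrite in_itv/= => /andP[t0 t1].
have i1 : lebesgue_measure.-integrable `[0, 1] (EFin \o f).
  by apply: cont01_integrable => //; rewrite ler01 lexx.
apply: (proj1 (continuous_FTC1_closed t1 i1 t0 _)).
by apply: (within_continuous_continuous _ cf) => //; rewrite in_itv/= t0.
Qed.

Lemma derive1_prim f : cont01 f -> {in `]0, 1[, derive1 (prim f) =1 f}.
Proof.
move=> cf t; rewrite in_itv/= => /andP[t0 t1].
have i1 : lebesgue_measure.-integrable `[0, 1] (EFin \o f).
  by apply: cont01_integrable => //; rewrite ler01 lexx.
apply: (proj2 (continuous_FTC1_closed t1 i1 t0 _)).
by apply: (within_continuous_continuous _ cf) => //; rewrite in_itv/= t0.
Qed.

Lemma prim_FTC f F t : 0 < t -> {within `[0, t], continuous f} ->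
  derivable_oo_LRcontinuous F 0 t -> {in `]0, t[, derive1 F =1 f} ->
  prim f t = F t - F 0.
Proof.
move=> t0 cf dF Ff; rewrite /prim /Rintegral (@continuous_FTC2 _ f F)//.
Qed.

Lemma derivable_LR_continuous F a b : (forall t : R, derivable F t 1) ->
  derivable_oo_LRcontinuous F a b.
Proof.
move=> dF; have cF : continuous F.
  by move=> t; apply: differentiable_continuous; apply/derivable1_diffP.
by split; [move=> t _|exact/cvg_at_right_filter/cF|exact/cvg_at_left_filter/cF].
Qed.

Lemma prim_expn n t : 0 <= t -> prim (fun u : R => u ^+ n) t = t ^+ n.+1 / n.+1%:R.
Proof.
rewrite le_eqVlt => /predU1P[<-|t0]; first by rewrite prim0 expr0n mul0r.
rewrite (@prim_FTC _ (fun u : R => u ^+ n.+1 / n.+1%:R))//.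
- by rewrite expr0n mul0r subr0.
- apply: continuous_subspaceT => u; exact: exprn_continuous.
- apply: derivable_LR_continuous => u; apply: derivableM => //.
  exact: exprn_derivable.
- move=> u _; rewrite derive1Mr; last exact: exprn_derivable.
  by rewrite exp_derive1 /GRing.scale/= mulrAC divff ?mul1r// pnatr_eq0.
Qed.

(** Integration by parts of the identity against [prim x]. It brings a double time integral of the
    path back to moments. *)
Lemma prim_prim (x : R -> R) : cont01 x -> prim (prim x) 1 = prim x 1 - prim (fun u => u * x u) 1.
Proof.
move=> cx.
have := @Rintegration_by_parts R id (prim x) (fun=> 1) x 0 1 ltr01 (@cont01_cst R 1)
  _ _ cx (derivable_prim cx) (derive1_prim cx).
rewrite mul1r mul0r subr0 /prim => ->; first last.
- by move=> u _; rewrite derive1_id.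
- by apply: derivable_LR_continuous => u; exact: derivable_id.
rewrite opprB addrC subrK.
by apply: eq_Rintegral => u _; rewrite mul1r.
Qed.

End primitive_calculus.

(** * Closed forms along short words *)

Section word_values.
Context (R : realType) (x : R -> R).
Hypothesis cx : cont01 x.

Definition moment a n := prim (fun u => u ^+ a * x u ^+ n) 1.

Lemma prim_moment (c : R) a n (f : R -> R) :
  (forall u, 0 <= u <= 1 -> f u = c * (u ^+ a * x u ^+ n)) -> prim f 1 = c * moment a n.
Proof.
move=> fE; rewrite /moment -primZ ?ler01 ?lexx//; first exact: eq_prim.
by apply: cont01M; apply: cont01X => //; exact: cont01_id.
Qed.

Lemma prim_prim_moment : prim (prim x) 1 = moment 0 1 - moment 1 1.
Proof.
by rewrite prim_prim// /moment; congr (_ - _);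
  apply: eq_prim => // u _; rewrite ?expr0 ?expr1 ?mul1r.
Qed.

Lemma moment00 : moment 0 0 = 1.
Proof.
rewrite /moment (@eq_prim _ _ (fun=> 1))//; first by rewrite prim_cst// mul1r.
by move=> u _; rewrite !expr0 mulr1.
Qed.

Lemma moment10 : moment 1 0 = 2^-1.
Proof.
rewrite /moment (@eq_prim _ _ (fun u => u ^+ 1))// => [|u _]; last by rewrite expr0 mulr1.
by rewrite prim_expn// expr1n mul1r.
Qed.

(** Primitives nested inside an integrand of this shape are those of the constant 1; they are
    replaced by u, after which [field] recognises c u^a x_u^n. *)
Ltac solve_moment :=
  let u := fresh "u" in let u01 := fresh "u01" in
  move=> u u01 /=;
  repeat match goal with |- context [prim ?f u] =>
    rewrite (@eq_prim _ f (fun=> 1));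
      [rewrite prim_cst; [|by case/andP: u01]|by case/andP: u01|by move=> ? ?; field]
  end; by field.

Ltac to_moment c a n :=
  match goal with |- context [prim ?f 1] =>
    rewrite (@prim_moment c a n f); [|solve_moment] end.

(** Coefficient and exponents cannot be found by unification. The candidates are tried in turn, and
    a wrong one fails in the closing [field]. *)
Ltac to_moment_all :=
  first [to_moment (0 : R) 0%N 0%N | to_moment (1 : R) 0%N 1%N | to_moment (-1 : R) 0%N 1%N
   | to_moment (1 : R) 0%N 2%N | to_moment (-1 : R) 0%N 2%N
   | to_moment (2^-1 : R) 0%N 1%N | to_moment (- 2^-1 : R) 0%N 1%N
   | to_moment (2^-1 : R) 0%N 2%N | to_moment (- 2^-1 : R) 0%N 2%N
   | to_moment (2^-1 : R) 0%N 3%N | to_moment (- 2^-1 : R) 0%N 3%N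
   | to_moment (1 : R) 0%N 3%N | to_moment (-1 : R) 0%N 3%N
   | to_moment (6^-1 : R) 0%N 3%N | to_moment (- 6^-1 : R) 0%N 3%N
   | to_moment (1 : R) 0%N 0%N | to_moment (2^-1 : R) 0%N 0%N | to_moment (6^-1 : R) 0%N 0%N
   | to_moment (1 : R) 1%N 0%N | to_moment (1 : R) 1%N 1%N | to_moment (-1 : R) 1%N 1%N].

(* m_(a,n) = int_0^1 u^a x_u^n du.  The values are meant for words of size plus number
   of zeros at most 5; the default case covers the words without the letter 0. *)
Definition word_value (w : seq bool) : R :=
  match w with
  | [:: false] => 1
  | [:: false; false] => 1 / 2
  | [:: true; false] => moment 0 1
  | [:: false; true] => x 1 - moment 0 1
  | [:: true; true; false] => moment 0 2 / 2
  | [:: true; false; true] => moment 0 1 * x 1 - moment 0 2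
  | [:: false; true; true] => x 1 ^+ 2 / 2 - moment 0 1 * x 1 + moment 0 2 / 2
  | [:: false; false; true] => x 1 / 2 - moment 1 1
  | [:: false; true; false] => 2 * moment 1 1 - moment 0 1
  | [:: true; false; false] => moment 0 1 - moment 1 1
  | [:: true; true; true; false] => moment 0 3 / 6
  | [:: true; true; false; true] => moment 0 2 * x 1 / 2 - moment 0 3 / 2
  | [:: true; false; true; true] =>
      moment 0 1 * x 1 ^+ 2 / 2 - moment 0 2 * x 1 + moment 0 3 / 2
  | [:: false; true; true; true] =>
      x 1 ^+ 3 / 6 - moment 0 1 * x 1 ^+ 2 / 2 + moment 0 2 * x 1 / 2 - moment 0 3 / 6
  | _ => x 1 ^+ size w / (size w)`!%:R
  end.

Lemma prim_prim_scaled (c : R) (f g : R -> R) :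
  (forall u, 0 <= u <= 1 -> f u = prim g u) -> (forall u, 0 <= u <= 1 -> g u = c * x u) ->
  prim f 1 = c * (moment 0 1 - moment 1 1).
Proof.
move=> fg gx; rewrite -prim_prim_moment -primZ ?ler01 ?lexx//; last exact: cont01_prim.
apply: eq_prim => // u u01; rewrite fg// -primZ//.
by apply: eq_prim => //; case/andP: u01.
Qed.

Ltac to_double c :=
  match goal with |- context [prim ?f 1] =>
    rewrite (@prim_prim_scaled c f (fun u => c * x u));
      [|move=> u /andP[_ u1]; rewrite expr0 mulr1 add0r;
        apply: eq_prim => // ? ?; by field|by []] end.

(** The bound leaves twenty words; for each, the integration by parts is unfolded and every
    remaining integral is recognised as a multiple of a moment, or as a double integral of the
    path. *)
Lemma evt_iterated w : (size w + count_mem false w <= 5)%N ->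
  evt (iterated R w) x 1 = word_value w.
Proof.
case: w => [|[] [|[] [|[] [|[] [|[] [|? ?]]]]]] // _.
all: rewrite /iterated /= /integ /= !evt_cons !evt_nil /evm /coef /=.
all: rewrite /factorial /=; repeat first [to_moment_all | to_double (1 : R) | to_double (-1 : R)].
all: by rewrite ?moment00 ?moment10; field.
Qed.
End word_values.

(** * The cubature paths *)

Section piecewise.
Context (R : realType).
Implicit Types (f g x : R -> R).

Lemma prim_quadratic (c0 c1 c2 t : R) : 0 <= t <= 1 ->
  prim (fun u => c0 + (c1 * u + c2 * u ^+ 2)) t =
  c0 * t + (c1 * (t ^+ 2 / 2) + c2 * (t ^+ 3 / 3)).
Proof.
move=> t01; have /andP[t0 t1] := t01.
have cX n : cont01 (fun u : R => u ^+ n) by apply: cont01X; exact: cont01_id.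
have cZ c n : cont01 (fun u : R => c * u ^+ n) by apply: cont01M => //; exact: cont01_cst.
have -> : (fun u => c0 + (c1 * u + c2 * u ^+ 2)) = (fun u => c0 + (c1 * u ^+ 1 + c2 * u ^+ 2)).
  by apply/funext => u; rewrite expr1.
rewrite primD//; [|exact: cont01_cst|by apply: cont01D].
by rewrite primD// !primZ// prim_cst// !prim_expn.
Qed.

Lemma eq_prim_increment f g (a b : R) : cont01 f -> cont01 g -> 0 <= a -> a <= b -> b <= 1 ->
  (forall u, a < u <= b -> f u = g u) -> prim f b - prim f a = prim g b - prim g a.
Proof.
move=> cf cg a0 ab b1 fg.
have b01 : 0 <= b <= 1 by rewrite b1 (le_trans a0).
have i1 := cont01_integrable b01 cf; have i2 := cont01_integrable b01 cg.
rewrite /prim !Rintegral_itvB//.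
by apply: eq_Rintegral => u; rewrite inE/= in_itv/=; exact: fg.
Qed.

Lemma lipschitz_regular x (L : R) : x 0 = 0 ->
  (forall s t, 0 <= s -> s <= t -> t <= 1 -> `|x t - x s| <= L * (t - s)) ->
  regular_paths 2 [set x].
Proof.
move=> x0 lip.
have L0 : 0 <= L.
  by have := lip 0 1 (lexx 0) ler01 (lexx 1); rewrite subr0 mulr1; apply: le_trans.
split => [|_ ->//|eps e0].
- exists L => // _ t -> /andP[t0 t1].
  have := lip 0 t (lexx 0) t0 t1; rewrite x0 !subr0 => /le_trans; apply.
  by rewrite ler_piMr.
- exists (eps / (L ^+ 2 + 1)); first by rewrite divr_gt0// ltr_wpDl// sqr_ge0.
  move=> _ s t -> s0 st t1 ts.
  have ts0 : 0 <= t - s by rewrite subr_ge0.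
  have L2 : 0 < L ^+ 2 + 1 by rewrite ltr_wpDl// sqr_ge0.
  apply: (@le_trans _ _ ((L * (t - s)) ^+ 2)).
    by rewrite ler_pXn2r// ?nnegrE ?mulr_ge0//; exact: lip.
  rewrite exprMn [(t - s) ^+ 2]expr2 mulrA; apply: ler_wpM2r => //.
  move: ts; rewrite ltr_pdivlMr// => ts; apply: le_trans (ltW ts).
  by rewrite mulrC; apply: ler_wpM2l => //; lra.
Qed.

End piecewise.

Section omega_paths.
Context (R : realType) (H : R).
Hypothesis hH : 2^-1 <= H < 1.
Notation alpha := (alpha H).
Notation beta := (beta H).
Notation omega1 := (omega1 H).

Let H0 : 2 * H + 1 != 0. Proof. by case/andP: hH => h1 _; apply/eqP; lra. Qed.

Lemma alphaE : alpha = Num.sqrt 3.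
Proof. by rewrite /alpha; field. Qed.

Lemma alpha_sqr : alpha ^+ 2 = 3.
Proof. by rewrite alphaE sqr_sqrtr. Qed.

(** This value solves (8 * 3 + beta^2) / 27 = 3 / (2 H + 1). The radicand is (57 - 48 H) (2 H + 1),
    nonnegative on the range of H, so the square root is a true one. *)
Lemma beta_sqr : beta ^+ 2 = 81 / (2 * H + 1) - 24.
Proof.
rewrite /beta exprMn sqr_sqrtr; first by field.
by case/andP: hH => h1 h2; nra.
Qed.

(** A 1-Lipschitz function whose multiples, added to a linear path, produce the change of slope on
    the middle third. The Lipschitz bound of [omega1] follows without comparing its pieces. *)
Definition ramp (t : R) : R :=
  if t <= 1 / 3 then 0 else if t <= 2 / 3 then t - 1 / 3 else 1 / 3.

Lemma omega1E t : omega1 t = (2 * alpha - beta) * t + 3 * (beta - alpha) * ramp t.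
Proof. by rewrite /omega1 /ramp; do 2 (case: ifP => _; first by field); field. Qed.

Lemma ramp_lip s t : s <= t -> `|ramp t - ramp s| <= t - s.
Proof.
move=> st; rewrite ler_norml /ramp.
by case: (leP t (1/3)) => ?; case: (leP s (1/3)) => ?; case: (leP t (2/3)) => ?;
   case: (leP s (2/3)) => ?; apply/andP; split; lra.
Qed.

Lemma omega1_lip s t : s <= t ->
  `|omega1 t - omega1 s| <= (`|2 * alpha - beta| + `|3 * (beta - alpha)|) * (t - s).
Proof.
move=> st; rewrite !omega1E [leRHS]mulrDl.
have -> : (2 * alpha - beta) * t + 3 * (beta - alpha) * ramp t -
    ((2 * alpha - beta) * s + 3 * (beta - alpha) * ramp s) =
    (2 * alpha - beta) * (t - s) + 3 * (beta - alpha) * (ramp t - ramp s) by ring.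
apply: le_trans (ler_normD _ _) _; apply: lerD; rewrite normrM.
  by rewrite [X in _ * X <= _]ger0_norm ?subr_ge0.
by apply: ler_wpM2l => //; exact: ramp_lip.
Qed.

Lemma omega1_0 : omega1 0 = 0.
Proof. by rewrite /omega1 divr_ge0// mulr0. Qed.

Lemma omega1_1 : omega1 1 = alpha.
Proof. 
rewrite /omega1; case: (leP (1:R) (1/3)) => [?|_]; first by lra.
by case: (leP (1:R) (2/3)) => [?|_]; [lra|ring].
Qed.

Lemma omega1_regular : regular_paths 2 [set omega1].
Proof. by apply: lipschitz_regular omega1_0 _ => s t _ st _; exact: omega1_lip. Qed.

Lemma opp_omega1_regular : regular_paths 2 [set (fun t => - omega1 t)].
Proof.
apply: lipschitz_regular => [|s t _ st _]; first by rewrite omega1_0 oppr0.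
by rewrite -opprD normrN; exact: omega1_lip.
Qed.

Lemma zero_regular : regular_paths 2 [set (fun=> 0 : R)].
Proof.
apply: (@lipschitz_regular _ _ 0) => // s t _ _ _; by rewrite subrr normr0 mul0r.
Qed.

Lemma cont01_omega1 : cont01 omega1.
Proof. by apply: (equicont_cont01 (equicont_path omega1_regular _)). Qed.

(** Over the three thirds of [0, 1], the function u integrates to 1/18, 3/18, 5/18 and u^2 to 1/81,
    7/81, 19/81. *)
Lemma prim_piecewise (f : R -> R) (a b c a' b' c' a'' b'' c'' : R) : cont01 f ->
  (forall u, 0 <= u <= 1 / 3 -> f u = a + (b * u + c * u ^+ 2)) ->
  (forall u, 1 / 3 < u <= 2 / 3 -> f u = a' + (b' * u + c' * u ^+ 2)) ->
  (forall u, 2 / 3 < u <= 1 -> f u = a'' + (b'' * u + c'' * u ^+ 2)) ->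
  prim f 1 = (a + a' + a'') / 3 + (b + 3 * b' + 5 * b'') / 18
    + (c + 7 * c' + 19 * c'') / 81.
Proof.
move=> cf H1 H2 H3.
have cq p q r : cont01 (fun u : R => p + (q * u + r * u ^+ 2)).
  apply: cont01D; first exact: cont01_cst.
  apply: cont01D; apply: cont01M; try exact: cont01_cst; first exact: cont01_id.
  exact/cont01X/cont01_id.
have h0 : 0 <= (1 / 3 : R) by lra.
have h1 : (1 / 3 : R) <= 2 / 3 by lra.
have h2 : (2 / 3 : R) <= 1 by lra.
have h3 : (1 / 3 : R) <= 1 by lra.
have h4 : 0 <= (2 / 3 : R) by lra.
have H1' u : 0 < u <= 1 / 3 -> f u = a + (b * u + c * u ^+ 2).
  by move=> /andP[/ltW u0 u1]; apply: H1; rewrite u0.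
have E1 := eq_prim_increment cf (cq a b c) (lexx 0) h0 h3 H1'.
have E2 := eq_prim_increment cf (cq a' b' c') h0 h1 h2 H2.
have E3 := eq_prim_increment cf (cq a'' b'' c'') h4 h2 (lexx 1) H3.
have i0 : 0 <= (0 : R) <= 1 by rewrite lexx ler01.
have i1 : 0 <= (1 : R) <= 1 by rewrite lexx ler01.
have i13 : 0 <= (1 / 3 : R) <= 1 by rewrite h0.
have i23 : 0 <= (2 / 3 : R) <= 1 by rewrite h4.
move: E1 E2 E3; rewrite prim0 !prim_quadratic// => E1 E2 E3.
have -> : prim f 1 = (prim f 1 - prim f (2/3)) + (prim f (2/3) - prim f (1/3))
  + (prim f (1/3) - 0) by ring.
by rewrite E1 E2 E3; field.
Qed.

(** The value reflects the symmetry x_(1-t) = alpha - x_t, and so does not depend on beta. *)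
Lemma omega1_moment1 : moment omega1 0 1 = alpha / 2.
Proof.
rewrite /moment (@prim_piecewise _ 0 (2 * alpha - beta) 0 (alpha - beta) (2 * beta - alpha) 0
  (beta - alpha) (2 * alpha - beta) 0).
- by field.
- apply: cont01M; first exact: cont01_cst.
  exact/cont01X/cont01_omega1.
- move=> u /andP[_ u1]; rewrite /omega1 u1 expr0 expr1; ring.
- move=> u /andP[u1 u2]; rewrite /omega1 leNgt u1/= u2 expr0 expr1; ring.
- move=> u /andP[u1 u2]; rewrite /omega1.
  have -> : (u <= 1 / 3) = false by apply/negbTE; rewrite -ltNge; lra.
  rewrite leNgt u1/= expr0 expr1; ring.
Qed.

Lemma omega1_moment2 : moment omega1 0 2 = 3 / (2 * H + 1).
Proof.
rewrite /moment (@prim_piecewise _ 0 0 ((2 * alpha - beta) ^+ 2)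
  ((alpha - beta) ^+ 2) (2 * (alpha - beta) * (2 * beta - alpha)) ((2 * beta - alpha) ^+ 2)
  ((beta - alpha) ^+ 2) (2 * (beta - alpha) * (2 * alpha - beta)) ((2 * alpha - beta) ^+ 2)).
(* The integral of the squared path for arbitrary alpha and beta; only now are their values used. *)
- transitivity ((8 * alpha ^+ 2 + beta ^+ 2) / 27); first by field.
  by rewrite alpha_sqr beta_sqr; field.
- apply: cont01M; first exact: cont01_cst.
  exact/cont01X/cont01_omega1.
- move=> u /andP[_ u1]; rewrite /omega1 u1 expr0; ring.
- move=> u /andP[u1 u2]; rewrite /omega1 leNgt u1/= u2 expr0; ring.
- move=> u /andP[u1 u2]; rewrite /omega1.
  have -> : (u <= 1 / 3) = false by apply/negbTE; rewrite -ltNge; lra.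
  rewrite leNgt u1/= expr0; ring.
Qed.

End omega_paths.

(** * Gaussian moments *)

Section gauss.
Import HBNNSimple.
Context (R : realType).
Notation mu := (@lebesgue_measure R).

(** Usual extension from indicators, where it is the definition of [normal_prob], to simple
    functions and then to monotone limits. *)
Lemma ge0_integral_normal_prob (m s : R) (f : _ -> \bar R) :
  measurable_fun setT f -> (forall x, 0 <= f x)%E ->
  (\int[normal_prob m s]_x f x = \int[mu]_x (f x * (normal_pdf m s x)%:E))%E.
Proof.
move=> mf f0.
have mp : measurable_fun [set: g_sigma_algebraType (R.-ocitv.-measurable)] (fun x => (normal_pdf m s x)%:E).
  by apply/measurable_EFinP; exact: measurable_normal_pdf.
have p0 x : (0 <= (normal_pdf m s x)%:E)%E by rewrite lee_fin normal_pdf_ge0.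
pose f_ := nnsfun_approx measurableT mf.
transitivity (lim (\int[normal_prob m s]_x (f_ n x)%:E @[n --> \oo])%E).
  rewrite -monotone_convergence//=.
  - apply: eq_integral => ? /[!inE] xD; apply/esym/cvg_lim => //=.
    exact: cvg_nnsfun_approx.
  - by move=> n; exact/measurable_EFinP/measurable_funTS.
  - by move=> n ? _; rewrite lee_fin.
  - by move=> ? _ ? ? mn; rewrite lee_fin; exact/lefP/nd_nnsfun_approx.
rewrite [X in _ = X](_ : _ = lim
    (\int[mu]_x ((f_ n x)%:E * (normal_pdf m s x)%:E) @[n --> \oo])%E); last first.
  rewrite -monotone_convergence//=.
  - apply: eq_integral => x _; apply/esym/cvg_lim => //.
    by apply: cvgeZr => //; exact: cvg_nnsfun_approx.
  - by move=> n; apply: emeasurable_funM => //; exact/measurable_EFinP/measurable_funTS.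
  - by move=> n x _; rewrite mule_ge0// lee_fin.
  - move=> x _ a b ab; rewrite lee_wpmul2r// lee_fin; exact/lefP/nd_nnsfun_approx.
apply: congr_lim; apply/funext => n /=.
under eq_integral do rewrite fimfunE -fsumEFin//.
rewrite [LHS]ge0_integral_fsum//; last 2 first.
  - move=> r; exact/measurable_EFinP/measurableT_comp.
  - by move=> r x _; exact: nnfun_muleindic_ge0.
under [RHS]eq_integral => x _.
  rewrite fimfunE -fsumEFin// ge0_mule_fsuml; last first.
    by move=> r; exact: nnfun_muleindic_ge0.
  over.
rewrite [RHS]ge0_integral_fsum//; last 2 first.
  - by move=> r; apply: emeasurable_funM => //; exact/measurable_EFinP/measurableT_comp.
  - by move=> r x _; rewrite mule_ge0//; exact: nnfun_muleindic_ge0.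
apply: eq_fsbigr => r _.
under [RHS]eq_integral do rewrite EFinM -muleA.
rewrite integralZl_indic_nnsfun//= integral_indic//= setIT.
have [r0|r0] := ltP r 0.
  rewrite preimage_nnfun0//= measure0 mule0.
  by rewrite integral0_eq// => x _; rewrite indicE in_set0 mul0e mule0.
rewrite ge0_integralZl//; last 2 first.
- apply: emeasurable_funM => //; exact/measurable_EFinP.
- by move=> x _; rewrite mule_ge0// lee_fin.
congr (_ * _)%E; rewrite /normal_prob [LHS]integral_mkcond.
apply: eq_integral => x _; rewrite patchE indicE.
by case: ifP; rewrite ?mul1e ?mul0e.
Qed.

End gauss.

(** * Random variables with a given finite expectation *)

Section hasE.
Context (d : measure_display) (T : measurableType d) (R : realType) (P : probability T R).
Implicit Types (X Y : T -> R) (a b c : R).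

(** Integrability travels with the value, so that linear combinations of expectations raise no side
    condition. *)
Definition hasE X a := P.-integrable [set: T] (EFin \o X) /\ (\int[P]_w (X w)%:E = a%:E)%E.

Lemma hasE_measurable X a : hasE X a -> measurable_fun [set: T] X.
Proof. by case=> /measurable_int/measurable_EFinP. Qed.

Lemma hasE_unique X a b : hasE X a -> hasE X b -> a = b.
Proof. by case=> _ Xa [_]; rewrite Xa => -[]. Qed.

Lemma hasE_ex X : P.-integrable [set: T] (EFin \o X) -> exists a, hasE X a.
Proof.
move=> iX; exists (fine (\int[P]_w (X w)%:E)); split => //.
by rewrite fineK//; exact: integrable_fin_num iX.
Qed.

Lemma hasE_expectation X a : hasE X a -> 'E_P[X]%E = a%:E.
Proof. by case=> _ <-; rewrite unlock. Qed.

Lemma eq_hasE X Y a b : X =1 Y -> a = b -> hasE X a -> hasE Y b.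
Proof. by move=> /funext -> ->. Qed.

Lemma hasE_cst c : hasE (fun=> c) c.
Proof.
split; first exact: finite_measure_integrable_cst.
by rewrite integral_cst// [X in (_ * X)%E]probability_setT mule1.
Qed.

Lemma hasED X Y a b : hasE X a -> hasE Y b -> hasE (fun w => X w + Y w) (a + b).
Proof.
move=> [iX EX] [iY EY]; split.
  exact: (integrableD measurableT iX iY).
by under eq_integral do rewrite EFinD; rewrite integralD// EX EY.
Qed.

Lemma hasEZ c X a : hasE X a -> hasE (fun w => c * X w) (c * a).
Proof.
move=> [iX EX]; split.
  exact: (integrableZl measurableT c iX).
by under eq_integral do rewrite EFinM; rewrite integralZl// EX.
Qed.

Lemma hasEB X Y a b : hasE X a -> hasE Y b -> hasE (fun w => X w - Y w) (a - b).
Proof.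
move=> hX hY; apply: eq_hasE (hasED hX (hasEZ (-1) hY)) => [w|]; by rewrite mulN1r.
Qed.

Lemma hasE_le X Y a b : hasE X a -> hasE Y b -> (forall w, X w <= Y w) -> a <= b.
Proof.
move=> [iX EX] [iY EY] XY; rewrite -lee_fin -EX -EY.
by apply: le_integral => // w _; rewrite lee_fin.
Qed.

Lemma hasE_dominated X Y b : measurable_fun [set: T] X -> hasE Y b ->
  (forall w, `|X w| <= Y w) -> exists2 a, hasE X a & `|a| <= b.
Proof.
move=> mX hY XY; have [iY EY] := hY.
have iX : P.-integrable [set: T] (EFin \o X).
  apply: le_integrable iY => //; first exact/measurable_EFinP.
  move=> w _ /=; rewrite lee_fin; apply: le_trans (XY w) _; exact: ler_norm.
have [a hX] := hasE_ex iX; exists a => //; rewrite ler_norml; apply/andP; split.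
  rewrite lerNl -mulN1r; apply: (hasE_le (hasEZ (-1) hX) hY) => w.
  by rewrite mulN1r; apply: le_trans (XY w); rewrite -normrN ler_norm.
by apply: (hasE_le hX hY) => w; apply: le_trans (XY w); exact: ler_norm.
Qed.

Lemma ge0_hasE X a : measurable_fun [set: T] X -> (forall w, 0 <= X w) ->
  (\int[P]_w (X w)%:E = a%:E)%E -> hasE X a.
Proof.
move=> mX X0 EX; split=> //; apply/integrableP; split; first exact/measurable_EFinP.
by under eq_integral do rewrite /= ger0_norm//; rewrite EX ltry.
Qed.

Lemma ae_eq_hasE X Y a : measurable_fun [set: T] Y -> hasE X a ->
  {ae P, forall w, X w = Y w} -> hasE Y a.
Proof.
move=> mY hX XY; have mX := hasE_measurable hX; case: hX => iX EX.
have E : ae_eq P [set: T] (EFin \o X) (EFin \o Y).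
  by apply: filterS XY => w /= ->.
have mEX : measurable_fun [set: T] (EFin \o X) by exact/measurable_EFinP.
have mEY : measurable_fun [set: T] (EFin \o Y) by exact/measurable_EFinP.
split.
  apply/integrableP; split => //; have /integrableP[_] := iX.
  congr (_ < _)%E; apply: ae_eq_integral => //; try exact: measurableT_comp.
  by apply: filterS XY => w /= ->.
by rewrite -EX; apply: ae_eq_integral => //; exact: ae_eq_sym.
Qed.

Lemma hasE_eq0 X : hasE X 0 -> (forall w, 0 <= X w) -> {ae P, forall w, X w = 0}.
Proof.
move=> hX X0; have mX := hasE_measurable hX; case: hX => iX EX.
have [|H _] := @ae_eq_integral_abs _ _ _ P setT measurableT (EFin \o X).
  exact/measurable_EFinP.
have : ae_eq P setT (EFin \o X) (cst 0%E).
  by apply: H; rewrite -[RHS]EX; apply: eq_integral => w _ /=; rewrite ger0_norm.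
by apply: filterS => w /(_ I) /= [].
Qed.

Lemma hasE_markov X a (t : R) : hasE X a -> (forall w, 0 <= X w) -> 0 < t ->
  (P [set w | t <= X w]%R <= (a / t)%:E)%E.
Proof.
move=> hX X0 t0; have mX := hasE_measurable hX; case: hX => iX EX.
set A := [set w | t <= X w].
have mA : measurable A.
  have := mX measurableT _ (measurable_itv `[t, +oo[).
  by rewrite setTI; congr measurable; apply/seteqP; split => w /=; rewrite in_itv/= andbT.
rewrite mulrC EFinM -lee_pdivrMl ?invr_gt0// invrK -EX.
have -> : (P A = \int[P]_w (\1_A w)%:E)%E by rewrite integral_indic// setIT.
rewrite -ge0_integralZl//=; last 2 first.
- exact/measurable_EFinP/measurable_indic.
- by rewrite lee_fin ltW.
apply: ge0_le_integral => //=.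
- by move=> w _; rewrite -EFinM lee_fin mulr_ge0 ?(ltW t0)// indicE ler0n.
- by apply/measurable_EFinP; apply: measurable_funM => //; exact: measurable_indic.
- exact/measurable_EFinP.
- move=> w _; rewrite -EFinM lee_fin indicE; case: (boolP (w \in _)) => [|_].
    by rewrite inE/= mulr1.
  by rewrite mulr0.
Qed.

End hasE.

(** * Expectations under a Gaussian law as integrals against its density *)

Section gauss_transfer.
Context (R : realType).
Notation mu := (@lebesgue_measure R).

(** The line is cut at 0 and the substitution y to -y exchanges the two half-lines. *)
Lemma ge0_integral_reflection (G : R -> R) : continuous G -> (forall y, 0 <= G y) ->
  (\int[mu]_y (G (- y))%:E = \int[mu]_y (G y)%:E)%E.
Proof.
move=> cG G0.
have split_half (F : R -> R) : continuous F -> (forall y, 0 <= F y) ->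
  (\int[mu]_y (F y)%:E = \int[mu]_(y in `]-oo, 0%R]) (F y)%:E
     + \int[mu]_(y in `[0%R, +oo[) (F y)%:E)%E.
  move=> cF F0.
  have mF : measurable_fun [set: R] (EFin \o F).
    by apply/measurable_EFinP; exact: continuous_measurable_fun.
  rewrite -(integral_itv_obnd_cbnd (r := 0)); last exact: measurable_funTS.
  rewrite -ge0_integral_setU//=.
  - congr (integral _ _ _); apply/seteqP; split => // y _ /=.
    by rewrite !in_itv/= andbT; case: (leP y 0) => ?; [left|right].
  - exact: measurable_funTS.
  - by move=> y _; rewrite lee_fin.
  - apply/disj_setPS => y []/=; rewrite !in_itv/= andbT => y0.
    by move=> /lt_le_trans/(_ y0); rewrite ltxx.
have cGN : continuous (G \o -%R).
  by move=> y; apply: continuous_comp; [exact: opp_continuous|exact: cG].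
rewrite (split_half _ cG G0) (split_half _ cGN) //=.
have cw (F : R -> R) A : continuous F -> {within A, continuous F}.
  by move=> cF; exact: continuous_subspaceT.
have H1 := @ge0_integration_by_substitutionNy R G 0 (cw _ _ cG) (fun y _ => G0 y).
have H2 := @ge0_integration_by_substitutionNy R (G \o -%R) 0 (cw _ _ cGN) (fun y _ => G0 (- y)).
rewrite oppr0 in H1 H2; rewrite H1 H2.
rewrite addeC; congr (_ + _)%E.
by apply: eq_integral => y _ /=; rewrite opprK.
Qed.

Lemma normal_pdf_even (s y : R) : s != 0 -> normal_pdf 0 s (- y) = normal_pdf 0 s y.
Proof.
by move=> s0; rewrite normal_pdfE// /normal_fun !subr0 sqrrN.
Qed.

Lemma normal_pdf_shift (m s y : R) : s != 0 -> normal_pdf m s y = normal_pdf 0 s (y - m).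
Proof. by move=> s0; rewrite !normal_pdfE// /normal_fun subr0. Qed.

Let tilt_exponent (c k z y : R) : k != 0 -> z != 0 -> c = (k - 1) / (2 * (z * k)) ->
  - (c * y ^+ 2) + - y ^+ 2 / (z * k *+ 2) = - y ^+ 2 / (z *+ 2).
Proof.
by move=> k0 z0 ->; field; rewrite k0 z0.
Qed.

(** With k = 1 + 2 c s^2, multiplying by exp(-c y^2) replaces the variance s^2 by s^2 / k, and the
    change of normalisation is k^(-1/2). Negative c is allowed while k > 0, which gives exponential
    moments. *)
Lemma normal_pdf_tilt (c s y : R) : s != 0 -> 0 < 1 + 2 * c * s ^+ 2 ->
  expR (- (c * y ^+ 2)) * normal_pdf 0 s y =
  (Num.sqrt (1 + 2 * c * s ^+ 2))^-1 * normal_pdf 0 (s / Num.sqrt (1 + 2 * c * s ^+ 2)) y.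
Proof.
move=> s0 k0; set k := 1 + 2 * c * s ^+ 2 in k0 *.
have rk0 : 0 < Num.sqrt k by rewrite sqrtr_gt0.
have rk0' : Num.sqrt k != 0 by rewrite gt_eqF.
rewrite !normal_pdfE ?mulf_neq0 ?invr_eq0// /normal_fun /normal_peak !subr0.
have E : s ^+ 2 = (s / Num.sqrt k) ^+ 2 * k.
  by rewrite exprMn exprVn sqr_sqrtr ?ltW// divfK// gt_eqF.
have -> : s ^+ 2 * pi *+ 2 = k * ((s / Num.sqrt k) ^+ 2 * pi *+ 2).
  by rewrite E; ring.
rewrite (sqrtrM _ (ltW k0)) invfM mulrCA -!mulrA; congr (_ * (_ * _)).
rewrite -expRD; congr expR; rewrite E.
have : (s / Num.sqrt k) ^+ 2 != 0 by rewrite expf_neq0// mulf_neq0// invr_eq0.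
move: E; set z := (s / Num.sqrt k) ^+ 2 => E z0.
have k0' : k != 0 by rewrite gt_eqF.
have kE : c = (k - 1) / (2 * (z * k)) by rewrite -E /k; field.
exact: tilt_exponent.
Qed.

Section transfer.
Context (d : measure_display) (T : measurableType d) (P : probability T R).
Context (X : T -> R) (m s : R).
Hypothesis mX : measurable_fun [set: T] X.
Hypothesis s0 : s != 0.
Hypothesis lawX : forall A : set R, measurable A -> P (X @^-1` A) = normal_prob m s A.

Lemma ge0_gaussian_integral (f : R -> R) : continuous f -> (forall y, 0 <= f y) ->
  (\int[P]_w (f (X w - m))%:E = \int[mu]_y (f y * normal_pdf 0 s y)%:E)%E.
Proof.
move=> cf f0.
have cshift : continuous (fun y : R => y - m).
  by move=> y; apply: (@cvgB _ R^o); [exact: cvg_id|exact: cvg_cst].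
have cfm : continuous (fun y => f (y - m)).
  by move=> y; apply: (continuous_comp (cshift y)); exact: cf.
have mf : measurable_fun [set: R] (fun y : R => f (y - m)) by exact: continuous_measurable_fun.
have cpdf := @continuous_normal_pdf R 0 s s0.
pose g (y : R) := (f (y - m))%:E.
have mg : measurable_fun [set: R] g by exact/measurable_EFinP.
have g0 y : (0 <= g y)%E by rewrite lee_fin.
transitivity (\int[normal_prob m s]_y g y)%E.
  pose X' : T -> g_sigma_algebraType (R.-ocitv.-measurable) := X.
  have mX' : measurable_fun [set: T] X' := mX.
  rewrite -[LHS](@ge0_integral_pushforward _ _ _ _ _ X' mX' P setT g) //.
  by apply: eq_measure_integral => A mA _; exact: lawX.
rewrite ge0_integral_normal_prob//.
have F' : derive1 (fun y : R => y - m) = cst 1.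
  apply/funext => y; rewrite derive1E deriveB// derive_id derive_cst subr0//.
rewrite (@increasing_ge0_integration_by_substitutionT _ (fun y => y - m)
  (fun y => f y * normal_pdf 0 s y)) ?F'//.
- apply: eq_integral => y _; rewrite /g fctE /= mulr1 -EFinM normal_pdf_shift//.
- by move=> x y xy; rewrite ltrD2r.
- by move=> y; exact: cvg_cst.
- exact: is_cvg_cst.
- exact: is_cvg_cst.
- exact: cvg_addrr_Ny.
- exact: cvg_addrr.
- by move=> y; apply: cvgM; [exact: cf|exact: cpdf].
- by move=> y; rewrite mulr_ge0// normal_pdf_ge0.
Qed.

End transfer.
End gauss_transfer.

(** * Gaussian moments from the expectation of exp(-c Y^2) *)

Section expansions.
Context (R : realType).
Implicit Types (u c A B K : R).

Lemma squeeze_eq A B K c0 : 0 < c0 ->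
  (forall c, 0 < c -> c <= c0 -> `|A - B| <= K * c) -> A = B.
Proof.
move=> c00 H; apply/eqP; rewrite -subr_eq0 -normr_le0; apply/ler_addgt0Pl => e e0.
rewrite addr0; have K0 : 0 < `|K| + 1 by rewrite ltr_wpDl.
pose c := Num.min c0 (e / (`|K| + 1)).
have cp : 0 < c by rewrite lt_min c00 divr_gt0.
have cc0 : c <= c0 by rewrite ge_min lexx.
have ce : c * (`|K| + 1) <= e by rewrite -ler_pdivlMr// ge_min lexx orbT.
apply: le_trans (H c cp cc0) _; have := ler_norm K; nra.
Qed.

(* Moments are read off E exp(-c Y^2) = (1 + 2 c s^2)^(-1/2) as c tends to 0. *)
Lemma rsqrt_expansion u : 0 <= u <= 1 ->
  `|(Num.sqrt (1 + u))^-1 - (1 - u / 2 + 3 / 8 * u ^+ 2)| <= u ^+ 3.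
Proof.
move=> /andP[u0 u1]; set p := 1 - u / 2 + 3 / 8 * u ^+ 2; set r := Num.sqrt (1 + u).
have r2 : r ^+ 2 = 1 + u by rewrite sqr_sqrtr//; lra.
have r1 : 1 <= r by rewrite -sqrtr1 ler_sqrt; lra.
have p0 : 0 <= p by rewrite /p; nra.
have D1 : 1 <= (p * r + 1) * r by nra.
have D0 : (p * r + 1) * r != 0 by rewrite gt_eqF//; lra.
have r0 : r != 0 by rewrite gt_eqF//; lra.
(* The conjugate factor [p * r + 1] removes the root: the numerator contains only r^2 = 1 + u. *)
have -> : r^-1 - p = (1 - p ^+ 2 * r ^+ 2) / ((p * r + 1) * r).
  apply: (mulIf D0); rewrite divfK//.
  transitivity ((p * r + 1) * (r^-1 * r) - p * r * (p * r + 1)); first by ring.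
  by rewrite mulVf//; ring.
rewrite r2; have -> : 1 - p ^+ 2 * (1 + u) = - (u ^+ 3 * (5 / 8 - 15 / 64 * u + 9 / 64 * u ^+ 2)).
  by rewrite /p; field.
rewrite mulNr normrN normrM ger0_norm; last first.
  by rewrite mulr_ge0 ?exprn_ge0//; nra.
rewrite ger0_norm ?invr_ge0; last by lra.
rewrite ler_pdivrMr; last by lra.
have u3 : 0 <= u ^+ 3 by rewrite exprn_ge0.
rewrite ler_wpM2l//; nra.
Qed.

(** For the lower bound, exp(-u) (1 + u) <= 1 gives 1 - exp(-u) >= u exp(-u), which is at least u (1
    - u). *)
Lemma expRN_bounds u : 0 <= u -> u - u ^+ 2 <= 1 - expR (- u) <= u.
Proof.
move=> u0; apply/andP; split; last by have := expR_ge1Dx (- u); lra.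
have e1 := expR_ge1Dx u; have e0 := expR_gt0 u.
have : expR (- u) * (1 + u) <= 1.
  rewrite expRN -ler_pdivlMl ?invr_gt0// invrK mulr1//.
have := expR_gt0 (- u); nra.
Qed.

End expansions.

Section gaussian_moments.
Context (R : realType) (d : measure_display) (T : measurableType d) (P : probability T R).
Context (X : T -> R) (m s : R).
Hypothesis mX : measurable_fun [set: T] X.
Hypothesis s0 : s != 0.
Hypothesis lawX : forall A : set R, measurable A -> P (X @^-1` A) = normal_prob m s A.

Let Y w := X w - m.

Let mY : measurable_fun [set: T] Y.
Proof. exact: measurable_funB. Qed.

Let s2 : 0 < s ^+ 2. Proof. by rewrite exprn_even_gt0. Qed.

Lemma hasE_exp_square c : 0 < 1 + 2 * c * s ^+ 2 ->
  hasE P (fun w => expR (- (c * Y w ^+ 2))) (Num.sqrt (1 + 2 * c * s ^+ 2))^-1.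
Proof.
move=> k0; have cf : continuous (fun y : R => expR (- (c * y ^+ 2))).
  move=> y; apply: continuous_comp; last exact: continuous_expR.
  apply: (@cvgN _ R^o); apply: cvgM; first exact: cvg_cst.
  exact: exprn_continuous.
apply: ge0_hasE => [|w|].
- have mf : measurable_fun [set: R] (fun y : R => expR (- (c * y ^+ 2))).
    exact: continuous_measurable_fun.
  exact: measurableT_comp mf mY.
- exact: expR_ge0.
rewrite (ge0_gaussian_integral mX s0 lawX cf)//.
under eq_integral do rewrite normal_pdf_tilt// EFinM.
rewrite ge0_integralZl//=.
- by rewrite integral_normal_pdf mule1.
- by apply/measurable_EFinP; exact: measurable_normal_pdf.
- by move=> y _; rewrite lee_fin normal_pdf_ge0.
Qed.

(** With u = Y^2 / (4 s^2), the moment is dominated through u^q <= q! exp(u). The choice c = -1 / (4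
    s^2) makes 1 + 2 c s^2 equal to 1/2, so E exp(u) = sqrt 2, bounded by 2. The chaining argument
    uses the factor (s^2)^q and the fact that every q is allowed. *)
Lemma hasE_even_moment q : exists2 a, hasE P (fun w => Y w ^+ (2 * q)) a &
  a <= 2 * q`!%:R * 4 ^+ q * (s ^+ 2) ^+ q.
Proof.
pose c := - (4 * s ^+ 2)^-1.
have k : 1 + 2 * c * s ^+ 2 = 2^-1 by rewrite /c; field.
have hE : hasE P (fun w => expR (- (c * Y w ^+ 2))) (Num.sqrt 2^-1)^-1.
  by have := @hasE_exp_square c; rewrite k; apply.
pose C : R := q`!%:R * (4 * s ^+ 2) ^+ q.
have hC := hasEZ C hE.
have bnd w : `|Y w ^+ (2 * q)| <= C * expR (- (c * Y w ^+ 2)).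
  have u0 : 0 <= Y w ^+ 2 / (4 * s ^+ 2) by rewrite divr_ge0 ?sqr_ge0// mulr_ge0// ltW.
  rewrite ger0_norm; last by rewrite exprM exprn_ge0// sqr_ge0.
  have -> : - (c * Y w ^+ 2) = Y w ^+ 2 / (4 * s ^+ 2) by rewrite /c; ring.
  set u := Y w ^+ 2 / (4 * s ^+ 2) in u0 *.
  have -> : Y w ^+ (2 * q) = (4 * s ^+ 2) ^+ q * u ^+ q.
    by rewrite exprM -exprMn /u mulrC divfK// mulf_neq0// expf_neq0.
  rewrite /C [leRHS](_ : _ = (4 * s ^+ 2) ^+ q * (q`!%:R * expR u)); last by ring.
  rewrite ler_wpM2l//; first by rewrite exprn_ge0// mulr_ge0// ltW.
  rewrite -ler_pdivrMl ?ltr0n ?fact_gt0//.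
  case: q {C hC} => [|q]; first by rewrite expr0 fact0 invr1 mulr1 -expR0 ler_expR.
  by have := expR_ge1Dxn q u0; rewrite mulrC; lra.
have [|a ha aC] := hasE_dominated _ hC bnd; first by apply: measurable_funX.
exists a => //; apply: le_trans (ler_norm _) _; apply: le_trans aC _.
rewrite /C exprMn; have -> : 2 * q`!%:R * 4 ^+ q * (s ^+ 2) ^+ q =
  q`!%:R * (4 ^+ q * (s ^+ 2) ^+ q) * 2 :> R by ring.
apply: ler_wpM2l.
  by rewrite mulr_ge0 ?ler0n// mulr_ge0// exprn_ge0 ?ler0n ?sqr_ge0.
rewrite -[leRHS]invrK lef_pV2 ?posrE ?sqrtr_gt0 ?invr_gt0//.
apply: (@le_trans _ _ (Num.sqrt (2^-1 ^+ 2))); first by rewrite sqrtr_sqr ger0_norm.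
by rewrite ler_sqrt; lra.
Qed.

Lemma hasE_moment k : exists a, hasE P (fun w => Y w ^+ k) a.
Proof.
have [a ha _] := hasE_even_moment k.
have [||b hb _] := hasE_dominated (X := fun w => Y w ^+ k) _ (hasED (hasE_cst P 1) ha).
- exact: measurable_funX.
- move=> w; rewrite mulnC exprM -[(Y w ^+ k) ^+ 2]real_normK ?num_real//.
  by set z := `|Y w ^+ k|; have := sqr_ge0 (z - 1); have := normr_ge0 (Y w ^+ k); rewrite -/z; nra.
- by exists b.
Qed.

(** The functions |y^k| + y^k and |y^k| - y^k are nonnegative, which the transfer to the density
    requires, and the reflection exchanges them. Hence b + a = b - a, where b is the absolute
    moment. *)
Lemma hasE_odd_moment k : odd k -> hasE P (fun w => Y w ^+ k) 0.
Proof.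
move=> ok; have [a ha] := hasE_moment k.
have cX : continuous (fun y : R => y ^+ k) by move=> y; exact: exprn_continuous.
have cN : continuous (fun y : R => `|y ^+ k|).
  by move=> y; apply: (@cvg_norm _ R^o); exact: cX.
pose fp (y : R) := `|y ^+ k| + y ^+ k; pose fm (y : R) := `|y ^+ k| - y ^+ k.
have cfp : continuous fp by move=> y; apply: (@cvgD _ R^o); [exact: cN|exact: cX].
have cfm : continuous fm by move=> y; apply: (@cvgB _ R^o); [exact: cN|exact: cX].
have fp0 y : 0 <= fp y by rewrite /fp -lerBlDr sub0r -normrN ler_norm.
have fm0 y : 0 <= fm y by rewrite /fm subr_ge0 ler_norm.
have fpm y : fp (- y) = fm y by rewrite /fp exprNn -signr_odd ok expr1 mulN1r normrN.
have hn : exists b, hasE P (fun w => `|Y w ^+ k|) b.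
  apply: hasE_ex; have [iX _] := ha; exact: (integrable_norm iX).
have [b hb] := hn.
have hp := hasED hb ha; have hm := hasEB hb ha.
suff e : b + a = b - a.
  by apply: eq_hasE ha => //; lra.
have [_ /= Ep] := hp; have [_ /= Em] := hm.
have Ep' := ge0_gaussian_integral mX s0 lawX cfp fp0.
have Em' := ge0_gaussian_integral mX s0 lawX cfm fm0.
have : (\int[P]_w (fp (X w - m))%:E = \int[P]_w (fm (X w - m))%:E)%E.
  rewrite Ep' Em' -(@ge0_integral_reflection _ (fun y => fp y * normal_pdf 0 s y)).
  - by apply: eq_integral => y _; rewrite fpm normal_pdf_even.
  - by move=> y; apply: cvgM; [exact: cfp|exact: continuous_normal_pdf].
  - by move=> y; rewrite mulr_ge0// normal_pdf_ge0.
by rewrite [X in X = _]Ep [X in _ = X]Em => -[].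
Qed.

(** Up to this value of c, both 2 c s^2 and its double lie in [0, 1], where [rsqrt_expansion]
    applies; the double occurs in the fourth moment. *)
Let bound_c0 : R := (4 * s ^+ 2)^-1.
Let c00 : 0 < bound_c0. Proof. by rewrite /bound_c0 invr_gt0 mulr_gt0// ltr0n. Qed.
Let bound_c c : 0 < c -> c <= bound_c0 -> 0 <= 2 * (2 * c * s ^+ 2) <= 1.
Proof.
move=> c0 cb; have cs : 0 < c * s ^+ 2 by exact: mulr_gt0.
have b4 : 0 < 4 * s ^+ 2 by rewrite mulr_gt0 ?ltr0n.
have : c * (4 * s ^+ 2) <= 1.
  by have := ler_wpM2r (ltW b4) cb; rewrite /bound_c0 mulVf ?gt_eqF.
by move=> ?; apply/andP; split; lra.
Qed.

(** The random variable c Y^2 - (1 - exp(-c Y^2)) lies between 0 and c^2 Y^4. Taking expectations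
    and dividing by c leaves an error of order c. *)
Lemma hasE_second_moment : hasE P (fun w => Y w ^+ 2) (s ^+ 2).
Proof.
have [a2 h2] := hasE_moment 2; have [a4 h4] := hasE_moment 4.
suff <- : a2 = s ^+ 2 by [].
have a40 : 0 <= a4 by apply: (hasE_le (hasE_cst P 0) h4) => w; rewrite (exprM _ 2 2) sqr_ge0.
(* Here 3/2 (s^2)^2 c^2 is the quadratic term 3/8 (2 c s^2)^2, and 2 (s^2)^2 c^2 bounds the cubic
   remainder, as 4 c s^2 <= 1. *)
apply: (@squeeze_eq _ _ _ (a4 + (3 / 2 * (s ^+ 2) ^+ 2 + 2 * (s ^+ 2) ^+ 2)) bound_c0) => // c c0 cb.
have /andP[k0 k1] := bound_c c0 cb.
have kp : 0 < 1 + 2 * c * s ^+ 2 by lra.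
have hE := hasEB (hasE_cst P 1) (hasE_exp_square kp).
have hc := hasEZ c h2.
have hd := hasEB hc hE.
have h4' := hasEZ (c ^+ 2) h4.
have L1 := hasE_le (hasE_cst P 0) hd (fun w => _).
have {}L1 : 0 <= c * a2 - (1 - (Num.sqrt (1 + 2 * c * s ^+ 2))^-1).
  apply: L1 => w; have /expRN_bounds : 0 <= c * Y w ^+ 2 by rewrite mulr_ge0 ?sqr_ge0// ltW.
  by move=> /andP[_]; lra.
have L2 : c * a2 - (1 - (Num.sqrt (1 + 2 * c * s ^+ 2))^-1) <= c ^+ 2 * a4.
  apply: (hasE_le hd h4') => w; have /expRN_bounds : 0 <= c * Y w ^+ 2 by rewrite mulr_ge0 ?sqr_ge0// ltW.
  by rewrite exprMn -exprM => /andP[+ _]; lra.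
have L3 : `|(Num.sqrt (1 + 2 * c * s ^+ 2))^-1 - (1 - (2 * c * s ^+ 2) / 2
   + 3 / 8 * (2 * c * s ^+ 2) ^+ 2)| <= (2 * c * s ^+ 2) ^+ 3.
  by apply: rsqrt_expansion; apply/andP; split; lra.
have z0 := s2; move: L1 L2 L3; set f := (Num.sqrt _)^-1; set z := s ^+ 2 in z0 k0 k1 *.
move=> L1 L2; rewrite ler_norml => /andP[L3 L4].
have u3 : (2 * c * z) ^+ 3 <= c * (c * (2 * z ^+ 2)).
  have -> : (2 * c * z) ^+ 3 = (c * (c * (2 * z ^+ 2))) * (2 * (2 * c * z)) by ring.
  by apply: ler_piMr => //; rewrite !(mulr_ge0 (ltW c0))// mulr_ge0 ?sqr_ge0.
rewrite -(ler_pM2l c0) -{1}(ger0_norm (ltW c0)) -normrM ler_norml.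
by apply/andP; split; nra.
Qed.

(** The second difference 1 - 2 exp(-c Y^2) + exp(-2 c Y^2) = (1 - exp(-c Y^2))^2 has no linear term
    in c and approximates c^2 Y^4 within 2 c^3 Y^6. The same combination of the expansions has
    leading term 3 c^2 s^4. *)
Lemma hasE_fourth_moment : hasE P (fun w => Y w ^+ 4) (3 * (s ^+ 2) ^+ 2).
Proof.
have [a4 h4] := hasE_moment 4; have [a6 h6] := hasE_moment 6.
suff <- : a4 = 3 * (s ^+ 2) ^+ 2 by [].
have a60 : 0 <= a6 by apply: (hasE_le (hasE_cst P 0) h6) => w; rewrite (exprM _ 3 2) sqr_ge0.
(* The constant 80 is 2 * 2^3 + 4^3, from the cubic remainders at c, taken twice, and at 2 c. *)
apply: (@squeeze_eq _ _ _ (2 * a6 + 80 * (s ^+ 2) ^+ 3) bound_c0) => // c c0 cb.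
have /andP[k0 k1] := bound_c c0 cb.
have kp : 0 < 1 + 2 * c * s ^+ 2 by lra.
have kp2 : 0 < 1 + 2 * (2 * c) * s ^+ 2 by lra.
have hE := hasED (hasEB (hasE_cst P 1) (hasEZ 2 (hasE_exp_square kp))) (hasE_exp_square kp2).
have hd := hasEB (hasEZ (c ^+ 2) h4) hE.
have h6' := hasEZ (2 * c ^+ 3) h6.
have key w : 0 <= c ^+ 2 * Y w ^+ 4 - (1 - 2 * expR (- (c * Y w ^+ 2)) + expR (- (2 * c * Y w ^+ 2)))
    <= 2 * c ^+ 3 * Y w ^+ 6.
  have u0 : 0 <= c * Y w ^+ 2 by rewrite mulr_ge0 ?sqr_ge0// ltW.
  have -> : expR (- (2 * c * Y w ^+ 2)) = expR (- (c * Y w ^+ 2)) ^+ 2.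
    by rewrite -expRM_natl; congr expR; ring.
  have -> : c ^+ 2 * Y w ^+ 4 = (c * Y w ^+ 2) ^+ 2 by ring.
  have -> : 2 * c ^+ 3 * Y w ^+ 6 = 2 * (c * Y w ^+ 2) ^+ 3 by ring.
  have := expRN_bounds u0; have := expR_le1 (- (c * Y w ^+ 2)).
  rewrite oppr_le0 u0; set e := expR _; set u := c * _ in u0 *.
  move=> e1 /andP[b1 b2]; have -> : u ^+ 2 - (1 - 2 * e + e ^+ 2) = (u - (1 - e)) * (u + (1 - e)) by ring.
  have q1 : 0 <= u - (1 - e) by lra.
  have q2 : 0 <= u + (1 - e) by lra.
  apply/andP; split; first exact: mulr_ge0.
  have -> : 2 * u ^+ 3 = u ^+ 2 * (2 * u) by ring.
  by apply: ler_pM => //; lra.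
have L1 : 0 <= c ^+ 2 * a4 - (1 - 2 * (Num.sqrt (1 + 2 * c * s ^+ 2))^-1 +
    (Num.sqrt (1 + 2 * (2 * c) * s ^+ 2))^-1).
  by apply: (hasE_le (hasE_cst P 0) hd) => w; case/andP: (key w).
have L2 : c ^+ 2 * a4 - (1 - 2 * (Num.sqrt (1 + 2 * c * s ^+ 2))^-1 +
    (Num.sqrt (1 + 2 * (2 * c) * s ^+ 2))^-1) <= 2 * c ^+ 3 * a6.
  by apply: (hasE_le hd h6') => w; case/andP: (key w).
have L3 : `|(Num.sqrt (1 + 2 * c * s ^+ 2))^-1 - (1 - (2 * c * s ^+ 2) / 2
   + 3 / 8 * (2 * c * s ^+ 2) ^+ 2)| <= (2 * c * s ^+ 2) ^+ 3.
  by apply: rsqrt_expansion; apply/andP; split; lra.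
have L4 : `|(Num.sqrt (1 + 2 * (2 * c) * s ^+ 2))^-1 - (1 - (2 * (2 * c) * s ^+ 2) / 2
   + 3 / 8 * (2 * (2 * c) * s ^+ 2) ^+ 2)| <= (2 * (2 * c) * s ^+ 2) ^+ 3.
  by apply: rsqrt_expansion; apply/andP; split; lra.
move: L1 L2 L3 L4; set f := (Num.sqrt (1 + 2 * c * _))^-1; set g := (Num.sqrt _)^-1.
set z := s ^+ 2; rewrite !ler_norml => L1 L2 /andP[L3 L3'] /andP[L4 L4'].
have c2 : 0 < c ^+ 2 by rewrite exprn_gt0.
by apply/andP; split; rewrite -(ler_pM2l c2); lra.
Qed.

End gaussian_moments.

Section centered_gaussian.
Context (R : realType) (d : measure_display) (T : measurableType d) (P : probability T R).


(** The parameters hidden in [is_gaussian] are recovered from the first two moments: m = 0 and s^2 =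
    v. If sigma = 0 the variable is almost surely constant, hence almost surely 0. *)
Lemma centered_gaussian_moments (X : T -> R) (v : R) :
  is_gaussian P X -> hasE P X 0 -> hasE P (fun w => X w ^+ 2) v ->
  [/\ forall k, odd k -> hasE P (fun w => X w ^+ k) 0,
      hasE P (fun w => X w ^+ 4) (3 * v ^+ 2) &
      forall q, exists2 a, hasE P (fun w => X w ^+ (2 * q)) a & a <= 2 * q`!%:R * 4 ^+ q * v ^+ q].
Proof.
move=> [m [s lawX]] hX hX2; have mX := hasE_measurable hX.
have [s0|s0] := eqVneq s 0.
  have Xm : {ae P, forall w, X w = m}.
    have mm : measurable (~` [set m] : set R) by exact: measurableC.
    exists (X @^-1` (~` [set m])); split.
    - by have := mX measurableT _ mm; rewrite setTI.
    - have := lawX _ mm; rewrite s0 eqxx => ->.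
      by rewrite diracE memNset// => -[].
    - by move=> w /= H1; exact: H1.
  have m0 : m = 0.
    have h := ae_eq_hasE (measurable_cst m) hX Xm.
    by rewrite (hasE_unique h (hasE_cst P m)).
  have X0 : {ae P, forall w, X w = 0} by rewrite m0 in Xm.
  have Xk k : (0 < k)%N -> hasE P (fun w => X w ^+ k) 0.
    move=> k0; apply: (ae_eq_hasE _ (hasE_cst P 0)); first exact: measurable_funX.
    by case: k k0 => // k _; apply: filterS X0 => w /= ->; rewrite expr0n.
  have v0 : v = 0 by apply: hasE_unique hX2 _; exact: Xk.
  rewrite v0; split => [k ok||q].
  - by apply: Xk; case: k ok.
  - by rewrite expr0n /= mulr0; exact: Xk.
  - case: q => [|q]; first by exists 1; [exact: hasE_cst|rewrite !expr0 fact0; lra].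
    by exists 0; [apply: Xk; rewrite muln_gt0|rewrite expr0n/= mulr0].
have law A : measurable A -> P (X @^-1` A) = normal_prob m s A.
  by move=> mA; rewrite lawX// (negbTE s0).
have m0 : m = 0.
  have h1 := hasE_odd_moment mX s0 law (isT : odd 1).
  have h2 : hasE P (fun w => X w - m) 0 by apply: eq_hasE h1 => // w; rewrite expr1.
  by have := hasE_unique h2 (hasEB hX (hasE_cst P m)); lra.
have Ym k : (fun w => (X w - m) ^+ k) = (fun w => X w ^+ k).
  by apply/funext => w; rewrite m0 subr0.
have vE : v = s ^+ 2.
  by have := hasE_second_moment mX s0 law; rewrite Ym => /(hasE_unique hX2).
rewrite vE; split => [k ok||q].
- by rewrite -Ym; exact: (hasE_odd_moment mX s0 law ok).
- by rewrite -Ym; exact: (hasE_fourth_moment mX s0 law).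
- by rewrite -Ym; exact: (hasE_even_moment mX s0 law q).
Qed.

Lemma integrable_sqr (X : T -> R) v : measurable_fun [set: T] X ->
  hasE P (fun w => X w ^+ 2) v -> exists a, hasE P X a.
Proof.
move=> mX h2; have [||a ha _] := hasE_dominated (X := X) _ (hasED (hasE_cst P 1) h2) => //.
  move=> w; rewrite -[X w ^+ 2]real_normK ?num_real//.
  by set z := `|X w|; have := sqr_ge0 (z - 1); have := normr_ge0 (X w); rewrite -/z; nra.
by exists a.
Qed.

Lemma integrable_prod (X Y : T -> R) v v' : measurable_fun [set: T] X -> measurable_fun [set: T] Y ->
  hasE P (fun w => X w ^+ 2) v -> hasE P (fun w => Y w ^+ 2) v' ->
  exists2 a, hasE P (fun w => X w * Y w) a & `|a| <= v + v'.
Proof.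
move=> mX mY h2 h2'; apply: (hasE_dominated _ (hasED h2 h2')).
  exact: measurable_funM.
move=> w; rewrite normrM -[X w ^+ 2]real_normK ?num_real// -[Y w ^+ 2]real_normK ?num_real//.
have := sqr_ge0 (`|X w| - `|Y w|); have := normr_ge0 (X w); have := normr_ge0 (Y w); nra.
Qed.

End centered_gaussian.

(** * Moments of fractional Brownian motion *)

Section fBm_moments.
Context (R : realType) (d : measure_display) (T : measurableType d) (P : probability T R).
Context (H : R) (B : R -> {RV P >-> R}).
Hypothesis hB : is_fBm H B.
Hypothesis H0 : 0 < H.

Definition fcov (a b : R) : R := 2^-1 * (a `^ (2 * H) + b `^ (2 * H) - `|a - b| `^ (2 * H)).

Let H20 : 2 * H != 0. Proof. by rewrite mulf_neq0// gt_eqF. Qed.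

Lemma fcov_diag a : fcov a a = a `^ (2 * H).
Proof. by rewrite /fcov subrr normr0 powR0//; field. Qed.

Let mB a : measurable_fun [set: T] (B a). Proof. exact: measurable_funPT. Qed.

Lemma fBm_sqr a : 0 <= a <= 1 -> hasE P (fun w => B a w ^+ 2) (a `^ (2 * H)).
Proof.
move=> a01; have [_ _ _ cv] := hB; apply: ge0_hasE => [|w|].
- exact: measurable_funX.
- exact: sqr_ge0.
- have := cv a a a01 a01; rewrite unlock -[X in _ = X%:E]/(fcov a a) fcov_diag => <-.
  by apply: eq_integral => w _; rewrite expr2.
Qed.

Lemma fBm_mean a : 0 <= a <= 1 -> hasE P (B a) 0.
Proof.
move=> a01; have [_ _ mn _] := hB; have [e he] := integrable_sqr (mB a) (fBm_sqr a01).
apply: eq_hasE (he) => //; have := mn a a01; rewrite (hasE_expectation he) => -[].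
by [].
Qed.

Lemma fBm_cov a b : 0 <= a <= 1 -> 0 <= b <= 1 -> hasE P (fun w => B a w * B b w) (fcov a b).
Proof.
move=> a01 b01; have [_ _ _ cv] := hB.
have [e he _] := integrable_prod (mB a) (mB b) (fBm_sqr a01) (fBm_sqr b01).
apply: eq_hasE (he) => //; have := cv a b a01 b01; rewrite (hasE_expectation he) => -[].
by [].
Qed.

Lemma fBm_pair_gaussian a b (c c' : R) : 0 <= a <= 1 -> 0 <= b <= 1 ->
  is_gaussian P (fun w => c * B a w + c' * B b w).
Proof.
move=> a01 b01; have [_ G _ _] := hB.
have := G 2 (fun k => if k == ord0 then c else c') (fun k => if k == ord0 then a else b) _.
rewrite (_ : (fun w => _) = (fun w => c * B a w + c' * B b w)).
  by apply => k; case: ifP.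
by apply/funext => w; rewrite big_ord_recl big_ord1.
Qed.

Lemma fBm_pair_moments a b (c c' : R) : 0 <= a <= 1 -> 0 <= b <= 1 ->
  let v := c ^+ 2 * a `^ (2 * H) + c' ^+ 2 * b `^ (2 * H) + 2 * c * c' * fcov a b in
  [/\ forall k, odd k -> hasE P (fun w => (c * B a w + c' * B b w) ^+ k) 0,
      hasE P (fun w => (c * B a w + c' * B b w) ^+ 4) (3 * v ^+ 2) &
      forall q, exists2 e, hasE P (fun w => (c * B a w + c' * B b w) ^+ (2 * q)) e &
        e <= 2 * q`!%:R * 4 ^+ q * v ^+ q].
Proof.
move=> a01 b01 v; apply: centered_gaussian_moments; first exact: fBm_pair_gaussian.
  by apply: eq_hasE (hasED (hasEZ c (fBm_mean a01)) (hasEZ c' (fBm_mean b01))) => //; ring.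
apply: eq_hasE (hasED (hasED (hasEZ (c ^+ 2) (fBm_sqr a01)) (hasEZ (c' ^+ 2) (fBm_sqr b01)))
  (hasEZ (2 * c * c') (fBm_cov a01 b01))) => // w; ring.
Qed.

Lemma fBm_odd a k : 0 <= a <= 1 -> odd k -> hasE P (fun w => B a w ^+ k) 0.
Proof.
move=> a01 ok; have [/(_ k ok) h _ _] := fBm_pair_moments 1 0 a01 a01.
by apply: eq_hasE h => // w; rewrite mul1r mul0r addr0.
Qed.

Lemma fBm_fourth a : 0 <= a <= 1 -> hasE P (fun w => B a w ^+ 4) (3 * (a `^ (2 * H)) ^+ 2).
Proof.
move=> a01; have [_ h _] := fBm_pair_moments 1 0 a01 a01.
by apply: eq_hasE h => [w|]; [rewrite mul1r mul0r addr0|congr (_ * _ ^+ 2); ring].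
Qed.

(** Polarisation: (y + x)^3 + (y - x)^3 - 2 y^3 = 6 x^2 y, and the third moments of the Gaussian
    variables on the left vanish. *)
Lemma fBm_sqr_mul a b : 0 <= a <= 1 -> 0 <= b <= 1 -> hasE P (fun w => B a w ^+ 2 * B b w) 0.
Proof.
move=> a01 b01; have [/(_ 3%N isT) h1 _ _] := fBm_pair_moments 1 1 b01 a01.
have [/(_ 3%N isT) h2 _ _] := fBm_pair_moments 1 (-1) b01 a01.
have h3 := fBm_odd b01 (isT : odd 3).
apply: eq_hasE (hasEZ 6^-1 (hasEB (hasED h1 h2) (hasEZ 2 h3))) => [w|]; first by field.
by ring.
Qed.

Lemma fBm_increment s t q : 0 <= s <= 1 -> 0 <= t <= 1 ->
  exists2 e, hasE P (fun w => (B t w - B s w) ^+ (2 * q)) e &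
        e <= 2 * q`!%:R * 4 ^+ q * (`|t - s| `^ (2 * H)) ^+ q.
Proof.
move=> s01 t01; have [_ _ /(_ q) [e he eq]] := fBm_pair_moments 1 (-1) t01 s01.
exists e; first by apply: eq_hasE he => // w; rewrite mul1r mulN1r.
apply: le_trans eq _; rewrite le_eqVlt; apply/orP; left; apply/eqP; congr (_ * _ ^+ q).
by rewrite /fcov; field.
Qed.

End fBm_moments.

(** * Regularity of the sample paths *)

Section chaining.
Context (R : realType).
Implicit Types (x : R -> R) (s t r M : R).

Lemma cont01_at x s : cont01 x -> 0 <= s <= 1 -> forall eps : R, 0 < eps ->
  exists2 delta : R, 0 < delta & forall y, 0 <= y <= 1 -> `|s - y| < delta ->
    `|x s - x y| <= eps.
Proof.
move=> /subspace_continuousP cx s01 eps e0.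
have := cx s; rewrite /= in_itv/= => /(_ s01) /cvgrPdist_le/(_ eps e0).
rewrite near_withinE => -[d /= d0 H]; exists d => // y y01 sy.
by apply: H => //=; rewrite in_itv.
Qed.

Lemma expr_small r eps : 0 <= r < 1 -> 0 < eps -> exists N, forall n, (N <= n)%N -> r ^+ n <= eps.
Proof.
move=> /andP[r0 r1] e0; have : r ^+ n @[n --> \oo] --> (0 : R).
  by apply: cvg_expr; rewrite ger0_norm.
move=> /cvgrPdist_le/(_ eps e0)[N _ H]; exists N => n Nn.
by have := H n Nn; rewrite /= sub0r normrN ger0_norm// exprn_ge0.
Qed.

Definition dyadic_index n s : nat := Num.truncn (s * 2 ^+ n).
Definition dyadic n k : R := k%:R / 2 ^+ n.

Let p2 n : 0 < 2 ^+ n :> R. Proof. by rewrite exprn_gt0. Qed.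

Lemma dyadic_indexP n s : 0 <= s ->
  (dyadic_index n s)%:R <= s * 2 ^+ n < (dyadic_index n s).+1%:R.
Proof. by move=> s0; apply: truncn_itv; rewrite mulr_ge0// ltW. Qed.

Lemma dyadicS n k : dyadic n.+1 (2 * k) = dyadic n k.
Proof. by rewrite /dyadic exprS natrM; field; rewrite lt0r_neq0. Qed.

Lemma dyadic_index_le n s : 0 <= s <= 1 -> (dyadic_index n s <= 2 ^ n)%N.
Proof.
move=> /andP[s0 s1]; have /andP[h _] := dyadic_indexP n s0.
by rewrite -(ler_nat R) natrX; apply: le_trans h _; rewrite ler_piMl// ltW.
Qed.

Lemma dyadic_near n s : 0 <= s -> 0 <= s - dyadic n (dyadic_index n s) < (2 ^+ n)^-1.
Proof.
move=> s0; have /andP[h1 h2] := dyadic_indexP n s0; rewrite /dyadic; apply/andP; split.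
  by rewrite subr_ge0 ler_pdivrMr.
rewrite ltrBlDr -[X in X + _]mul1r -mulrDl ltr_pdivlMr// nat1r.
by [].
Qed.

Section path.
Context (x : R -> R) (M r : R).
Hypotheses (cx : cont01 x) (M0 : 0 <= M) (r0 : 0 < r) (r1 : r < 1).
Hypothesis dyadic_incr : forall n k, (k < 2 ^ n)%N ->
  `|x (dyadic n k.+1) - x (dyadic n k)| <= M * r ^+ n.

Let pt n s := x (dyadic n (dyadic_index n s)).

(** The dyadic points just below s at levels n and n + 1 either coincide or are neighbours at level
    n + 1. *)
Lemma dyadic_step n s : 0 <= s <= 1 -> `|pt n.+1 s - pt n s| <= M * r ^+ n.+1.
Proof.
move=> s01; have /andP[s0 s1] := s01; rewrite /pt.
have /andP[a1 a2] := dyadic_indexP n s0; have /andP[b1 b2] := dyadic_indexP n.+1 s0.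
have bl := dyadic_index_le n.+1 s01.
set k := dyadic_index n s in a1 a2 *; set k' := dyadic_index n.+1 s in b1 b2 bl *.
have l1 : (2 * k <= k')%N.
  rewrite -ltnS -(ltr_nat R) natrM; apply: le_lt_trans b2.
  by rewrite exprS mulrCA ler_pM2l.
have l2 : (k' <= (2 * k).+1)%N.
  rewrite -ltnS -(ltr_nat R); apply: le_lt_trans b1 _.
  have -> : (2 * k).+2%:R = 2 * k.+1%:R :> R by rewrite -natrM mulnS.
  by rewrite exprS mulrCA ltr_pM2l.
rewrite -(dyadicS n k); move: l1; rewrite leq_eqVlt => /predU1P[<-|l1].
  by rewrite subrr normr0 mulr_ge0// exprn_ge0// ltW.
have kk : k' = (2 * k).+1 by apply/eqP; rewrite eqn_leq l2.
by rewrite kk; apply: dyadic_incr; rewrite -kk.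
Qed.

Lemma dyadic_sum n i s : 0 <= s <= 1 ->
  `|pt (n + i) s - pt n s| <= M * (r ^+ n.+1 - r ^+ (n + i).+1) / (1 - r).
Proof.
move=> s01; elim: i => [|i ih]; first by rewrite addn0 !subrr normr0 mulr0 mul0r.
rewrite addnS; have st := dyadic_step (n + i) s01.
have -> : pt (n + i).+1 s - pt n s = (pt (n + i).+1 s - pt (n + i) s) + (pt (n + i) s - pt n s) by ring.
apply: le_trans (ler_normD _ _) _; apply: le_trans (lerD st ih) _.
rewrite le_eqVlt; apply/orP; left; apply/eqP; rewrite [r ^+ (n + i).+2]exprS.
have : 1 - r != 0 by rewrite subr_eq0 gt_eqF.
by move=> ?; field.
Qed.

(** The geometric bound is uniform in the finer level, and continuity of x lets that level tend to
    infinity. *)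
Lemma dyadic_approx n s : 0 <= s <= 1 -> `|x s - pt n s| <= M * r ^+ n.+1 / (1 - r).
Proof.
move=> s01; have /andP[s0 s1] := s01; apply/ler_addgt0Pl => e e0.
have [d d0 Hd] := cont01_at cx s01 e0.
have h : 0 <= (2^-1 : R) < 1 by lra.
have [N /(_ (N + n)%N (leq_addr _ _)) HN] := expr_small h (divr_gt0 d0 (ltr0n R 2)).
have := dyadic_near (n + N) s0; set y := dyadic _ _ => /andP[y1 y2].
have ypt : pt (n + N) s = x y by [].
have -> : x s - pt n s = (x s - x y) + (pt (n + N) s - pt n s) by rewrite ypt; ring.
apply: le_trans (ler_normD _ _) _; apply: lerD.
  apply: Hd.
    have := dyadic_index_le (n + N) s01; rewrite -(ler_nat R) natrX => yl.
    apply/andP; split; first by rewrite divr_ge0// exprn_ge0.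
    by rewrite /y /dyadic ler_pdivrMr// mul1r.
  rewrite ger0_norm//; apply: lt_le_trans y2 _; rewrite -exprVn addnC.
  by apply: le_trans HN _; lra.
apply: le_trans (dyadic_sum n N s01) _.
rewrite ler_pM2r ?invr_gt0 ?subr_gt0// ler_wpM2l//.
by rewrite gerBl exprn_ge0// ltW.
Qed.

(** At distance at most 2^(-n), the level-n points below s and t coincide or are neighbours, at cost
    M r^n. Each end adds the geometric tail M r^(n+1) / (1 - r). *)
Lemma chaining_bound n s t : 0 <= s -> s <= t -> t <= 1 -> t - s <= (2 ^+ n)^-1 ->
  `|x t - x s| <= M * r ^+ n * (1 + 2 * r / (1 - r)).
Proof.
move=> s0 st t1 ts; have s01 : 0 <= s <= 1 by rewrite s0 (le_trans st).
have t0 : 0 <= t by exact: le_trans st.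
have t01 : 0 <= t <= 1 by rewrite t0.
have As := dyadic_approx n s01; have At := dyadic_approx n t01.
have mid : `|pt n t - pt n s| <= M * r ^+ n.
  rewrite /pt; have tl := dyadic_index_le n t01.
  have /andP[a1 a2] := dyadic_indexP n s0; have /andP[b1 b2] := dyadic_indexP n t0.
  set k := dyadic_index n s in a1 a2 *; set k' := dyadic_index n t in b1 b2 tl *.
  have ts' : (t - s) * 2 ^+ n <= 1 by rewrite -ler_pdivlMr// mul1r.
  have st' : s * 2 ^+ n <= t * 2 ^+ n by rewrite ler_pM2r.
  have l1 : (k <= k')%N by rewrite -ltnS -(ltr_nat R); apply: le_lt_trans a1 (le_lt_trans st' b2).
  have l2 : (k' <= k.+1)%N.
    rewrite -ltnS -(ltr_nat R) -[k.+2%:R]natr1; apply: le_lt_trans b1 _.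
    by move: a2 ts'; rewrite mulrBl; lra.
  move: l1; rewrite leq_eqVlt => /predU1P[->|l1].
    by rewrite subrr normr0 mulr_ge0// exprn_ge0// ltW.
  have kk : k' = k.+1 by apply/eqP; rewrite eqn_leq l2.
  by rewrite kk; apply: dyadic_incr; rewrite -kk.
have -> : x t - x s = (x t - pt n t) + (pt n t - pt n s) - (x s - pt n s) by ring.
apply: le_trans (ler_normB _ _) _.
apply: le_trans (lerD (le_trans (ler_normD _ _) (lerD At mid)) As) _.
rewrite exprS le_eqVlt; apply/orP; left; apply/eqP.
have : 1 - r != 0 by rewrite subr_eq0 gt_eqF.
by move=> ?; field.
Qed.

End path.

(* Kolmogorov's chaining: geometric control of dyadic increments. *)
Lemma dyadic_regular (p : nat) (G : set (R -> R)) (M r : R) :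
  (0 < p)%N -> 0 <= M -> 0 < r -> r < 1 -> 2 * r ^+ p < 1 ->
  (forall x, G x -> cont01 x) -> (forall x, G x -> x 0 = 0) ->
  (forall x, G x -> forall n k, (k < 2 ^ n)%N ->
    `|x (dyadic n k.+1) - x (dyadic n k)| <= M * r ^+ n) ->
  regular_paths p G.
Proof.
move=> pp M0 r0 r1 rp cG G0 dG; pose C := M * (1 + 2 * r / (1 - r)).
have C0 : 0 <= C.
  by rewrite mulr_ge0// addr_ge0// divr_ge0 ?subr_ge0 ?mulr_ge0// ltW.
have key x n s t : G x -> 0 <= s -> s <= t -> t <= 1 -> t - s <= (2 ^+ n)^-1 ->
    `|x t - x s| <= C * r ^+ n.
  move=> Gx s0 st t1 ts.
  have := chaining_bound (cG _ Gx) M0 r0 r1 (dG _ Gx) s0 st t1 ts.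
  by rewrite /C mulrAC.
split => [|//|eps e0].
  exists C => // x t Gx /andP[t0 t1]; have := key x 0%N 0 t Gx (lexx 0) t0 t1.
  by rewrite (G0 _ Gx) !subr0 !expr0 invr1 mulr1; apply.
have q0 : 0 <= 2 * r ^+ p < 1 by rewrite rp mulr_ge0// exprn_ge0// ltW.
have Cp : 0 < 2 * C ^+ p + 1 by rewrite ltr_wpDl// mulr_ge0// exprn_ge0.
have [N HN] := expr_small q0 (divr_gt0 e0 Cp).
exists ((2 ^+ N)^-1); first by rewrite invr_gt0.
move=> x s t Gx s0 st t1 ts.
have [->|nst] := eqVneq s t.
  by rewrite !subrr normr0 mulr0 expr0n; case: p pp {rp q0 Cp HN}.
have ts0 : 0 < t - s by rewrite subr_gt0 lt_neqAle nst.
have h : 0 <= (2^-1 : R) < 1 by lra.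
have ex : exists m, (2 ^+ m)^-1 < t - s.
  have [m /(_ m (leqnn m)) Hm] := expr_small h (divr_gt0 ts0 (ltr0n R 2)).
  by exists m; rewrite -exprVn; apply: le_lt_trans Hm _; lra.
(* Minimality fixes the scale: with m = n + 1, the length satisfies 2^(-n-1) < t - s <= 2^(-n). *)
have [m Hm min_m] := ex_minnP ex.
have mN : (N < m)%N.
  rewrite ltnNge; apply/negP => mN.
  have : (2 ^+ N)^-1 <= (2 ^+ m)^-1 :> R.
    by rewrite lef_pV2 ?posrE// ler_eXn2l// ltr1n.
  by lra.
case: m Hm mN min_m => // n Hn nN min_n.
have tsn : t - s <= (2 ^+ n)^-1.
  by rewrite leNgt; apply/negP => /min_n; rewrite ltnn.
have lt_n : (2 ^+ n)^-1 <= 2 * (t - s).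
  move: Hn; rewrite exprS invfM => Hn.
  by rewrite -ler_pdivrMl// ltW.
have Crn : 0 <= C * r ^+ n := mulr_ge0 C0 (exprn_ge0 n (ltW r0)).
have := key x n s t Gx s0 st t1 tsn; rewrite -(ler_pXn2r pp) ?nnegrE// => kp.
apply: le_trans kp _; rewrite exprMn.
(* The factor 2^(-n) is comparable to t - s, and (2 r^p)^n supplies the smallness. *)
have -> : (r ^+ n) ^+ p = (2 * r ^+ p) ^+ n * (2 ^+ n)^-1.
  rewrite exprMn -!exprM mulnC mulrAC divff ?mul1r// lt0r_neq0//.
have Hq := HN n nN.
have q1 : 0 <= (2 * r ^+ p) ^+ n by rewrite exprn_ge0//; case/andP: q0.
rewrite mulrA; apply: (@le_trans _ _ (C ^+ p * (2 * r ^+ p) ^+ n * (2 * (t - s)))).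
  by rewrite ler_wpM2l// mulr_ge0// exprn_ge0.
rewrite mulrA ler_wpM2r ?(ltW ts0)//.
set u := (2 * r ^+ p) ^+ n in Hq q1 *; set v := C ^+ p in Cp Hq *.
move: Hq; rewrite ler_pdivlMr// => Hq.
have -> : v * u * 2 = u * (2 * v + 1) - u by ring.
by lra.
Qed.


End chaining.

Section level_sets.
Context (R : realType) (d : measure_display) (T : measurableType d).
Implicit Types (X : T -> R) (c : R).

Lemma measurable_ge X c : measurable_fun [set: T] X -> measurable [set w | c <= X w].
Proof.
move=> mX; have := mX measurableT _ (measurable_itv `[c, +oo[).
by rewrite setTI; congr measurable; apply/seteqP; split => w /=; rewrite in_itv/= andbT.
Qed.

Lemma measurable_gt X c : measurable_fun [set: T] X -> measurable [set w | c < X w].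
Proof.
move=> mX; have := mX measurableT _ (measurable_itv `]c, +oo[).
by rewrite setTI; congr measurable; apply/seteqP; split => w /=; rewrite in_itv/= andbT.
Qed.

End level_sets.

(** * Events of large probability with regular sample paths *)

Section kolmogorov.
Context (R : realType) (d : measure_display) (T : measurableType d) (P : probability T R).
Context (H : R) (B : R -> {RV P >-> R}).
Hypothesis hB : is_fBm H B.
Hypothesis H0 : 0 < H.

Definition path_of (w : T) (t : R) : R := B t w.

(** The ratio of the variances of dyadic increments at consecutive levels. *)
Let rho : R := 2^-1 `^ (2 * H).

Lemma dyadic01 n k : (k <= 2 ^ n)%N -> 0 <= dyadic R n k <= 1.
Proof.
move=> kn; rewrite /dyadic; apply/andP; split.
  by rewrite divr_ge0// exprn_ge0.
by rewrite ler_pdivrMr ?exprn_gt0// mul1r -natrX ler_nat.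
Qed.

Lemma dyadic_increment_pow n k : `|dyadic R n k.+1 - dyadic R n k| `^ (2 * H) = rho ^+ n.
Proof.
have p2 : 0 < 2 ^+ n :> R by rewrite exprn_gt0.
have -> : dyadic R n k.+1 - dyadic R n k = 2^-1 ^+ n.
  by rewrite /dyadic -mulrBl -natr1 addrC addKr mul1r exprVn.
have h : 0 <= 2^-1 :> R by rewrite invr_ge0.
rewrite ger0_norm ?exprn_ge0// -(powR_mulrn n h) powRAC.
by rewrite powR_mulrn// powR_ge0.
Qed.

(** Markov's inequality for the 2q-th power of the increment. *)
Lemma dyadic_tail q n k (M r : R) : (k < 2 ^ n)%N -> 0 < M -> 0 < r ->
  (P [set w | M * r ^+ n <= `|B (dyadic R n k.+1) w - B (dyadic R n k) w|]%R <=
   (2 * q`!%:R * 4 ^+ q / M ^+ (2 * q) * (rho / r ^+ 2) ^+ q ^+ n)%:E)%E.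
Proof.
move=> kn M0 r0.
have [e he el] := fBm_increment hB H0 q (dyadic01 (ltnW kn)) (dyadic01 kn).
rewrite dyadic_increment_pow in el.
have c0 : 0 < M * r ^+ n by rewrite mulr_gt0// exprn_gt0.
have ge0 w : 0 <= (B (dyadic R n k.+1) w - B (dyadic R n k) w) ^+ (2 * q).
  by rewrite exprM exprn_ge0// sqr_ge0.
have t0 : 0 < (M * r ^+ n) ^+ (2 * q) by rewrite exprn_gt0.
apply: le_trans (le_trans (hasE_markov he ge0 t0) _).
  have mB a : measurable_fun [set: T] (B a) by exact: measurable_funPT.
  apply: le_measure; rewrite ?inE.
  - apply: measurable_ge; apply: measurableT_comp => //; exact: measurable_funB.
  - apply: measurable_ge; apply: measurable_funX; exact: measurable_funB.
  - move=> w /= hw; rewrite -[X in _ <= X]ger0_norm// normrX.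
    by apply: lerXn2r => //; rewrite nnegrE ltW.
rewrite lee_fin ler_pdivrMr//; apply: le_trans el _.
rewrite le_eqVlt; apply/orP; left; apply/eqP.
have rn0 : r != 0 by rewrite gt_eqF.
have Mn0 : M != 0 by rewrite gt_eqF.
have E1 : (r ^+ n) ^+ (2 * q) = ((r ^+ 2) ^+ q) ^+ n by rewrite -!exprM mulnCA [(n * q)%N]mulnC.
have E2 : ((rho / r ^+ 2) ^+ q) ^+ n = (rho ^+ n) ^+ q / ((r ^+ 2) ^+ q) ^+ n.
  by rewrite [(rho / _) ^+ q]exprMn exprVn [LHS]exprMn exprVn; congr (_ / _); exact: exprAC.
rewrite [(M * _) ^+ _]exprMn E1 E2; move: ((rho ^+ n) ^+ q) => z; field.
by rewrite !expf_neq0.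
Qed.

Definition large_increment M r n k : set T :=
  [set w | M * r ^+ n <= `|B (dyadic R n k.+1) w - B (dyadic R n k) w|].

Lemma measurable_large_increment M r n k : measurable (large_increment M r n k).
Proof.
apply: measurable_ge; apply: measurableT_comp => //.
by apply: measurable_funB; exact: measurable_funPT.
Qed.

(** Level n has 2^n increments, each large with probability at most eta / 2 * 4^(-n). The level thus
    contributes at most eta / 2^(n+1), and the levels sum to eta. *)
Lemma union_tail q (M r eta : R) : 0 < M -> 0 < r -> (rho / r ^+ 2) ^+ q <= 4^-1 ->
  0 <= eta -> 2 * q`!%:R * 4 ^+ q / M ^+ (2 * q) <= eta / 2 ->
  (P (\bigcup_n \big[setU/set0]_(k < 2 ^ n) large_increment M r n k) <= eta%:E)%E.
Proof.
move=> M0 r0 kap eta0 Ceta; pose bad := large_increment M r; rewrite -/bad.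
have mbad n k : measurable (bad n k) by exact: measurable_large_increment.
have mU n : measurable (\big[setU/set0]_(k < 2 ^ n) bad n k).
  by apply: bigsetU_measurable => k _; exact: mbad.
have mUU : measurable (\bigcup_n \big[setU/set0]_(k < 2 ^ n) bad n k) by exact: bigcupT_measurable.
apply: (le_trans (generalized_Boole_inequality P mU mUU)).
apply: (le_trans _ (epsilon_trick0 xpredT eta0)).
apply: lee_nneseries => [n _ _|n _]; first exact: measure_ge0.
apply: le_trans (Boole_inequality P (fun k _ => mbad n k)) _.
have rho0 : 0 <= rho by exact: powR_ge0.
have one k : (k < 2 ^ n)%N -> (P (bad n k) <= (eta / 2 * 4^-1 ^+ n)%:E)%E.
  move=> kn; apply: le_trans (dyadic_tail q kn M0 r0) _; rewrite lee_fin.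
  apply: ler_pM => //.
  - by rewrite divr_ge0 ?mulr_ge0 ?ler0n ?exprn_ge0 ?ler0n ?(ltW M0).
  - by rewrite !exprn_ge0// divr_ge0// sqr_ge0.
  - by apply: lerXn2r => //; rewrite nnegrE ?invr_ge0// exprn_ge0// divr_ge0// sqr_ge0.
apply: (@le_trans _ _ (\sum_(k < 2 ^ n) (eta / 2 * 4^-1 ^+ n)%:E)%E).
  by apply: lee_sum => k _; exact: one.
rewrite sumEFin lee_fin sumr_const card_ord -[_ *+ (2 ^ n)]mulr_natl !natrX [2 ^+ n.+1]exprS.
have -> : 4^-1 ^+ n = (2 ^+ n)^-1 * (2 ^+ n)^-1 :> R.
  by rewrite -invfM -exprMn exprVn; congr (_ ^+ _)^-1; ring.
have : 2 ^+ n != 0 :> R by rewrite expf_neq0.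
move: (2 ^+ n) => z z0; rewrite le_eqVlt; apply/orP; left; apply/eqP; field.
by rewrite z0.
Qed.

(** The conditions on r say 2^(-H) < r < 2^(-1/p), so such an r exists exactly when H > 1/p. The
    left inequality makes large increments improbable for a high moment; the right one makes the
    path increments o((t - s)^(1/p)). *)
Lemma fBm_regular_events p (r eta : R) : (0 < p)%N -> 0 < r -> r < 1 -> rho < r ^+ 2 ->
  2 * r ^+ p < 1 -> 0 < eta -> exists G : set T,
  [/\ measurable G, (P (~` G) <= eta%:E)%E & regular_paths p (path_of @` G)].
Proof.
move=> p0 r0 r1 rr rp eta0.
have r2 : 0 < r ^+ 2 by rewrite exprn_gt0.
have rho0 : 0 <= rho by exact: powR_ge0.
have kap : 0 <= rho / r ^+ 2 < 1 by rewrite divr_ge0 ?(ltW r2)//= ltr_pdivrMr// mul1r.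
have [N HN] := expr_small kap (ltac:(lra) : 0 < 4^-1 :> R).
(* The exponent is positive so that M <= M^(2q) for the M >= 1 chosen next, which satisfies C <= eta
   / 2 * M. *)
pose q := N.+1; pose C : R := 2 * q`!%:R * 4 ^+ q.
have C0 : 0 < C by rewrite !mulr_gt0 ?ltr0n ?fact_gt0// exprn_gt0.
pose M := 1 + C / (eta / 2).
have M1 : 1 <= M by rewrite lerDl divr_ge0 ?divr_ge0// ltW.
have M0 : 0 < M by lra.
have Ceta : C / M ^+ (2 * q) <= eta / 2.
  rewrite ler_pdivrMr ?exprn_gt0//; apply: (@le_trans _ _ (eta / 2 * M)).
    rewrite /M mulrDr mulrCA divff ?mulr1 ?lerDr ?divr_ge0 ?(ltW eta0)//.
    by rewrite gt_eqF// divr_gt0.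
  rewrite ler_wpM2l ?divr_ge0 ?(ltW eta0)// -[leLHS]expr1.
  by apply: ler_weXn2l => //; rewrite /q mulnS.
pose bad := large_increment M r.
pose U := \bigcup_n \big[setU/set0]_(k < 2 ^ n) bad n k.
have U_eta : (P U <= eta%:E)%E.
  by apply: (union_tail (q := q)) => //; [exact: HN|exact: ltW].
have mbad n k : measurable (bad n k) by exact: measurable_large_increment.
have mU : measurable U.
  by apply: bigcupT_measurable => n; apply: bigsetU_measurable => k _; exact: mbad.
have i0 : 0 <= (0 : R) <= 1 by rewrite lexx ler01.
(* That the path starts at 0 is known only almost surely, from E B_0^2 = 0; the exceptional null set
   is removed as well. *)
have [N0 [mN0 PN0 N0s]] : {ae P, forall w, B 0 w ^+ 2 = 0}.
  apply: hasE_eq0 => [|w]; last exact: sqr_ge0.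
  by have := fBm_sqr hB H0 i0; rewrite powR0// mulf_neq0// gt_eqF.
exists (~` (U `|` N0)); split.
- by apply: measurableC; exact: measurableU.
- rewrite setCK; apply: le_trans (measureU2 P mU mN0) _.
  by rewrite [X in (_ + X)%E]PN0 adde0.
apply: (@dyadic_regular _ p _ M r) => //.
- exact: ltW.
- by move=> _ [w _ <-]; have [cB _ _ _] := hB; exact: cB.
- move=> _ [w wG <-]; have : B 0 w ^+ 2 = 0.
    by apply: contrapT => h; apply: wG; right; exact: N0s.
  by move/eqP; rewrite sqrf_eq0 => /eqP.
- move=> _ [w wG <-] n k kn; rewrite leNgt; apply/negP => h; apply: wG; left.
  exists n => //; rewrite (bigD1 (Ordinal kn))//=; left.
  exact: ltW.
Qed.

End kolmogorov.

(** * Measurability and expectation of time integrals *)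

Section continuous_process.
Context (R : realType) (d : measure_display) (T : measurableType d) (P : probability T R).
Notation mu := (@lebesgue_measure R).
Context (Z : R -> T -> R).
Hypothesis cZ : forall w, cont01 (fun t => Z t w).
Hypothesis mZ : forall t, 0 <= t <= 1 -> measurable_fun [set: T] (Z t).

Let F (p : T * measurableTypeR R) : R := Z p.2 p.1 * \1_(`[0, 1]%classic : set R) p.2.

Let cell n k : set (measurableTypeR R) :=
  `[0, 1] `&` `[dyadic R n k, dyadic R n k.+1[.

(** Left-point dyadic step processes, jointly measurable and converging pointwise to [F] by
    continuity in time. The index runs up to 2^n inclusive because the last cell is the end point 1
    alone. *)
Let Fn n (p : T * measurableTypeR R) : R :=
  \sum_(k < (2 ^ n).+1) Z (dyadic R n k) p.1 * \1_(cell n k) p.2.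

Let mcell n k : measurable (cell n k).
Proof. by apply: measurableI; exact: measurable_itv. Qed.

Let dyadic01 n k : (k <= 2 ^ n)%N -> 0 <= dyadic R n k <= 1.
Proof.
move=> kn; rewrite /dyadic; apply/andP; split.
  by rewrite divr_ge0// exprn_ge0.
by rewrite ler_pdivrMr ?exprn_gt0// mul1r -natrX ler_nat.
Qed.

Let mFn n : measurable_fun [set: T * measurableTypeR R] (Fn n).
Proof.
apply: measurable_sum => k; apply: measurable_funM.
  apply: (measurableT_comp (mZ (dyadic01 _))); first by rewrite -ltnS.
  exact: measurable_fst.
apply: (@measurableT_comp _ _ _ _ _ _ (\1_(cell n k) : measurableTypeR R -> R)).
  exact: measurable_indic.
exact: measurable_snd.
Qed.

Let cell_index n k s : 0 <= s <= 1 -> (s \in cell n k) = (k == dyadic_index n s).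
Proof.
move=> s01; have /andP[s0 _] := s01; have p2 : 0 < 2 ^+ n :> R by rewrite exprn_gt0.
have /andP[a1 a2] := dyadic_indexP n s0; set j := dyadic_index n s in a1 a2 *.
have -> : (s \in cell n k) = (k%:R <= s * 2 ^+ n < k.+1%:R).
  apply/idP/idP; rewrite inE /cell /= !in_itv/= /dyadic.
    by move=> [_ /andP[h1 h2]]; rewrite -ler_pdivrMr// h1 -ltr_pdivlMr.
  by move=> /andP[h1 h2]; split=> //; rewrite ler_pdivrMr// h1 ltr_pdivlMr.
apply/andP/eqP => [[h1 h2]|->//].
apply/eqP; rewrite eqn_leq; apply/andP; split; rewrite -ltnS -(ltr_nat R).
  exact: le_lt_trans h1 a2.
exact: le_lt_trans a1 h2.
Qed.

Let FnE n w s : 0 <= s <= 1 -> Fn n (w, s) = Z (dyadic R n (dyadic_index n s)) w.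
Proof.
move=> s01; have jn := dyadic_index_le n s01; rewrite -ltnS in jn.
rewrite /Fn (bigD1 (Ordinal jn))//= big1 ?addr0 => [|k kj].
  by rewrite indicE cell_index// eqxx mulr1.
rewrite indicE cell_index//; have -> : (val k == dyadic_index n s) = false.
  by apply: negbTE; apply: contra kj => /eqP e; apply/eqP/val_inj.
by rewrite mulr0.
Qed.

Let FnF (p : T * measurableTypeR R) : Fn n p @[n --> \oo] --> F p.
Proof.
case: p => w s; rewrite /F /=; case: (boolP (0 <= s <= 1)) => s01; last first.
  have -> : \1_(`[0, 1]%classic : set R) s = 0 :> R.
    by rewrite indicE memNset//= in_itv/=; exact/negP.
  rewrite mulr0; have -> : Fn ^~ (w, s) = fun=> 0; last exact: cvg_cst.
  apply/funext => n; rewrite /Fn big1// => k _ /=.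
  by rewrite indicE memNset ?mulr0// => -[/=]; rewrite in_itv/= (negbTE s01).
rewrite indicE mem_set/= ?in_itv//= mulr1.
apply/cvgrPdist_le => /= e e0; have [dl dl0 Hd] := cont01_at (@cZ w) s01 e0.
have h : 0 <= (2^-1 : R) < 1 by lra.
have [N HN] := expr_small h (divr_gt0 dl0 (ltr0n R 2)).
exists N => // n /= Nn; rewrite FnE//; have /andP[s0 _] := s01.
have := dyadic_near n s0; set y := dyadic _ _ _ => /andP[y1 y2].
apply: Hd; first by apply: dyadic01; exact: dyadic_index_le.
rewrite ger0_norm//; apply: lt_le_trans y2 _; rewrite -exprVn.
by apply: le_trans (HN _ Nn) _; lra.
Qed.

Let mF : measurable_fun [set: T * measurableTypeR R] F.
Proof. by apply: (measurable_fun_cvg mFn) => p _; exact: FnF. Qed.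

Let Ft t (p : T * measurableTypeR R) : \bar R :=
  (F p * \1_(`[0, t]%classic : set R) p.2)%:E.

Let mFt t : measurable_fun [set: T * measurableTypeR R] (Ft t).
Proof.
apply/measurable_EFinP; apply: measurable_funM => //.
apply: (@measurableT_comp _ _ _ _ _ _ (\1_(`[0, t]%classic) : measurableTypeR R -> R)).
  exact: measurable_indic.
exact: measurable_snd.
Qed.

Let prim_Ft t w : t <= 1 ->
  (\int[mu]_(s in `[0%R, t]) (Z s w)%:E = \int[mu]_s Ft t (w, s))%E.
Proof.
move=> t1; rewrite integral_mkcond; apply: eq_integral => s _; rewrite patchE /Ft /F /=.
rewrite !indicE; case: ifP => [|_]; last by rewrite mulr0.
move=> st; rewrite mulr1 mem_set ?mulr1//=.
move: st; rewrite inE/= !in_itv/= => /andP[-> st].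
exact: le_trans t1.
Qed.

Lemma measurable_prim t : t <= 1 -> measurable_fun [set: T] (fun w => prim (fun s => Z s w) t).
Proof.
move=> t1; rewrite (_ : (fun w => _) = fine \o (fun w => \int[mu]_s Ft t (w, s))%E); last first.
  by apply/funext => w; rewrite /= -prim_Ft.
apply: measurableT_comp; first exact: fine_measurable.
have -> : (fun w => \int[mu]_s Ft t (w, s))%E =
    (fun w => \int[mu]_s (Ft t)^\+ (w, s) - \int[mu]_s (Ft t)^\- (w, s))%E.
  by apply/funext => w; rewrite [LHS]integralE; congr (_ - _)%E;
    apply: eq_integral => s _; rewrite !(funeposE, funenegE).
apply: emeasurable_funB.
  apply: (@measurable_fun_fubini_tonelli_F _ _ _ _ _ mu ((Ft t)^\+%E)) => //.
  exact: measurable_funepos.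
apply: (@measurable_fun_fubini_tonelli_F _ _ _ _ _ mu ((Ft t)^\-%E)) => //.
exact: measurable_funeneg.
Qed.

(** The uniform bound on E |Z_s| gives integrability over the product, and Fubini's theorem
    exchanges the expectation and the time integral. *)
Lemma hasE_prim (m : R -> R) (C : R) : (forall s, 0 <= s <= 1 -> hasE P (Z s) (m s)) ->
  (forall s, 0 <= s <= 1 -> exists2 a, hasE P (fun w => `|Z s w|) a & a <= C) ->
  hasE P (fun w => prim (fun s => Z s w) 1) (prim m 1).
Proof.
move=> hm hC.
have FtE w s : Ft 1 (w, s) = (Z s w * \1_(`[0, 1]%classic : set R) s)%:E.
  by rewrite /Ft /F /= -mulrA !indicE; case: (_ \in _); rewrite ?mulr1 ?mulr0.
have FE w (s : R) : F (w, s) * \1_(`[0, 1]%classic : set R) s = Z s w * \1_(`[0, 1]%classic : set R) s.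
  by rewrite /F /= -mulrA !indicE; case: (_ \in _); rewrite ?mulr1 ?mulr0.
have s01P (s : R) : (s \in (`[0, 1]%classic : set R)) = (0 <= s <= 1).
  by apply/idP/idP; rewrite inE/= in_itv.
have intF : (P \x mu)%E.-integrable [set: T * measurableTypeR R] (Ft 1).
  apply/(integrable21ltyP _ _ (mFt 1)).
  apply: (@le_lt_trans _ _ (\int[mu]_(s in `[0%R, 1%R]) C%:E)%E); last first.
    rewrite integral_cst//= lebesgue_measure_itv/= lte_fin ltr01 oppr0 adde0 mule1.
    exact: ltry.
  rewrite [leRHS]integral_mkcond; apply: ge0_le_integral => //=.
  - by move=> s _; exact: integral_ge0.
  - apply: (@measurable_fun_fubini_tonelli_G _ _ _ _ _ P (fun p => `|Ft 1 p|)%E) => //.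
    exact: measurableT_comp.
  - by apply/(measurable_restrictT _ _).1.
  - move=> s _; rewrite patchE s01P; case: ifP => s01.
      have [a ha aC] := hC s s01; apply: (@le_trans _ _ a%:E); last by rewrite lee_fin.
      rewrite le_eqVlt; apply/orP; left; apply/eqP; have [_ <-] := ha.
      by apply: eq_integral => w _; rewrite FE indicE s01P s01 mulr1.
    rewrite integral0_eq// => w _; rewrite FE indicE s01P s01 mulr0 normr0//.
have i1 : 0 <= (1 : R) <= 1 by rewrite ler01 lexx.
have primE w : (\int[mu]_s Ft 1 (w, s) = (prim (fun s => Z s w) 1)%:E)%E.
  rewrite -prim_Ft// fineK//; apply: integrable_fin_num => //.
  exact: (cont01_integrable i1 (@cZ w)).
have EF := Fubini intF.
have intP := integrable_fubini_F intF.
have intP' : P.-integrable [set: T] (EFin \o (fun w => prim (fun s => Z s w) 1)).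
  by apply: eq_integrable intP => //= w _; rewrite /fubini_F primE.
split => //.
have E : (\int[P]_w (prim (fun s => Z s w) 1)%:E = \int[mu]_(s in `[0%R, 1%R]) (m s)%:E)%E.
  under eq_integral do rewrite -primE.
  rewrite EF [RHS]integral_mkcond; apply: eq_integral => s _; rewrite patchE s01P; case: ifP => s01.
    by have [_ <-] := hm s s01; apply: eq_integral => w _; rewrite FtE indicE s01P s01 mulr1.
  by rewrite integral0_eq// => w _; rewrite FtE indicE s01P s01 mulr0.
by rewrite [in RHS]/prim /Rintegral fineK -E//; exact: (integrable_fin_num measurableT intP').
Qed.

End continuous_process.

(** * Stratonovich and Young integrals of fractional Brownian motion *)

Section fBm_paths.
Context (R : realType) (d : measure_display) (T : measurableType d) (P : probability T R).
Context (H : R) (B : R -> {RV P >-> R}).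
Hypothesis hB : is_fBm H B.
Hypothesis H0 : 0 < H.

Lemma fBm_regular_cubic (eta : R) : H = 2^-1 -> 0 < eta -> exists G : set T,
  [/\ measurable G, (P (~` G) <= eta%:E)%E & regular_paths 3 (path_of B @` G)].
Proof.
(* The value 3/4 lies between 2^(-1/2) and 2^(-1/3): its square 9/16 exceeds 1/2 and its cube 27/64
   is below 1/2. *)
move=> hH eta0; apply: (fBm_regular_events hB H0 (r := 3 / 4)) => //; try lra.
have -> : 2 * H = 1 by rewrite hH; lra.
by rewrite powRr1 ?expr2; lra.
Qed.

Lemma fBm_regular_square (eta : R) : 2^-1 < H -> 0 < eta -> exists G : set T,
  [/\ measurable G, (P (~` G) <= eta%:E)%E & regular_paths 2 (path_of B @` G)].
Proof.
move=> hH eta0.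
have rho : 2^-1 `^ (2 * H) < 2^-1 :> R.
  have -> : 2 * H = 1 + (2 * H - 1) by ring.
  rewrite powRD; last by rewrite invr_eq0 pnatr_eq0 implybT.
  rewrite powRr1 ?invr_ge0// gtr_pMr ?invr_gt0// /powR invr_eq0 pnatr_eq0/= expR_lt1.
  have : ln 2^-1 < 0 :> R by apply: ln_lt0; lra.
  by move=> l0; rewrite pmulr_rlt0//; lra.
have rho0 : 0 <= 2^-1 `^ (2 * H) :> R by exact: powR_ge0.
(* The midpoint of 2^(-2 H) and 1/2, distinct numbers since H > 1/2; its square root is the ratio
   r. *)
set r2 : R := (2^-1 `^ (2 * H) + 2^-1) / 2.
have r20 : 0 < r2 by rewrite /r2; lra.
have rr : Num.sqrt r2 ^+ 2 = r2 by rewrite sqr_sqrtr// ltW.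
apply: (fBm_regular_events hB H0 (r := Num.sqrt r2)) => //.
- by rewrite sqrtr_gt0.
- have -> : 1 = Num.sqrt 1 :> R by rewrite sqrtr1.
  by rewrite ltr_sqrt//; rewrite /r2; lra.
- by rewrite rr /r2; lra.
- by rewrite rr /r2; lra.
Qed.

Lemma fBm_cont01 w : cont01 (path_of B w).
Proof. by have [cB _ _ _] := hB; exact: cB. Qed.

Lemma measurable_ev e t : 0 <= t <= 1 ->
  measurable_fun [set: T] (fun w => ev e (path_of B w) t).
Proof.
elim: e t => [|c|n|a iha b ihb|a iha b ihb|a iha] t t01 /=.
- exact: measurable_cst.
- exact: measurable_cst.
- apply: (@measurable_funX _ _ _ _ (B t) n); exact: measurable_funPT.
- by apply: measurable_funD; [exact: iha|exact: ihb].
- by apply: measurable_funM; [exact: iha|exact: ihb].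
- apply: (@measurable_prim _ _ _ (fun s w => ev a (path_of B w) s)) => //.
    by move=> w; apply: cont01_ev; exact: fBm_cont01.
  by case/andP: t01.
Qed.

Lemma measurable_evt l t : 0 <= t <= 1 ->
  measurable_fun [set: T] (fun w => evt l (path_of B w) t).
Proof.
move=> t01; apply: (@measurable_sum _ _ _ _ _ _ (fun m w => evm m (path_of B w) t)) => m.
apply: measurable_funM; last first.
  apply: (@measurable_funX _ _ _ _ (B t)); exact: measurable_funPT.
apply: measurable_funD; first exact: measurable_cst.
exact: (@measurable_ev (Prim m.1.2)).
Qed.

End fBm_paths.

(** * Stratonovich iterated integrals at H = 1/2 *)

Section stratonovich.
Context (R : realType) (d : measure_display) (T : measurableType d) (P : probability T R).
Implicit Types (X Z : R -> {RV P >-> R}) (Y : {RV P >-> R}).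

Lemma measurable_trapezoid X Z Y s : measurable_fun [set: T] (fun w =>
  `| \sum_(k < size s) (X (part_pt s k) w + X (part_pt s k.+1) w) / 2
     * (Z (part_pt s k.+1) w - Z (part_pt s k) w) - Y w |).
Proof.
apply: measurableT_comp => //; apply: measurable_funB; last exact: measurable_funPT.
apply: measurable_sum => k; apply: measurable_funM.
  by apply: measurable_funM => //; apply: measurable_funD; exact: measurable_funPT.
by apply: measurable_funB; exact: measurable_funPT.
Qed.

Lemma ae_eq_prob (f g : T -> R) : measurable_fun [set: T] f -> measurable_fun [set: T] g ->
  (forall eps eta : R, 0 < eps -> 0 < eta -> (P [set w | eps < `|f w - g w|]%R <= eta%:E)%E) ->
  {ae P, forall w, f w = g w}.
Proof.
move=> mf mg h.
have md (eps : R) : measurable [set w | eps < `|f w - g w|].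
  by apply: measurable_gt; apply: measurableT_comp => //; exact: measurable_funB.
have P0 (eps : R) : 0 < eps -> P [set w | eps < `|f w - g w|] = 0%E.
  move=> e0; apply/eqP; rewrite -measure_le0; apply/lee_addgt0Pr => eta eta0.
  by rewrite add0e; exact: h.
pose A n := [set w | n.+1%:R^-1 < `|f w - g w|].
have [N [mN PN AN]] : P.-negligible (\bigcup_n A n).
  apply: negligible_bigcup => n; exists (A n); split => //; first exact: md.
  by apply: P0; rewrite invr_gt0.
exists N; split => //; apply: subset_trans AN => w /= fg.
have : 0 < `|f w - g w| by rewrite normr_gt0 subr_eq0; apply/eqP.
move=> /ltr_add_invr [n hn]; exists n => //=.
by move: hn; rewrite add0r.
Qed.

Lemma stratonovich_int_unique X Z t Y Y' : 0 <= t -> is_stratonovich_int X Z t Y ->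
  is_stratonovich_int X Z t Y' -> {ae P, forall w, Y w = Y' w}.
Proof.
move=> t0 hY hY'; apply: ae_eq_prob; [exact: measurable_funPT|exact: measurable_funPT|].
move=> eps eta eps0 eta0.
have [e2 n2] : 0 < eps / 2 /\ 0 < eta / 2 by rewrite !divr_gt0.
have [dl dl0 h] := hY _ _ e2 n2; have [dl' dl'0 h'] := hY' _ _ e2 n2.
have m0 : 0 < Num.min dl dl' by rewrite lt_min dl0.
have [s sp sm] := exists_partition t0 m0.
have mm (D : R) : Num.min dl dl' <= D -> mesh_lt s D.
  by move=> hD k ks; apply: lt_le_trans hD; exact: sm.
have := h s sp (mm _ _); rewrite ge_min lexx => /(_ isT) {}h.
have := h' s sp (mm _ _); rewrite ge_min lexx orbT => /(_ isT) {}h'.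
have -> : eta = eta / 2 + eta / 2 by lra.
rewrite EFinD; apply: le_trans _ (leeD h h').
have mA Y0 := measurable_gt (eps / 2) (measurable_trapezoid X Z Y0 s).
apply: le_trans _ (measureU2 P (mA Y) (mA Y')).
apply: le_measure; rewrite ?inE; [|exact: measurableU|].
  apply: measurable_gt; apply: measurableT_comp => //.
  by apply: measurable_funB; exact: measurable_funPT.
move=> w /= hw; apply: contrapT => /not_orP[/negP + /negP]; rewrite -!leNgt.
set S := \sum_(k < _) _ => a b; move: hw; rewrite ltNge => /negP; apply.
have -> : Y w - Y' w = (S - Y' w) - (S - Y w) by ring.
by apply: le_trans (ler_normB _ _) _; lra.
Qed.

Context (B : R -> {RV P >-> R}).
Hypothesis hB : is_fBm 2^-1 B.

Let H0 : 0 < 2^-1 :> R. Proof. by rewrite invr_gt0. Qed.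

(** Off an event of probability at most eta, the trapezoidal sums are close to the functional for
    all partitions below one mesh. The integrand need only be known almost surely at each time,
    because a partition has finitely many points. *)
Lemma is_stratonovich_evt X (l : seq (cterm R)) i t Y : 0 <= t <= 1 ->
  (forall u, 0 <= u <= 1 -> {ae P, forall w, X u w = evt l (path_of B w) u}) ->
  {ae P, forall w, Y w = evt (integ i l) (path_of B w) t} ->
  is_stratonovich_int X (process_hat B i) t Y.
Proof.
move=> t01 hX hY eps eta eps0 eta0; have /andP[t0 t1] := t01.
have [G [mG PG rG]] := fBm_regular_cubic hB H0 erefl eta0.
have [dl dl0 Hd] := trapezoid_sums i l (isT : (0 < 3 <= 3)%N) rG eps0.
exists dl => // s sp sm.
(* Past the end of the partition [part_pt] takes the default value 0, so the bound holds for all k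
   and the null sets can be united over all natural numbers. *)
have pt01 k : 0 <= part_pt s k <= 1.
  have [ks|ks] := leqP k (size s); last by rewrite /part_pt nth_default// lexx ler01.
  by rewrite (part_pt_ge0 sp ks)/= (le_trans (part_pt_le sp ks)).
have [N [mN PN hN]] : {ae P, forall w, (forall k, X (part_pt s k) w =
    evt l (path_of B w) (part_pt s k)) /\ Y w = evt (integ i l) (path_of B w) t}.
  by apply: filterI => //; apply: ae_foralln => k; exact: hX.
have mD := measurable_gt eps (measurable_trapezoid X (process_hat B i) Y s).
apply: (@le_trans _ _ (P (~` G `|` N))).
  apply: le_measure; rewrite ?inE//; first by apply: measurableU => //; exact: measurableC.
  move=> w /= hw; apply: contrapT => /not_orP[wG wN].
  have {}wG : G w by apply: contrapT.
  have [Xw Yw] : (forall k, X (part_pt s k) w = evt l (path_of B w) (part_pt s k)) /\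
      Y w = evt (integ i l) (path_of B w) t by apply: contrapT => /hN.
  move: hw; rewrite ltNge => /negP; apply.
  apply: le_trans (Hd (path_of B w) t s _ t1 sp sm); last by exists w.
  rewrite Yw le_eqVlt; apply/orP; left; apply/eqP; congr (`|_ - _|).
  apply: eq_bigr => k _; rewrite !Xw; congr (_ * _).
  by case: (i).
apply: le_trans (measureU2 P (measurableC mG) mN) _.
by rewrite [X in (_ + X)%E]PN adde0.
Qed.

(** The integral is a choice among the limits in probability. The functional [evt (integ i l)], a
    random variable by measurability, shows that a limit exists, and almost sure uniqueness
    identifies the chosen one with it. *)
Lemma stratonovich_foldl (w : seq bool) X (l : seq (cterm R)) t : 0 <= t <= 1 ->
  (forall u, 0 <= u <= 1 -> {ae P, forall o, X u o = evt l (path_of B o) u}) ->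
  {ae P, forall o, foldl (fun (I : R -> {RV P >-> R}) (i : bool) (t : R) =>
    stratonovich_int I (process_hat B i) t) X w t o =
    evt (foldl (fun l i => integ i l) l w) (path_of B o) t}.
Proof.
move=> t01; elim: w X l => [|i w ih] X l hX /=; first exact: hX.
apply: ih => u u01; have /andP[u0 u1] := u01.
pose Y : {RV P >-> R} :=
  mfun_Sub (mem_set (measurable_evt hB (integ i l) u01)).
have YE : {ae P, forall o, Y o = evt (integ i l) (path_of B o) u}.
  exact: aeW.
have hY := is_stratonovich_evt u01 hX YE.
have hS : is_stratonovich_int X (process_hat B i) u
    (stratonovich_int X (process_hat B i) u).
  by apply: (@xgetPex _ _ [set Y | is_stratonovich_int X (process_hat B i) u Y]); exists Y.
apply: filterS2 (stratonovich_int_unique u0 hS hY) YE => o.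
by move=> ->.
Qed.

Lemma stratonovich_iterE (w : seq bool) t : 0 <= t <= 1 ->
  {ae P, forall o, stratonovich_iter B w t o = evt (iterated R w) (path_of B o) t}.
Proof.
move=> t01; apply: stratonovich_foldl => // u /andP[u0 _].
by apply: aeW => o /=; rewrite (evt_iterated_nil _ u0).
Qed.

End stratonovich.

(** * Integrals of almost everywhere equal functions *)

Section nonmeasurable.
Import HBNNSimple.
Context (d : measure_display) (T : measurableType d) (R : realType).
Context (mu : {measure set T -> \bar R}).
Implicit Types f g : T -> \bar R.

(* No measurability of f or g: a simple function below f, cut off on the
   exceptional null set, is below g and has the same integral. *)
Lemma ge0_le_integral_ae f g : (forall w, 0 <= f w)%E -> (forall w, 0 <= g w)%E ->
  {ae mu, forall w, (f w <= g w)%E} -> (\int[mu]_w f w <= \int[mu]_w g w)%E.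
Proof.
move=> f0 g0 [N [mN muN hN]].
rewrite !ge0_integralE// !patch_setT.
apply: ge_ereal_sup => _ [h /= hf <-].
pose h' := proj_nnsfun h (measurableC mN).
have -> : sintegral mu h = sintegral mu h'.
  have := integral_nnsfun mu measurableT h; rewrite patch_setT => <-.
  have := integral_nnsfun mu measurableT h'; rewrite patch_setT => <-.
  apply: ae_eq_integral => //.
    1,2: by apply/measurable_EFinP; exact: measurable_funPT.
  exists N; split => // w /= hw; apply: contrapT => wN; apply: hw => _.
  by rewrite /= mindicE mem_set// mulr1.
apply: ereal_sup_ubound; exists h' => //= w.
rewrite mindicE; case: (boolP (w \in ~` N)) => [/set_mem wN|_]; last by rewrite mulr0.
rewrite mulr1; apply: le_trans (hf w) _.
by apply: contrapT => /hN.
Qed.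

Lemma ae_eq_integral_nonmeasurable f g :
  {ae mu, forall w, f w = g w} -> (\int[mu]_w f w = \int[mu]_w g w)%E.
Proof.
move=> fg; rewrite integralE [RHS]integralE.
have le f' g' : {ae mu, forall w, f' w = g' w} ->
    (\int[mu]_w (f'^\+ w) <= \int[mu]_w (g'^\+ w))%E /\
    (\int[mu]_w (f'^\- w) <= \int[mu]_w (g'^\- w))%E.
  move=> fg'; split; apply: ge0_le_integral_ae => //;
    by apply: filterS fg' => w; rewrite ?funeposE ?funenegE => ->.
have gf : {ae mu, forall w, g w = f w} by apply: filterS fg.
have [a1 a2] := le _ _ fg; have [b1 b2] := le _ _ gf.
by congr (_ - _)%E; apply/eqP; rewrite eq_le ?a1 ?a2.
Qed.

End nonmeasurable.

Section expectation.
Context (R : realType) (d : measure_display) (T : measurableType d) (P : probability T R).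
Context (H : R) (B : R -> {RV P >-> R}).
Hypothesis hB : is_fBm H B.
Hypothesis hH : 2^-1 <= H.

Let H0 : 0 < H. Proof. by apply: lt_le_trans hH; rewrite invr_gt0. Qed.

(** The events of regular paths have complements of probability at most 1 / (n + 1), so almost every
    path lies in one of them; that is enough for a pathwise identity. *)
Lemma young_iter_ae (w : seq bool) : 2^-1 < H ->
  {ae P, forall o, young_iter (path_of B o) w 1 = evt (iterated R w) (path_of B o) 1}.
Proof.
move=> H2; have i1 : 0 <= (1 : R) <= 1 by rewrite ler01 lexx.
have /choice[G hG] (n : nat) : exists G : set T, [/\ measurable G,
    (P (~` G) <= (n.+1%:R^-1 : R)%:E)%E & regular_paths 2 (path_of B @` G)].
  by apply: (fBm_regular_square hB) => //; rewrite invr_gt0.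
have mG n : measurable (~` G n) by have [mG _ _] := hG n; exact: measurableC.
have mI : measurable (\bigcap_n ~` G n) by exact: bigcapT_measurable.
exists (\bigcap_n ~` G n); split => //.
  apply/eqP; rewrite -measure_le0; apply/lee_addgt0Pr => eps eps0; rewrite add0e.
  have [n hn] := ltr_add_invr eps0; rewrite add0r in hn.
  apply: (@le_trans _ _ (P (~` G n))).
    by apply: le_measure; rewrite ?inE//; exact: bigcap_inf.
  by have [_ h _] := hG n; apply: le_trans h _; rewrite lee_fin ltW.
move=> o /= ho n _ /= Gno; apply: ho; have [_ _ rG] := hG n.
by apply: (young_iterE _ rG) => //; exists o.
Qed.

(* young_iter need not be measurable off the event where the paths are regular, so
   both expectations are compared through [ae_eq_integral_nonmeasurable]. *)
Lemma fBm_iter_expectation (w : seq bool) (a : R) :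
  hasE P (fun o => evt (iterated R w) (path_of B o) 1) a ->
  ('E_P[fBm_iter H B w] = a%:E)%E.
Proof.
move=> ha; have i1 : 0 <= (1 : R) <= 1 by rewrite ler01 lexx.
have [_ <-] := ha; rewrite unlock; apply: ae_eq_integral_nonmeasurable.
rewrite /fBm_iter; case: eqP => [e|/eqP ne].
  have hB' : is_fBm 2^-1 B by rewrite -e.
  by apply: filterS (stratonovich_iterE hB' w i1) => o ->.
have H2 : 2^-1 < H by rewrite lt_neqAle eq_sym ne.
by apply: filterS (young_iter_ae w H2) => o <-.
Qed.

End expectation.

(** * Expected iterated integrals *)

Section power_integrals.
Context (R : realType).
Implicit Types p t : R.

Lemma derivable_LR_powR p : 0 < p -> derivable_oo_LRcontinuous (fun t => t `^ p) 0 1.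
Proof.
move=> p0; split=> [t|/=|/=].
- rewrite in_itv/= => /andP[t0 _].
  by have [] := is_derive1_powR p t0.
- by rewrite powR0 ?gt_eqF//; exact: powR_cvg0.
- have [d1 _] := is_derive1_powR p (ltr01 : 0 < 1 :> R).
  have c1 : {for 1, continuous (fun t : R => t `^ p)}.
    by apply: differentiable_continuous; apply/derivable1_diffP.
  exact: cvg_at_left_filter c1.
Qed.

Lemma cont01_powR p : 0 < p -> cont01 (fun t => t `^ p).
Proof. by move=> p0; exact: derivable_oo_LRcontinuous_within (derivable_LR_powR p0). Qed.

Lemma prim_powR p : 0 < p -> prim (fun t => t `^ p) 1 = (p + 1)^-1.
Proof.
move=> p0; have p1 : 0 < p + 1 by rewrite addr_gt0.
rewrite (@prim_FTC _ _ (fun t => (p + 1)^-1 * t `^ (p + 1)))//.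
- by rewrite powR1 powR0 ?gt_eqF// mulr0 subr0 mulr1.
- exact: cont01_powR.
- have [h1 h2 h3] := derivable_LR_powR p1; split=> [t t01||].
  + by apply: derivableM => //; exact: h1.
  + by apply: cvgM; [exact: cvg_cst|exact: h2].
  + by apply: cvgM; [exact: cvg_cst|exact: h3].
- move=> t; rewrite in_itv/= => /andP[t0 _].
  have [h1 h2] := is_derive1_powR (p + 1) t0.
  rewrite derive1E deriveM//.
  rewrite h2 derive_cst scaler0 addr0 addrK /GRing.scale/=.
  by rewrite mulrA mulVf ?mul1r// gt_eqF.
Qed.

Lemma prim_reflection f : cont01 f -> prim (fun t => f (1 - t)) 1 = prim f 1.
Proof.
move=> cf; have i1 : 0 <= (1 : R) <= 1 by rewrite ler01 lexx.
by rewrite /prim [RHS](Rintegration_by_substitution_onem i1 cf) /unstable.onem subrr.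
Qed.

Lemma cont01_reflection f : cont01 f -> cont01 (fun t => f (1 - t)).
Proof.
move=> cf; have r01 (s : R) : 0 <= s <= 1 -> 0 <= 1 - s <= 1 by lra.
apply/subspace_continuousP => s /=; rewrite in_itv/= => s01.
apply/cvgrPdist_le => eps e0; have [dl dl0 h] := cont01_at cf (r01 s s01) e0.
exists dl => // y /= sy; rewrite in_itv/= => y01; apply: h; first exact: r01.
have -> : 1 - s - (1 - y) = y - s by ring.
by rewrite distrC.
Qed.

(** The integrals of s^(2 H) and (1 - s)^(2 H) over [0, 1] cancel by reflection, leaving half the
    integral of 1 whatever H is. *)
Lemma prim_fcov (H : R) : 0 < H -> prim (fun s => fcov H s 1) 1 = 2^-1.
Proof.
move=> H0; have p0 : 0 < 2 * H by rewrite mulr_gt0.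
have i1 : 0 <= (1 : R) <= 1 by rewrite ler01 lexx.
have c := cont01_powR p0; have cr := cont01_reflection c.
have cD : cont01 (fun s : R => s `^ (2 * H) + 1) by apply: cont01D => //; exact: cont01_cst.
have cN : cont01 (fun s : R => -1 * (1 - s) `^ (2 * H)) by apply: cont01M => //; exact: cont01_cst.
rewrite (@eq_prim _ _ (fun s : R => 2^-1 * (s `^ (2 * H) + 1 + -1 * (1 - s) `^ (2 * H))))//.
  rewrite primZ//; last exact: cont01D.
  rewrite primD// primD//; last exact: cont01_cst.
  rewrite primZ// (@prim_reflection (fun t : R => t `^ (2 * H)))// prim_cst//; ring.
move=> s s01; rewrite /fcov powR1 distrC ger0_norm ?mulN1r//; lra.
Qed.

End power_integrals.

Section word_means.
Context (R : realType) (d : measure_display) (T : measurableType d) (P : probability T R).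
Context (H : R) (B : R -> {RV P >-> R}).
Hypothesis hB : is_fBm H B.
Hypothesis H0 : 0 < H.

Let i1 : 0 <= (1 : R) <= 1. Proof. by rewrite ler01 lexx. Qed.

Let mB s : measurable_fun [set: T] (B s). Proof. exact: measurable_funPT. Qed.

Lemma normr_monomial_le (x y : R) n k : (n + k <= 4)%N ->
  `|x ^+ n * y ^+ k| <= 1 + x ^+ 4 + y ^+ 4.
Proof.
move=> nk; pose M := Num.max 1 (Num.max `|x| `|y|).
have [M1 xM yM] : [/\ 1 <= M, `|x| <= M & `|y| <= M].
  by rewrite /M !le_max !lexx !orbT.
have M0 : 0 <= M by lra.
apply: (@le_trans _ _ (M ^+ 4)).
  rewrite normrM !normrX; apply: (@le_trans _ _ (M ^+ n * M ^+ k)).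
    by apply: ler_pM => //; rewrite ?exprn_ge0//; apply: lerXn2r; rewrite ?nnegrE.
  by rewrite -exprD; apply: ler_weXn2l.
have x4 : 0 <= x ^+ 4 by rewrite (exprM x 2 2) sqr_ge0.
have y4 : 0 <= y ^+ 4 by rewrite (exprM y 2 2) sqr_ge0.
have e4 (z : R) : `|z| ^+ 4 = z ^+ 4 by rewrite -normrX ger0_norm// (exprM z 2 2) sqr_ge0.
by rewrite /M /Num.max; case: ifP => _; [case: ifP => _|]; rewrite ?e4 ?expr1n; lra.
Qed.

(** The bound is 7 = 1 + 3 + 3, the fourth moments of B_s and B_1 being at most 3. *)
Lemma fBm_monomial_bound s n k : 0 <= s <= 1 -> (n + k <= 4)%N ->
  exists2 e, hasE P (fun w => `|B s w ^+ n * B 1 w ^+ k|) e & e <= 7.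
Proof.
move=> s01 nk; have h := hasED (hasED (hasE_cst P 1) (fBm_fourth hB H0 s01)) (fBm_fourth hB H0 i1).
have m : measurable_fun [set: T] (fun w => `|B s w ^+ n * B 1 w ^+ k|).
  by apply: measurableT_comp => //; apply: measurable_funM; exact: measurable_funX.
have [w|e he eb] := hasE_dominated m h.
  by rewrite normr_id; exact: normr_monomial_le.
exists e => //; apply: le_trans (ler_norm _) _; apply: le_trans eb _.
rewrite powR1; have /andP[s0 s1] := s01.
have a0 : 0 <= s `^ (2 * H) by exact: powR_ge0.
have a1 : s `^ (2 * H) <= 1.
  apply: (@le_trans _ _ (1 `^ (2 * H))); last by rewrite powR1.
  by apply: ge0_ler_powR; rewrite ?nnegrE ?mulr_ge0 ?(ltW H0).
have : (s `^ (2 * H)) ^+ 2 <= 1 by rewrite expr_le1.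
lra.
Qed.

(** The factor B_1^k is moved under the time integral, so that only the mixed moments E B_s^n B_1^k
    remain to be integrated. *)
Lemma hasE_moment_mul a n k (m : R -> R) : (n + k <= 4)%N ->
  (forall s, 0 <= s <= 1 -> hasE P (fun w => B s w ^+ n * B 1 w ^+ k) (m s)) ->
  hasE P (fun w => moment (path_of B w) a n * B 1 w ^+ k) (prim (fun s => s ^+ a * m s) 1).
Proof.
move=> nk hm; pose Z (s : R) w := s ^+ a * (B s w ^+ n * B 1 w ^+ k).
have cm w : cont01 (fun s : R => s ^+ a * path_of B w s ^+ n).
  by apply: cont01M; apply: cont01X; [exact: cont01_id|exact: (fBm_cont01 hB)].
apply: (@eq_hasE _ _ _ _ (fun w => prim (fun s => Z s w) 1)) (erefl _) _ => [w|].
  rewrite /moment mulrC -primZ//; apply: eq_prim => // u _.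
  by rewrite /Z /path_of; ring.
apply: (@hasE_prim _ _ _ _ Z _ _ (fun s => s ^+ a * m s) 7) => [w|s s01|s s01|s s01].
- have := cont01M (cm w) (@cont01_cst R (B 1 w ^+ k)).
  by congr cont01; apply/funext => s; rewrite /Z mulrA.
- apply: measurable_funM => //; apply: measurable_funM; exact: measurable_funX.
- exact/hasEZ/hm.
- have [e he eb] := fBm_monomial_bound s01 nk; have /andP[s0 s1] := s01.
  have [sa0 sa1] : 0 <= s ^+ a /\ s ^+ a <= 1 by rewrite exprn_ge0// exprn_ile1.
  exists (s ^+ a * e).
    apply: eq_hasE (hasEZ (s ^+ a) he) => // w.
    by rewrite /Z [RHS]normrM (ger0_norm sa0).
  have e0 : 0 <= e by apply: hasE_le (hasE_cst P 0) he _ => w /=.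
  by apply: le_trans eb; rewrite ler_piMl.
Qed.

Lemma hasE_moment_mul0 a n k : (n + k <= 4)%N ->
  (forall s, 0 <= s <= 1 -> hasE P (fun w => B s w ^+ n * B 1 w ^+ k) 0) ->
  hasE P (fun w => moment (path_of B w) a n * B 1 w ^+ k) 0.
Proof.
move=> nk h; apply: eq_hasE (hasE_moment_mul a nk h) => //.
rewrite -[RHS](mul0r 1) -[RHS](prim_cst 0 ler01).
by apply: eq_prim => // u _; rewrite mulr0.
Qed.

Lemma hasE_moment_odd a n : (n <= 3)%N -> odd n -> hasE P (fun w => moment (path_of B w) a n) 0.
Proof.
move=> n3 on; have := @hasE_moment_mul0 a n 0; rewrite addn0 (leq_trans n3)// => /(_ isT) h.
apply: eq_hasE (h _) => // [w|s s01]; first by rewrite expr0 mulr1.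
by apply: eq_hasE (fBm_odd hB H0 s01 on) => // w; rewrite expr0 mulr1.
Qed.

Lemma hasE_moment2 : hasE P (fun w => moment (path_of B w) 0 2) (2 * H + 1)^-1.
Proof.
have := @hasE_moment_mul 0 2 0 (fun s => s `^ (2 * H)) isT => h.
apply: eq_hasE (h _) => [w||s s01]; first by rewrite expr0 mulr1.
  rewrite -prim_powR ?mulr_gt0//; apply: eq_prim => // u _.
  by rewrite expr0 mul1r.
by apply: eq_hasE (fBm_sqr hB H0 s01) => // w; rewrite expr0 mulr1.
Qed.

Lemma hasE_moment1_mul : hasE P (fun w => moment (path_of B w) 0 1 * B 1 w) 2^-1.
Proof.
have := @hasE_moment_mul 0 1 1 (fun s => fcov H s 1) isT => h.
apply: eq_hasE (h _) => // [|s s01].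
  by rewrite -(prim_fcov H0); apply: eq_prim => // u _; rewrite expr0 mul1r.
by apply: eq_hasE (fBm_cov hB H0 s01 i1) => // w; rewrite !expr1.
Qed.

Lemma hasE_moment1_mul2 : hasE P (fun w => moment (path_of B w) 0 1 * B 1 w ^+ 2) 0.
Proof.
apply: hasE_moment_mul0 => // s s01.
by apply: eq_hasE (fBm_sqr_mul hB H0 i1 s01) => // w; rewrite expr1 mulrC.
Qed.

Lemma hasE_moment2_mul : hasE P (fun w => moment (path_of B w) 0 2 * B 1 w) 0.
Proof.
apply: (@hasE_moment_mul0 0 2 1) => // s s01.
exact: (fBm_sqr_mul hB H0 s01 i1).
Qed.

Lemma hasE_sqr1 : hasE P (fun w => B 1 w ^+ 2) 1.
Proof. by apply: eq_hasE (fBm_sqr hB H0 i1) => //; rewrite powR1. Qed.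

Lemma hasE_fourth1 : hasE P (fun w => B 1 w ^+ 4) 3.
Proof. by apply: eq_hasE (fBm_fourth hB H0 i1) => //; rewrite powR1 expr1n mulr1. Qed.

(** For size plus number of zeros at most 5, the default case consists exactly of the words with an
    odd number of letters 1. *)
Definition word_mean (w : seq bool) : R :=
  match w with
  | [::] => 1
  | [:: false] => 1
  | [:: false; false] | [:: true; true] => 1 / 2
  | [:: true; true; true; true] => 1 / 8
  | [:: true; true; false] | [:: false; true; true] => (2 * H + 1)^-1 / 2
  | [:: true; false; true] => 1 / 2 - (2 * H + 1)^-1
  | _ => 0
  end.

Lemma fBm_word_mean w : (size w + count_mem false w <= 5)%N ->
  hasE P (fun o => word_value (path_of B o) w) (word_mean w).
Proof.
have hc := hasE_cst P 1; have h2 := hasE_sqr1; have h4 := hasE_fourth1.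
have ho k (ok : odd k) := fBm_odd hB H0 i1 ok.
have h1 := ho 1%N isT; have h3 := ho 3%N isT; have h5 := ho 5%N isT.
have m01 := hasE_moment_odd 0 (isT : (1 <= 3)%N) isT.
have m11 := hasE_moment_odd 1 (isT : (1 <= 3)%N) isT.
have m03 := hasE_moment_odd 0 (isT : (3 <= 3)%N) isT.
have m02 := hasE_moment2; have m01x := hasE_moment1_mul.
have m01xx := hasE_moment1_mul2; have m02x := hasE_moment2_mul.
have comb X Y a b : hasE P X a -> X =1 Y -> a = b -> hasE P Y b.
  by move=> hX XY ab; apply: eq_hasE hX.
have HN : 2 * H + 1 != 0 by rewrite gt_eqF// addr_gt0// mulr_gt0.
case: w => [|[] [|[] [|[] [|[] [|[] [|? ?]]]]]] // _ /=; rewrite /path_of.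
- apply: comb hc _ _ => [w|//]; by rewrite expr0 divr1.
- apply: comb h1 _ _ => [w|//]; by rewrite divr1.
- apply: comb (hasEZ 2^-1 h2) _ _ => [w|]; rewrite /factorial/=; by field.
- apply: comb (hasEZ 6^-1 h3) _ _ => [w|]; rewrite /factorial/=; by field.
- apply: comb (hasEZ 24^-1 h4) _ _ => [w|]; rewrite /factorial/=; by field.
- apply: comb (hasEZ 120^-1 h5) _ _ => [w|]; rewrite /factorial/=; by field.
- apply: comb (hasEZ 6^-1 m03) _ _ => [w|]; by field.
- apply: comb (hasEZ 2^-1 m02) _ _ => [w|]; rewrite /path_of; by field.
- apply: comb (hasEB (hasEZ 2^-1 m02x) (hasEZ 2^-1 m03)) _ _ => [w|]; by field.
- apply: comb (hasEB m01x m02) _ _ => [w|]; by field.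
- apply: comb (hasED (hasEB (hasEZ 2^-1 m01xx) m02x) (hasEZ 2^-1 m03)) _ _ => [w|]; by field.
- apply: comb (hasEB m01 m11) _ _ => [w|]; by field.
- apply: comb (hasEB h1 m01) _ _ => [w|]; by field.
- apply: comb (hasED (hasEB (hasEZ 2^-1 h2) m01x) (hasEZ 2^-1 m02)) _ _ => [w|]; by field.
- apply: comb (hasEB (hasED (hasEB (hasEZ 6^-1 h3) (hasEZ 2^-1 m01xx)) (hasEZ 2^-1 m02x)) (hasEZ 6^-1 m03)) _ _ => [w|]; by field.
- apply: comb (hasEB (hasEZ 2 m11) m01) _ _ => [w|]; by field.
- apply: comb (hasEZ 2^-1 hc) _ _ => [w|]; by field.
- apply: comb (hasEB (hasEZ 2^-1 h1) m11) _ _ => [w|]; by field.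
Qed.

End word_means.

(** * Matching the cubature paths with the expectations *)

Section cubature_side.
Context (R : realType) (H : R).
Hypothesis hH : 2^-1 <= H < 1.

Lemma moment_opp (x : R -> R) a n : cont01 x ->
  moment (fun t => - x t) a n = (-1) ^+ n * moment x a n.
Proof.
by move=> cx; rewrite /moment; apply: prim_moment => // u _; rewrite (exprNn (x u)); ring.
Qed.

Lemma moment_zero a n : moment (fun=> 0 : R) a n.+1 = 0.
Proof.
rewrite -[RHS](mul0r 1) -[RHS](prim_cst 0 ler01).
by apply: eq_prim => // u _; rewrite expr0n mulr0.
Qed.

(** The zero path contributes only to words without the letter 1. The two opposite paths cancel on
    words with an odd number of letters 1, and on the other words count as one path of weight
    1/3. *)
Lemma cubature_word_mean w : (size w + count_mem false w <= 5)%N ->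
  \sum_(j < 3) weights R j * word_value (paths H j) w = word_mean H w.
Proof.
have c1 : cont01 (omega1 H) by exact: cont01_omega1.
have e1 := omega1_1 H.
have m1 := omega1_moment1 H; have m2 := omega1_moment2 hH; have a2 := alpha_sqr hH.
have a4 : alpha H ^+ 4 = 9 by rewrite (exprM _ 2 2) a2; ring.
have HN : 2 * H + 1 != 0.
  by have /andP[h1 h2] := hH; rewrite gt_eqF//; lra.
rewrite !big_ord_recl big_ord0 /weights /paths /=.
case: w => [|[] [|[] [|[] [|[] [|[] [|? ?]]]]]] // _ /=.
all: rewrite ?(moment_opp _ _ c1) ?moment_zero ?e1 ?m1 ?m2 /factorial/=.
all: move: (alpha H) (moment (omega1 H) 1 1) (moment (omega1 H) 0 3) a2 a4 => a m11 m03 a2 a4.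
all: try by field.
(* The words 11, 1111 and 101 remain, where the value of alpha matters: alpha^2 = 3 for the first
   and last, alpha^4 = 9 for the second. *)
- by transitivity (a ^+ 2 / 6); [field|rewrite a2; field].
- by transitivity (a ^+ 4 / 72); [field|rewrite a4; field].
- by transitivity (a ^+ 2 / 6 - (2 * H + 1)^-1); [field|rewrite a2; field].
Qed.

Lemma path_word_value (j : 'I_3) w : (size w + count_mem false w <= 5)%N ->
  young_iter (paths H j) w 1 = word_value (paths H j) w.
Proof.
have i1 : 0 <= (1 : R) <= 1 by rewrite ler01 lexx.
have val (x : R -> R) : regular_paths 2 [set x] -> (size w + count_mem false w <= 5)%N ->
    young_iter x w 1 = word_value x w.
  move=> rx hw; rewrite (young_iterE w rx erefl i1) evt_iterated//.
  by apply: (equicont_cont01 (equicont_path rx _)).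
move=> hw; case: j => [[|[|[|//]]] j3]; apply: val => //.
- exact: omega1_regular.
- exact: opp_omega1_regular.
- exact: zero_regular.
Qed.

(** The degree is 2 H times the number of ones plus twice the number of zeros, and 2 H >= 1. *)
Lemma word_degree_le w : word_degree H w <= 5 -> (size w + count_mem false w <= 5)%N.
Proof.
have cs : (count_mem false w)%:R <= (size w)%:R :> R by rewrite ler_nat count_size.
rewrite /word_degree -(ler_nat R) natrD => h; apply: le_trans h.
have /andP[h1 _] := hH; nra.
Qed.

End cubature_side.

Theorem theorem2p6 (R : realType) (d : measure_display) (T : measurableType d)
    (P : probability T R) (H : R) (B : R -> {RV P >-> R})
    (hH : 2^-1 <= H < 1) (hB : is_fBm H B) :
  (H < 2 / 3 -> cubature_formula H B (weights R) (paths H) 5) /\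
  (2 / 3 <= H -> cubature_formula H B (weights R) (paths H) 4).
Proof.
have /andP[h1 h2] := hH; have H0 : 0 < H by lra.
have main : cubature_formula H B (weights R) (paths H) 5.
  move=> w /(word_degree_le hH) hw.
  rewrite (eq_bigr (fun j => weights R j * word_value (paths H j) w)); last first.
    by move=> j _; rewrite path_word_value.
  rewrite cubature_word_mean//; apply: fBm_iter_expectation => //.
  apply: eq_hasE (fBm_word_mean hB H0 hw) => // o.
  by rewrite evt_iterated//; exact: (fBm_cont01 hB).
split=> [_ //|_] w w4; apply: main; apply: le_trans w4 _.
by rewrite ler_nat.
Qed.
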